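(* Let $(S_n^{(1)},S_n^{(2)})_{n\ge 0}$ be a two-elephant walking model with memory parameters $p_1\in[0,1]$ and $p_2=1/2$, and let $\alpha_1=2p_1-1$. (i) There is a constant $C(\alpha_1)>0$ depending only on $\alpha_1$ such that, almost surely, $$C(\alpha_1)\le \limsup_{n\to\infty}\frac{S_n^{(1)}}{\sqrt{2n\log\log n}}\le 1+\sqrt{2}\,|\alpha_1|.$$ In particular, $S^{(1)}$ is recurrent: almost surely every integer is visited by $(S^{(1)}_n)_{n\ge0}$ infinitely often. (ii) As $n\to\infty$, $$\frac{S_n^{(1)}}{\sqrt{(1+2\alpha_1^2)n}}\ \xrightarrow{\ D\ }\ \mathcal N(0,1),$$ where $\xrightarrow{D}$ denotes convergence in distribution and $\mathcal N(0,1)$ is the standard normal law.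
   Context: Two-elephant walking model: fix $p_1,p_2\in[0,1]$. Let $(\xi_n^{(1)})_{n\ge2}$ be i.i.d. Bernoulli($p_1$) random variables, $(\xi_n^{(2)})_{n\ge2}$ i.i.d. Bernoulli($p_2$) random variables, and $(u_n^{(1)})_{n\ge1}$, $(u_n^{(2)})_{n\ge1}$ independent random variables with each $u_n^{(i)}$ uniformly distributed on $\{1,2,\dots,n\}$; all these families are mutually independent. Set $S_0^{(1)}=S_0^{(2)}=0$ and let the initial steps $X_1^{(1)},X_1^{(2)}\in\{-1,1\}$ be given. For $n\ge1$ define $$X_{n+1}^{(1)}:=\xi^{(1)}_{n+1}X^{(2)}_{u_n^{(2)}}-(1-\xi^{(1)}_{n+1})X^{(2)}_{u_n^{(2)}},\qquad X_{n+1}^{(2)}:=\xi^{(2)}_{n+1}X^{(1)}_{u_n^{(1)}}-(1-\xi^{(2)}_{n+1})X^{(1)}_{u_n^{(1)}},$$ and $S_n^{(i)}:=\sum_{k=1}^n X_k^{(i)}$ for $i=1,2$. Thus each elephant picks uniformly one of its partner's past steps and repeats it with probability $p_i$, otherwise takes its opposite. When $p_2=1/2$, $S^{(2)}$ is a simple random walk. *)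

(* Defs.v *)
From HB Require Import structures.
From mathcomp Require Import all_boot all_order all_algebra.
From mathcomp Require Import all_classical all_reals all_analysis.
From mathcomp Require Import normal_distribution.
Set Implicit Arguments. Unset Strict Implicit. Unset Printing Implicit Defensive.
Import Order.TTheory GRing.Theory Num.Theory.
Import numFieldNormedType.Exports.
Local Open Scope classical_set_scope.
Local Open Scope ring_scope.

Inductive ew_idx := IXi1 of nat | IXi2 of nat | IU1 of nat | IU2 of nat.

Definition ew_idx_eq_dec : comparable ew_idx.
Proof. move=> x y; rewrite /decidable; decide equality; apply: decP; exact: eqP. Defined.
HB.instance Definition _ := comparableMixin ew_idx_eq_dec.

Definition ew_valid (i : ew_idx) : bool :=
  match i with
  | IXi1 n | IXi2 n => (2 <= n)%N
  | IU1 n | IU2 n => (1 <= n)%N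
  end.

Definition ew_var (T : Type) (xi1 xi2 : nat -> T -> bool) (u1 u2 : nat -> T -> nat)
  (i : ew_idx) : T -> nat :=
  match i with
  | IXi1 n => fun w => nat_of_bool (xi1 n w)
  | IXi2 n => fun w => nat_of_bool (xi2 n w)
  | IU1 n => u1 n
  | IU2 n => u2 n
  end.

Definition mutually_independent_discrete d (T : measurableType d) (R : realType)
  (P : probability T R) (I : eqType) (valid : pred I) (Z : I -> T -> nat) : Prop :=
  (forall i, valid i -> forall v : nat, measurable [set w | Z i w = v]) /\
  forall (s : seq I) (v : I -> nat), uniq s -> all valid s ->
    P (\bigcap_(i in [set j | j \in s]) [set w | Z i w = v i]) =
    (\prod_(i <- s) P [set w | Z i w = v i])%E.

(* History of the pairs of steps (X_k^(1), X_k^(2)), k = 1..n, for outcome w. *)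
Fixpoint ew_hist (T : Type) (x1 x2 : int) (xi1 xi2 : nat -> T -> bool)
  (u1 u2 : nat -> T -> nat) (w : T) (n : nat) : seq (int * int) :=
  match n with
  | 0 => [::]
  | m.+1 =>
    match m with
    | 0 => [:: (x1, x2)]
    | k.+1 =>
      let h := ew_hist x1 x2 xi1 xi2 u1 u2 w m in
      (* X_{m+1}^(1) = (2 xi^(1)_{m+1} - 1) X^(2)_{u^(2)_m},
         X_{m+1}^(2) = (2 xi^(2)_{m+1} - 1) X^(1)_{u^(1)_m} *)
      let s1 : int := if xi1 m.+1 w then 1 else -1 in
      let s2 : int := if xi2 m.+1 w then 1 else -1 in
      rcons h (s1 * (nth (0, 0) h (u2 m w).-1).2,
               s2 * (nth (0, 0) h (u1 m w).-1).1)
    end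
  end.

Definition ew_S1 (T : Type) (x1 x2 : int) (xi1 xi2 : nat -> T -> bool)
  (u1 u2 : nat -> T -> nat) (n : nat) (w : T) : int :=
  \sum_(p <- ew_hist x1 x2 xi1 xi2 u1 u2 w n) p.1.

Definition two_elephant_model d (T : measurableType d) (R : realType)
  (P : probability T R) (p1 p2 : R)
  (xi1 xi2 : nat -> T -> bool) (u1 u2 : nat -> T -> nat) : Prop :=
  [/\ forall n, (2 <= n)%N -> P [set w | xi1 n w] = p1%:E,
      forall n, (2 <= n)%N -> P [set w | xi2 n w] = p2%:E,
      forall n k, (1 <= n)%N -> (1 <= k <= n)%N -> P [set w | u1 n w = k] = (n%:R^-1)%:E,
      forall n k, (1 <= n)%N -> (1 <= k <= n)%N -> P [set w | u2 n w = k] = (n%:R^-1)%:E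
    & mutually_independent_discrete P ew_valid (ew_var xi1 xi2 u1 u2)].

Definition cvg_in_distribution d (T : measurableType d) (R : realType)
  (P : probability T R) (Y : nat -> T -> R) (mu : set R -> \bar R) : Prop :=
  forall x : R, {for x, continuous (fun y : R => fine (mu [set` `]-oo, y]]))} ->
    (fun n => P [set w | Y n w <= x]) @ \oo --> mu [set` `]-oo, x]].

(* Main.v *)
(* Given the past, S^(2) makes a fair step, and independently S^(1) makes a step of mean
   alpha * S^(2)_k / k. Hence, up to a horizon N, S^(1)_k + c_k S^(2)_k is a martingale for
   c_k = alpha * (1/k + ... + 1/(N-1)); since c_N = 0 it ends at S^(1)_N, and its quadratic
   variation is (1 + 2 alpha^2) N up to lower order terms.

   For the upper bound, Hoeffding's lemma makes the exponential of the martingale a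
   supermartingale, and Ville's inequality is applied along a geometric sequence of
   horizons. This gives the constant sqrt (1 + 2 alpha^2) <= 1 + sqrt 2 |alpha|. For the
   lower bound, Paley-Zygmund applied to the same exponential gives, between two horizons
   of ratio 4^m, an upward jump of order sqrt (N log log N) with conditional probability at
   least 1 / (4 (j + 2)), j being the index of the horizon; infinitely many jumps occur
   because the harmonic series diverges. Recurrence follows by symmetry, the steps being
   +1 or -1. For the central limit theorem, a smoothed normal distribution function evolved
   by the heat equation is almost a martingale along the process, and the error is estimated
   by Taylor expansion. *)
Require Import Defs.
From HB Require Import structures.
From mathcomp Require Import all_boot all_order all_algebra.
From mathcomp Require Import all_classical all_reals all_analysis.
From mathcomp Require Import normal_distribution.
From mathcomp Require Import ring lra zify.
Set Implicit Arguments. Unset Strict Implicit. Unset Printing Implicit Defensive.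
Import Order.TTheory GRing.Theory Num.Theory.
Import numFieldNormedType.Exports.
Local Open Scope classical_set_scope.
Local Open Scope ring_scope.

(** * The process as a Markov chain of histories *)

(** The martingale depends on its horizon [N], because [c_k] does, so no single martingale limit
    theorem applies: each estimate is made for one [N] and has to be uniform enough to be combined
    over horizons. Since these estimates involve only histories of fixed finite length, conditional
    expectation is replaced by iterating an explicit four-branch averaging operator; the probability
    space enters only through the law of a history and through null sets. The factor 2 in
    [1 + 2 alpha ^ 2] is the integral of [(ln t) ^ 2] over [[0, 1]], the limiting average of the
    squared harmonic sums in [c_k]. Two points need care. Before the horizon the martingale differs
    from the walk by a multiple of [S^(2)], so the bounds for [S^(1)] rest on two-sided bounds for
    [S^(2)]. When [alpha] is 1 or -1, the step of [S^(1)] can be almost deterministic given the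
    past, so the lower bound must draw variance from the steps of [S^(2)], whose coefficients are
    large only well before the horizon. *)

Section Kernel.
Variables (R : realType) (alpha : R).
Hypothesis alpha_le1 : `|alpha| <= 1.

(* Histories are lists of pairs of steps, the latest first; [true] stands for [+1]. *)
Definition hist := seq (bool * bool).
Definition sgn (b : bool) : R := if b then 1 else -1.
Definition walk1 (h : hist) : R := \sum_(p <- h) sgn p.1.
Definition walk2 (h : hist) : R := \sum_(p <- h) sgn p.2.
Definition drift (h : hist) : R := alpha * walk2 h / (size h)%:R.

Definition ker (f : hist -> R) (h : hist) : R :=
  4^-1 * ((1 + drift h) * (f ((true, true) :: h) + f ((true, false) :: h))
        + (1 - drift h) * (f ((false, true) :: h) + f ((false, false) :: h))).

(* Expectation of [f] of the history obtained from [h] after [n] more steps. *)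
Definition expect (n : nat) (f : hist -> R) : hist -> R := iter n ker f.

Lemma sgn_norm b : `|sgn b| = 1.
Proof. by case: b; rewrite /sgn ?normrN normr1. Qed.

Lemma walk1_cons p h : walk1 (p :: h) = sgn p.1 + walk1 h.
Proof. by rewrite /walk1 big_cons. Qed.

Lemma walk2_cons p h : walk2 (p :: h) = sgn p.2 + walk2 h.
Proof. by rewrite /walk2 big_cons. Qed.

Lemma walk2_le h : `|walk2 h| <= (size h)%:R.
Proof.
elim: h => [|p h IH]; first by rewrite /walk2 big_nil normr0.
rewrite walk2_cons /= -natr1 (le_trans (ler_normD _ _))// sgn_norm.
by rewrite addrC lerD2r.
Qed.

Lemma drift_norm h : `|drift h| <= `|alpha|.
Proof.
rewrite /drift; case: h => [|p h].
  (* For the empty history [0^-1 = 0] makes the drift vanish. *)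
  by rewrite /= invr0 mulr0 normr0.
rewrite !normrM -mulrA ler_piMr // normfV normr_nat ler_pdivrMr ?ltr0n //.
by rewrite mul1r walk2_le.
Qed.

Lemma drift_itv h : -1 <= drift h <= 1.
Proof. by rewrite -ler_norml (le_trans (drift_norm h)). Qed.

Lemma ker_le f g h : (forall p, f (p :: h) <= g (p :: h)) -> ker f h <= ker g h.
Proof.
move=> fg; have := drift_itv h => /andP[m1 m2]; rewrite /ker.
have := fg (true, true); have := fg (true, false).
have := fg (false, true); have := fg (false, false) => a1 a2 a3 a4.
rewrite ler_pM2l ?invr_gt0 ?ltr0n// lerD // ler_wpM2l // ?lerD//; lra.
Qed.

Lemma kerE f g h : (forall p, f (p :: h) = g (p :: h)) -> ker f h = ker g h.
Proof. by move=> fg; rewrite /ker !fg. Qed.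

Lemma ker_cst c h : ker (fun=> c) h = c.
Proof. rewrite /ker; lra. Qed.

Lemma kerD f g h : ker (fun x => f x + g x) h = ker f h + ker g h.
Proof. rewrite /ker; lra. Qed.

Lemma kerZ c f h : ker (fun x => c * f x) h = c * ker f h.
Proof. rewrite /ker; lra. Qed.

Lemma expectS n f h : expect n.+1 f h = ker (expect n f) h.
Proof. by []. Qed.

Lemma expectSr n f h : expect n.+1 f h = expect n (ker f) h.
Proof. by rewrite /expect iterSr. Qed.

Lemma expect_add m n f h : expect (m + n) f h = expect m (expect n f) h.
Proof. by rewrite /expect iterD. Qed.

(** The histories over which [expect n f h] averages; recording their length and their beginning
    allows [f] to be estimated only there. *)
Definition extends (n : nat) (h h' : hist) := size h' = (n + size h)%N /\ drop n h' = h.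

Lemma extends_cons n h h' p : extends n (p :: h) h' -> extends n.+1 h h'.
Proof.
move=> [s d]; split; first by rewrite s /= addnS.
by rewrite -addn1 addnC -drop_drop d /= drop0.
Qed.

Lemma expect_le n f g h : (forall h', extends n h h' -> f h' <= g h') ->
  expect n f h <= expect n g h.
Proof.
elim: n h => [|n IH] h fg; first by apply: fg; split; rewrite ?drop0.
rewrite !expectS; apply: ker_le => p; apply: IH => h' /extends_cons; exact: fg.
Qed.

Lemma expect_eq n f g h : (forall h', extends n h h' -> f h' = g h') ->
  expect n f h = expect n g h.
Proof.
by move=> fg; apply/eqP; rewrite eq_le !expect_le // => h' /fg ->.
Qed.

Lemma expect_cst n c h : expect n (fun=> c) h = c.
Proof.
elim: n h => [|n IH] h //; rewrite expectS -[RHS](ker_cst c h).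
by apply: kerE => p; exact: IH.
Qed.

Lemma expectD n f g h :
  expect n (fun x => f x + g x) h = expect n f h + expect n g h.
Proof.
elim: n h => [|n IH] h //; rewrite !expectS -kerD.
by apply: kerE => p; exact: IH.
Qed.

Lemma expectZ n c f h : expect n (fun x => c * f x) h = c * expect n f h.
Proof.
elim: n h => [|n IH] h //; rewrite !expectS -kerZ.
by apply: kerE => p; exact: IH.
Qed.

Lemma expectB n f g h :
  expect n (fun x => f x - g x) h = expect n f h - expect n g h.
Proof.
rewrite -mulN1r -expectZ -expectD.
by apply: expect_eq => h' _; rewrite mulN1r.
Qed.

Lemma expect_sum n (I : Type) (r : seq I) (F : I -> hist -> R) h :
  expect n (fun x => \sum_(i <- r) F i x) h = \sum_(i <- r) expect n (F i) h.
Proof.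
elim: r => [|i r IH].
  rewrite big_nil -[RHS](expect_cst n 0 h).
  by apply: expect_eq => h' _; rewrite big_nil.
rewrite big_cons -IH -expectD.
by apply: expect_eq => h' _; rewrite big_cons.
Qed.

Lemma expect_ge0 n f h : (forall h', extends n h h' -> 0 <= f h') ->
  0 <= expect n f h.
Proof. by move=> f0; rewrite -(expect_cst n 0 h) expect_le. Qed.

Lemma expect_norm n f h : `|expect n f h| <= expect n (fun x => `|f x|) h.
Proof.
rewrite ler_norml -mulN1r -expectZ !expect_le // => h' _.
  by rewrite ler_norm.
by rewrite mulN1r lerNl -normrN ler_norm.
Qed.

(** Conditioning on the present: what depends only on the beginning of the history is constant
    during the remaining [n] steps. *)
Lemma expect_drop n (f : hist -> hist -> R) h :
  expect n (fun h' => f (drop n h') h') h = expect n (f h) h.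
Proof. by apply: expect_eq => h' [_ ->]. Qed.

Lemma expect_supermart n (G : hist -> R) h :
  (forall h', (size h <= size h' < size h + n)%N -> ker G h' <= G h') ->
  expect n G h <= G h.
Proof.
elim: n => [|n IH] hG //; rewrite expectSr.
apply: le_trans (IH _); last first.
  move=> h' /andP[h1 h2]; apply: hG; rewrite h1 /=; lia.
apply: expect_le => h' [sh _]; apply: hG; rewrite sh; lia.
Qed.

(** Since a history contains its whole past, a statement about the maximum over time becomes an
    event about the final history. *)
Fixpoint hits (B : hist -> bool) (h : hist) : bool :=
  if h is p :: t then B h || hits B t else false.

(* Ville's maximal inequality: stopping [G] at the first hit keeps it a supermartingale. *)
Lemma ville n (B : hist -> bool) (G : hist -> R) h :
  (forall h', 0 <= G h') ->
  (forall h', (size h <= size h' < size h + n)%N -> ker G h' <= G h') ->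
  (forall h', (size h <= size h' <= size h + n)%N -> B h' -> 1 <= G h') ->
  ~~ hits B h ->
  expect n (fun h' => (hits B h')%:R) h <= G h.
Proof.
move=> G0 Gs GB nB.
pose G' h' := if hits B h' then 1 else G h'.
have GG' : G' h = G h by rewrite /G' (negPf nB).
rewrite -GG'; apply: (@le_trans _ _ (expect n G' h)).
  by apply: expect_le => h' _; rewrite /G'; case: ifP.
apply: expect_supermart => h' hs; rewrite /G'; case: ifPn => hB.
  rewrite -[leRHS](ker_cst 1 h'); apply: ker_le => p.
  by rewrite /= hB orbT.
apply: le_trans (Gs _ hs); apply: ker_le => p.
rewrite /= (negPf hB) orbF; case: ifPn => // Bp; apply: GB => //=; lia.
Qed.

End Kernel.

(** * The two-point Hoeffding inequality *)

Section RealAnalysis.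
Variable R : realType.
Implicit Types f g : R -> R.

Lemma is_derive_add f g (x a b c : R) : is_derive x 1 f a -> is_derive x 1 g b ->
  c = a + b -> is_derive x 1 (fun y => f y + g y) c.
Proof. by move=> ? ? ->; exact: is_deriveD. Qed.

Lemma is_derive_mul f g (x a b c : R) : is_derive x 1 f a -> is_derive x 1 g b ->
  c = f x * b + g x * a -> is_derive x 1 (fun y => f y * g y) c.
Proof. by move=> ? ? ->; exact: is_deriveM. Qed.

Lemma is_derive_const (k x : R) : is_derive x 1 (fun=> k) 0.
Proof. exact: is_derive_cst. Qed.

Lemma is_derive_opp f (x a c : R) : is_derive x 1 f a ->
  c = - a -> is_derive x 1 (fun y => - f y) c.
Proof. by move=> ? ->; exact: is_deriveN. Qed.

Lemma is_derive_lin (k x : R) : is_derive x 1 (fun y => k * y) k.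
Proof.
apply: (is_derive_mul (is_derive_const k x) (is_derive_id x 1)).
by rewrite mulr0 addr0 mulr1.
Qed.

Lemma is_derive_chain f g (x a b c : R) : is_derive (g x) 1 f a -> is_derive x 1 g b ->
  c = a * b -> is_derive x 1 (fun y => f (g y)) c.
Proof. by move=> ? ? ->; exact: is_derive1_comp. Qed.

Lemma is_derive_inv f (x a c : R) : f x != 0 -> is_derive x 1 f a ->
  c = - a / f x ^+ 2 -> is_derive x 1 (fun y => (f y)^-1) c.
Proof.
move=> f0 df ->; rewrite (_ : _ / _ = - (f x) ^- 2 *: a); first exact: is_deriveV.
by rewrite -[RHS]/(_ * _) !mulNr mulrC.
Qed.

Lemma ge0_derive_le f (df : R -> R) : (forall x : R, 0 <= x -> is_derive x 1 f (df x)) ->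
  (forall x : R, 0 <= x -> 0 <= df x) -> forall x : R, 0 <= x -> f 0 <= f x.
Proof.
move=> fdf df0 x x0; rewrite -subr_ge0.
have [c|c|c c0 ->] := @MVT_segment R f df 0 x x0.
- by rewrite in_itv /= => /andP[c0 _]; apply: fdf; exact: ltW.
- apply: derivable_within_continuous => y; rewrite in_itv /= => /andP[y0 _].
  by have [] := fdf _ y0.
- rewrite mulr_ge0 ?subr_ge0//; apply: df0.
  by move: c0; rewrite in_itv /= => /andP[].
Qed.

Let tilt (m x : R) := (1 + m) * expR x + (1 - m) * expR (- x).
Let dtilt (m x : R) := (1 + m) * expR x - (1 - m) * expR (- x).

Let tilt_gt0 (m x : R) : -1 <= m <= 1 -> 0 < tilt m x.
Proof.
move=> /andP[m1 m2]; rewrite /tilt.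
have a := expR_gt0 x; have b := expR_gt0 (- x).
have [m0|m0] := leP 0 m.
  have : 0 <= (1 - m) * expR (- x) by apply: mulr_ge0; [lra|exact: ltW].
  have : 0 < (1 + m) * expR x by rewrite mulr_gt0//; lra.
  lra.
have : 0 <= (1 + m) * expR x by apply: mulr_ge0; [lra|exact: ltW].
have : 0 < (1 - m) * expR (- x) by rewrite mulr_gt0//; lra.
lra.
Qed.

Let is_derive_expN (x : R) : is_derive x 1 (fun y => expR (- y)) (- expR (- x)).
Proof.
apply: (is_derive_chain (is_derive_expR _) (is_derive_opp (is_derive_id x 1) erefl)).
by rewrite mulrN1.
Qed.

Let is_derive_tilt (m x : R) : is_derive x 1 (tilt m) (dtilt m x).
Proof.
apply: (is_derive_add (is_derive_mul (is_derive_const _ _) (is_derive_expR x) erefl)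
  (is_derive_mul (is_derive_const _ _) (is_derive_expN x) erefl)).
rewrite /dtilt; ring.
Qed.

Let is_derive_dtilt (m x : R) : is_derive x 1 (dtilt m) (tilt m x).
Proof.
apply: (is_derive_add (is_derive_mul (is_derive_const _ _) (is_derive_expR x) erefl)
  (is_derive_opp (is_derive_mul (is_derive_const _ _) (is_derive_expN x) erefl) erefl)).
rewrite /tilt; ring.
Qed.

(* With [r] the logarithmic derivative of [tilt m], [r' = 1 - r ^ 2 <= 1], hence
   [ln (tilt m x) <= ln (tilt m 0) + m x + x ^ 2 / 2]. *)
Let ln_tilt_le (m x : R) : -1 <= m <= 1 -> 0 <= x ->
  ln (tilt m x) <= ln 2 + m * x + x ^+ 2 / 2.
Proof.
move=> m1 x0; have A0 y := tilt_gt0 y m1.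
have tilt0 : tilt m 0 = 2 by rewrite /tilt oppr0 expR0; ring.
pose g y := m + y - dtilt m y / tilt m y.
have g0 y : 0 <= y -> 0 <= g y.
  move=> y0.
  have -> : 0 = g 0 by rewrite /g tilt0 /dtilt oppr0 expR0; lra.
  apply: (@ge0_derive_le g (fun z => (dtilt m z / tilt m z) ^+ 2)) y0.
    move=> z _; apply: (is_derive_add
      (is_derive_add (is_derive_const m z) (is_derive_id z 1) erefl)
      (is_derive_opp (is_derive_mul (is_derive_dtilt m z)
        (is_derive_inv _ (is_derive_tilt m z) erefl) erefl) erefl)).
      by rewrite gt_eqF.
    by field; rewrite gt_eqF.
  by move=> z _; rewrite sqr_ge0.
pose f y := m * y + y * y / 2 - ln (tilt m y).
have : f 0 <= f x; last by rewrite /f tilt0 expr2; lra.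
apply: (@ge0_derive_le f g) => // z _.
apply: (is_derive_add (is_derive_add (is_derive_lin m z)
  (is_derive_mul (is_derive_mul (is_derive_id z 1) (is_derive_id z 1) erefl)
   (is_derive_const _ _) erefl) erefl)
  (is_derive_opp (is_derive_chain (is_derive1_ln (A0 z)) (is_derive_tilt m z) erefl)
   erefl)).
rewrite /g; field; by rewrite gt_eqF.
Qed.

(** The centred variable with values [1 - m] and [-1 - m] has variance proxy 1 whatever [m] is; this
    uniformity lets a random drift be treated with a deterministic bound. Exchanging the two values
    reduces negative [x] to positive [x]. *)
Lemma hoeffding_two_point (m x : R) : -1 <= m <= 1 ->
  (1 + m) / 2 * expR (x * (1 - m)) + (1 - m) / 2 * expR (x * (-1 - m))
    <= expR (x ^+ 2 / 2).
Proof.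
wlog x0 : m x / 0 <= x.
  move=> H m1; have [x0|x0] := leP 0 x; first exact: H.
  have := H (- m) (- x); rewrite sqrrN opprK.
  have -> : - x * (1 + m) = x * (-1 - m) by ring.
  have -> : - x * (-1 + m) = x * (1 - m) by ring.
  by rewrite addrC; apply; lra.
move=> m1; have := ln_tilt_le m1 x0.
have A0 := tilt_gt0 x m1.
rewrite -ler_expR lnK ?posrE// !expRD lnK ?posrE// => H.
rewrite !mulrBr mulr1 mulrN1 !expRD [expR (- (x * m))]expRN [x * m]mulrC.
set E := expR (m * x) in H *; have E0 : 0 < E := expR_gt0 _.
have -> : forall a b : R, (1 + m) / 2 * (a / E) + (1 - m) / 2 * (b / E) =
  ((1 + m) * a + (1 - m) * b) / (2 * E).
  by move=> a b; field; lra.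
rewrite ler_pdivrMr ?mulr_gt0//; apply: le_trans H _.
by rewrite [leRHS]mulrC.
Qed.

(** Square [1 + x / 2 <= expR (x / 2)], whose left side is nonnegative exactly when [-2 <= x]. This
    is the counterpart from below of Hoeffding's bound. *)
Lemma expR_ge_quadratic (x : R) : -2 <= x -> 1 + x + x ^+ 2 / 4 <= expR x.
Proof.
move=> x2; have -> : x = x / 2 + x / 2 by field.
rewrite [expR (_ + _)]expRD -expr2.
have h := expR_ge1Dx (x / 2).
have : (1 + x / 2) ^+ 2 <= expR (x / 2) ^+ 2 by rewrite lerXn2r ?nnegrE ?expR_ge0//; lra.
by apply: le_trans; rewrite le_eqVlt; apply/orP; left; apply/eqP; field.
Qed.

End RealAnalysis.

(** * Martingales of the two walks *)

Section Harmonic.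
Variable R : realType.

Definition harm (k N : nat) : R := \sum_(k <= i < N) i%:R^-1.

Lemma harm_geq k N : (N <= k)%N -> harm k N = 0.
Proof. by move=> Nk; rewrite /harm big_geq. Qed.

Lemma harm_recl k N : (k < N)%N -> harm k N = k%:R^-1 + harm k.+1 N.
Proof. by move=> kN; rewrite /harm big_ltn. Qed.

Lemma harm_recr k N : (k <= N)%N -> harm k N.+1 = harm k N + N%:R^-1.
Proof. by move=> kN; rewrite /harm big_nat_recr. Qed.

Lemma harm_cat k m N : (k <= m <= N)%N -> harm k N = harm k m + harm m N.
Proof. by move=> /andP[km mN]; rewrite /harm -big_cat_nat. Qed.

Lemma harm_ge0 k N : 0 <= harm k N.
Proof. by apply: sumr_ge0 => i _; rewrite invr_ge0. Qed.

Lemma harm_anti k m N : (k <= m)%N -> harm m N <= harm k N.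
Proof.
move=> km; have [mN|Nm] := leqP m N; last by rewrite harm_geq ?harm_ge0// ltnW.
by rewrite (@harm_cat k m N) ?km// lerDr harm_ge0.
Qed.

Lemma harm_le k N : (0 < k)%N -> harm k N <= (N - k)%:R / k%:R.
Proof.
move=> k0; rewrite /harm; apply: (@le_trans _ _ (\sum_(k <= i < N) k%:R^-1)).
  apply: ler_sum_nat => i /andP[ki _].
  by rewrite lef_pV2 ?posrE ?ltr0n ?ler_nat// (leq_trans k0).
by rewrite sumr_const_nat mulr_natl.
Qed.

Lemma harm_ge k N : (0 < k)%N -> (N - k)%:R / N%:R <= harm k N.
Proof.
move=> k0; rewrite /harm; apply: (@le_trans _ _ (\sum_(k <= i < N) N%:R^-1)).
  by rewrite sumr_const_nat mulr_natl.
apply: ler_sum_nat => i /andP[ki iN].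
by rewrite lef_pV2 ?posrE ?ltr0n ?ler_nat//; lia.
Qed.

(** Each block from [k] to [4 k] contributes at most [(4 k - k) / k = 3]. A bound linear in [m] is
    enough against the factor [2 ^ m] gained by a jump. *)
Lemma harm_pow4 m k : (0 < k)%N -> harm k (4 ^ m * k) <= 3 * m%:R.
Proof.
move=> k0; elim: m => [|m IH]; first by rewrite mul1n harm_geq ?mulr0.
have p0 : (0 < 4 ^ m)%N by rewrite expn_gt0.
rewrite (@harm_cat k (4 ^ m * k)); last first.
  by rewrite leq_pmull// leq_mul2r leq_exp2l ?leqnSn ?orbT.
rewrite -[m.+1%:R]natr1 mulrDr lerD// mulr1 expnS -mulnA.
apply: le_trans (@harm_le _ _ _) _; first by rewrite muln_gt0 p0.
rewrite ler_pdivrMr ?ltr0n ?muln_gt0 ?p0// -natrM ler_nat; lia.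
Qed.

Lemma invS_le_lnB N : N.+2%:R^-1 <= ln N.+2%:R - ln N.+1%:R :> R.
Proof.
rewrite -ln_div ?posrE ?ltr0n//.
have -> : N.+2%:R / N.+1%:R = (1 - N.+2%:R^-1 : R)^-1.
  rewrite -[N.+2%:R]natr1; have : 0 < N.+1%:R :> R by rewrite ltr0n.
  by set x := N.+1%:R => x0; field; apply/andP; split; lra.
rewrite lnV; last first.
  by rewrite posrE subr_gt0 invf_lt1 ?ltr0n// ltr1n.
by rewrite lerNr; apply: le_ln1Dx; rewrite ltrN2 invf_lt1 ?ltr0n// ltr1n.
Qed.

Lemma harm_ln N : (0 < N)%N -> harm 1 N <= 1 + ln N%:R.
Proof.
case: N => [//|[|N] _]; first by rewrite harm_geq// ln1 addr0.
suff : harm 1 N.+2 <= 1 + ln N.+1%:R.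
  by move=> /le_trans; apply; rewrite lerD2l ler_ln ?posrE ?ltr0n// ler_nat.
elim: N => [|N IH]; first by rewrite /harm big_nat1 invr1 ln1 addr0.
rewrite harm_recr//; apply: (@le_trans _ _ (1 + ln N.+1%:R + N.+2%:R^-1)).
  by rewrite lerD2r.
by rewrite -addrA lerD2l -lerBrDl invS_le_lnB.
Qed.

(** The term [1 / i] occurs in exactly [i] of the sums. *)
Lemma sum_harm N : \sum_(1 <= k < N.+1) harm k N.+1 = N%:R.
Proof.
elim: N => [|N IH]; first by rewrite big_geq.
rewrite big_nat_recr//= (eq_big_nat _ _ (F2 := fun k => harm k N.+1 + N.+1%:R^-1)); last first.
  by move=> k /andP[_ kN]; rewrite harm_recr// ltnW.
rewrite big_split/= IH sumr_const_nat harm_recr// harm_geq// add0r subn1 /=.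
rewrite -mulr_natl -[N.+1%:R]natr1; field.
by rewrite natr1 pnatr_eq0.
Qed.

(** One more index adds a cross term to each square, and [sum_harm] evaluates these. The resulting 2
    is the one in [1 + 2 alpha ^ 2]. *)
Lemma sum_sqr_harm N :
  \sum_(1 <= k < N.+1) harm k N.+1 ^+ 2 = 2 * N%:R - harm 1 N.+1.
Proof.
elim: N => [|N IH]; first by rewrite big_geq// harm_geq// mulr0 subr0.
rewrite big_nat_recr//= (eq_big_nat _ _ (F2 := fun k => harm k N.+1 ^+ 2 +
   (2 * N.+1%:R^-1 * harm k N.+1 + N.+1%:R^-1 ^+ 2))); last first.
  by move=> k /andP[_ kN]; rewrite harm_recr 1?ltnW//; ring.
rewrite !big_split/= IH -mulr_sumr sum_harm sumr_const_nat.
rewrite (@harm_recr N.+1)// (@harm_geq N.+1)// add0r subn1 /= (@harm_recr 1 N.+1)//.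
rewrite -[_ ^+ 2 *+ N]mulr_natl -[N.+1%:R]natr1; field.
by rewrite natr1 pnatr_eq0.
Qed.

End Harmonic.

(** * Exponential moments of one martingale step *)

Section Martingale.
Variables (R : realType) (alpha : R).
Hypothesis alpha_le1 : `|alpha| <= 1.
Implicit Types (a l : R) (c : nat -> R) (h : hist).

(** The weight [a] serves three uses: [1] and [-1] give the first walk with either sign, and [0]
    with a constant [c] gives the second walk alone. *)
Definition mart a c h := a * walk1 R h + c (size h) * walk2 R h.

(* The condition that makes [mart a c] a martingale up to time [N]. *)
Definition mart_coef a c N :=
  forall k, (0 < k < N)%N -> c k = c k.+1 + a * alpha / k%:R.

Definition incr a (d : R) h (p : bool * bool) :=
  a * (sgn R p.1 - drift alpha h) + d * sgn R p.2.

Lemma mart_cons a c N h p : mart_coef a c N -> (0 < size h < N)%N ->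
  mart a c (p :: h) = mart a c h + incr a (c (size h).+1) h p.
Proof.
move=> cP hN; rewrite /mart /incr walk1_cons walk2_cons /= (cP _ hN) /drift.
have : (size h)%:R != 0 :> R by rewrite pnatr_eq0 -lt0n; case/andP: hN.
by move: (_%:R) => x x0; field.
Qed.

Lemma ker_prod (F : hist -> R) (K : R) (u v : bool -> R) h :
  (forall p, F (p :: h) = K * (u p.1 * v p.2)) ->
  ker alpha F h = K * ((1 + drift alpha h) / 2 * u true + (1 - drift alpha h) / 2 * u false)
    * ((v true + v false) / 2).
Proof. by move=> FE; rewrite /ker !FE /=; field. Qed.

(** Given the past, [incr] is centred and its two parts are uncorrelated, so the linear term
    disappears and the variances add. *)
Lemma ker_incr a (d : R) h (G : hist -> R) (x y z : R) :
  (forall p, G (p :: h) = x + y * incr a d h p + z * incr a d h p ^+ 2) ->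
  ker alpha G h = x + z * (a ^+ 2 * (1 - drift alpha h ^+ 2) + d ^+ 2).
Proof. by move=> GE; rewrite /ker !GE /incr /sgn /=; field. Qed.

Lemma ker_expR_le a c N l h : mart_coef a c N -> (0 < size h < N)%N ->
  ker alpha (fun h => expR (l * mart a c h)) h <=
  expR (l * mart a c h + l ^+ 2 / 2 * (a ^+ 2 + c (size h).+1 ^+ 2)).
Proof.
move=> cP hN; set d := c (size h).+1.
rewrite (@ker_prod _ (expR (l * mart a c h))
  (fun b => expR (l * a * (sgn R b - drift alpha h)))
  (fun b => expR (l * d * sgn R b))); last first.
  move=> p; rewrite (mart_cons _ cP hN) -!expRD; congr expR.
  by rewrite /incr -/d; ring.
rewrite expRD -mulrA ler_pM2l ?expR_gt0//.
rewrite [_ * (a ^+ 2 + _)]mulrDr expRD; apply: ler_pM.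
- have /andP[d1 d2] := drift_itv alpha_le1 h.
  by rewrite addr_ge0// mulr_ge0 ?expR_ge0// divr_ge0//; lra.
- by rewrite divr_ge0// addr_ge0 ?expR_ge0.
- apply: le_trans (hoeffding_two_point (l * a) (drift_itv alpha_le1 h)) _.
  by rewrite le_eqVlt; apply/orP; left; apply/eqP; congr expR; field.
- have := @hoeffding_two_point R 0 (l * d).
  rewrite oppr_le0 ler01 /sgn !subr0 addr0 => /(_ isT).
  rewrite -mulrDr mul1r mulrC => /le_trans; apply.
  by rewrite le_eqVlt; apply/orP; left; apply/eqP; congr expR; field.
Qed.

Lemma ker_expR_ge a c N l h : mart_coef a c N -> (0 < size h < N)%N ->
  (forall p, -2 <= l * incr a (c (size h).+1) h p) ->
  expR (l * mart a c h) *
    (1 + l ^+ 2 / 4 * (a ^+ 2 * (1 - drift alpha h ^+ 2) + c (size h).+1 ^+ 2)) <=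
  ker alpha (fun h => expR (l * mart a c h)) h.
Proof.
move=> cP hN small; set d := c (size h).+1.
(* The quadratic minorant as a function of histories; [ker] never reads its value on the empty
   history. *)
pose G h' := if h' is p :: _ then expR (l * mart a c h) *
  (1 + l * incr a d h p + l ^+ 2 / 4 * incr a d h p ^+ 2) else 0.
rewrite [leLHS](_ : _ = ker alpha G h); last first.
  rewrite (@ker_incr a d h G (expR (l * mart a c h)) (expR (l * mart a c h) * l)
    (expR (l * mart a c h) * (l ^+ 2 / 4))); first by ring.
  by move=> p; rewrite /G; ring.
apply: (ker_le alpha_le1) => p; rewrite /G (mart_cons _ cP hN) [l * (_ + _)]mulrDr expRD.
rewrite ler_pM2l ?expR_gt0//; apply: le_trans (expR_ge_quadratic (small p)).
by rewrite le_eqVlt; apply/orP; left; apply/eqP; rewrite -/d; field.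
Qed.

End Martingale.

(** * Maximal inequality, exponential moments and the Paley-Zygmund bound *)

Section Tail.
Variables (R : realType) (alpha : R).
Hypothesis alpha_le1 : `|alpha| <= 1.
Implicit Types (a l : R) (c : nat -> R) (h : hist).

(** The conditional variances without the random [drift ^ 2] term: a deterministic majorant of the
    bracket, which is what Hoeffding's bound produces. *)
Definition qvar a c (m n : nat) : R := \sum_(m <= k < n) (a ^+ 2 + c k.+1 ^+ 2).

Lemma qvar_ge0 a c m n : 0 <= qvar a c m n.
Proof. by apply: sumr_ge0 => i _; rewrite addr_ge0 ?sqr_ge0. Qed.

Lemma qvar_recr a c m n : (m <= n)%N ->
  qvar a c m n.+1 = qvar a c m n + (a ^+ 2 + c n.+1 ^+ 2).
Proof. by move=> mn; rewrite /qvar big_nat_recr. Qed.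

Lemma qvar_cat a c m n k : (m <= n <= k)%N ->
  qvar a c m k = qvar a c m n + qvar a c n k.
Proof. by move=> /andP[mn nk]; rewrite /qvar -big_cat_nat. Qed.

Lemma qvar_le a c m n k : (n <= k)%N -> qvar a c m n <= qvar a c m k.
Proof.
move=> nk; have [mn|nm] := leqP m n.
  by rewrite (@qvar_cat _ _ m n k) ?mn// lerDl qvar_ge0.
by rewrite {1}/qvar big_geq ?qvar_ge0// ltnW.
Qed.

Definition expmart a c l m h :=
  expR (l * mart a c h - l ^+ 2 / 2 * qvar a c m (size h)).

Lemma ker_expR_supermart a c N l m h : mart_coef alpha a c N ->
  (0 < m <= size h)%N -> (size h < N)%N ->
  ker alpha (expmart a c l m) h <= expmart a c l m h.
Proof.
move=> cP /andP[m0 mh] hN; rewrite {2}/expmart; set G := expmart a c l m.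
have h0 : (0 < size h)%N by exact: leq_trans mh.
have -> : ker alpha G h = expR (- (l ^+ 2 / 2 * qvar a c m (size h).+1)) *
    ker alpha (fun h => expR (l * mart a c h)) h.
  rewrite -kerZ; apply: kerE => p.
  by rewrite /G /expmart addrC expRD.
apply: (@le_trans _ _ (expR (- (l ^+ 2 / 2 * qvar a c m (size h).+1)) *
   expR (l * mart a c h + l ^+ 2 / 2 * (a ^+ 2 + c (size h).+1 ^+ 2)))).
  by rewrite ler_pM2l ?expR_gt0// (ker_expR_le alpha_le1 _ cP)// h0.
by rewrite -expRD qvar_recr// ler_expR le_eqVlt; apply/orP; left; apply/eqP; ring.
Qed.

(** Ville's inequality for the exponential supermartingale turns a bound on the total variance into
    a Gaussian tail for the maximum; [b] absorbs the starting value. *)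
Lemma expect_hits_le a c n y V b p : mart_coef alpha a c n.+1 ->
  0 <= y -> 0 < V -> qvar a c 1 n.+1 <= V -> mart a c [:: p] <= b ->
  expect alpha n (fun h => (hits (fun h' => y + b <= mart a c h') h)%:R) [:: p]
    <= expR (- (y ^+ 2 / (2 * V))).
Proof.
move=> cP y0 V0 qV pb; set B := fun h' => y + b <= mart a c h'.
set l := y / V.
have l0 : 0 <= l by rewrite divr_ge0// ltW.
have lV : l * y - l ^+ 2 / 2 * V = y ^+ 2 / (2 * V).
  by rewrite /l; field; rewrite gt_eqF.
pose G := expmart a c l 1.
pose G' h := expR (- (l * (y + b) - l ^+ 2 / 2 * V)) * G h.
have G'0 h : 0 <= G' h by rewrite mulr_ge0 ?expR_ge0.
have G'p : G' [:: p] <= expR (- (y ^+ 2 / (2 * V))).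
  rewrite /G' /G /expmart -expRD /= /qvar big_geq// mulr0 subr0 ler_expR -lV.
  have : l * mart a c [:: p] <= l * b by rewrite ler_wpM2l.
  by rewrite mulrDr; lra.
have GB h : (size h <= n.+1)%N -> B h -> 1 <= G' h.
  move=> hn; rewrite /B /G' /G /expmart => yb; rewrite -expRD -[leLHS]expR0 ler_expR.
  have : l * (y + b) <= l * mart a c h by rewrite ler_wpM2l.
  have : l ^+ 2 / 2 * qvar a c 1 (size h) <= l ^+ 2 / 2 * V.
    rewrite ler_wpM2l ?divr_ge0 ?sqr_ge0//.
    by apply: le_trans qV; exact: qvar_le.
  lra.
(* If the starting history is already a hit, [ville] does not apply, but then [G' [:: p]] is at
   least 1. *)
apply: le_trans G'p; have [hp|hp] := boolP (hits B [:: p]).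
  apply: (@le_trans _ _ 1).
    rewrite -[leRHS](expect_cst alpha n 1 [:: p]); apply: (expect_le alpha_le1) => h' _.
    by case: (hits _ _).
  by apply: GB => //; move: hp; rewrite /= orbF.
apply: (ville alpha_le1) => //.
  move=> h /= /andP[h1 h2]; rewrite kerZ ler_wpM2l ?expR_ge0//.
  by apply: (ker_expR_supermart _ cP) => //; rewrite -ltnS -add1n.
by move=> h /= /andP[_]; rewrite add1n; exact: GB.
Qed.

Lemma expect_expR_le a c N l n h : mart_coef alpha a c N ->
  (0 < size h)%N -> (size h + n <= N)%N ->
  expect alpha n (fun h' => expR (l * mart a c h')) h <=
  expR (l * mart a c h + l ^+ 2 / 2 * qvar a c (size h) (size h + n)).
Proof.
move=> cP h0 hN.
pose G := expmart a c l (size h).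
have : expect alpha n G h <= G h.
  apply: (expect_supermart alpha_le1) => h' /andP[h1 h2].
  by apply: (ker_expR_supermart _ cP); rewrite ?h0//; exact: leq_trans hN.
rewrite {2}/G /expmart /qvar big_geq// mulr0 subr0 => GG.
rewrite [leLHS](_ : _ = expR (l ^+ 2 / 2 * qvar a c (size h) (size h + n)) *
   expect alpha n G h); last first.
  rewrite -expectZ; apply: (expect_eq alpha_le1) => h' [sh' _].
  by rewrite /G /expmart -expRD sh' addnC; congr expR; ring.
by rewrite addrC expRD ler_pM2l ?expR_gt0.
Qed.

Lemma expect_submart n (G : hist -> R) h (r : R) : 0 <= r ->
  (forall h', (size h <= size h' < size h + n)%N -> r * G h' <= ker alpha G h') ->
  r ^+ n * G h <= expect alpha n G h.
Proof.
move=> r0; elim: n => [|n IH] hG; first by rewrite mul1r.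
rewrite exprS -mulrA; apply: (@le_trans _ _ (r * expect alpha n G h)).
  by rewrite ler_wpM2l// IH// => h' /andP[h1 h2]; apply: hG; rewrite h1; lia.
rewrite -expectZ expectSr; apply: (expect_le alpha_le1) => h' [sh _].
by apply: hG; lia.
Qed.

(** In place of Cauchy-Schwarz, a pointwise inequality bounds [X] by [A / 2 + r / 2 * X ^ 2], plus
    [(2 r)^-1] where [A / 2 <= X]; the monotone linear [expect] applies to it directly. *)
Lemma paley_zygmund n (X : hist -> R) h (A B : R) : (forall h', 0 <= X h') ->
  0 < A -> A <= expect alpha n X h ->
  expect alpha n (fun h' => X h' ^+ 2) h <= B ->
  A ^+ 2 / (4 * B) <= expect alpha n (fun h' => (A / 2 <= X h')%R%:R) h.
Proof.
move=> X0 A0 AX XB; set P := expect alpha n (fun h' => _%:R) h.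
have P0 : 0 <= P by apply: (expect_ge0 alpha_le1).
have B0 : 0 < B.
  apply: lt_le_trans XB.
  have : expect alpha n (fun h' => 2 * A * X h' - A ^+ 2) h <=
         expect alpha n (fun h' => X h' ^+ 2) h.
    apply: (expect_le alpha_le1) => h' _.
    by have := sqr_ge0 (X h' - A); rewrite sqrrB; lra.
  rewrite (expectB alpha_le1) (expectZ alpha) (expect_cst alpha).
  apply: lt_le_trans.
  have : 2 * A * A <= 2 * A * expect alpha n X h by rewrite ler_wpM2l//; lra.
  have : 0 < A ^+ 2 by rewrite exprn_gt0.
  by rewrite expr2; lra.
(* With this [r] the second-moment term costs [A / 4], leaving [A / 4] for the probability. *)
pose r := A / (2 * B).
have r0 : 0 < r by rewrite divr_gt0// mulr_gt0.
have : expect alpha n X h <= expect alpha n (fun h' => A / 2 +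
     (r / 2 * X h' ^+ 2 + (2 * r)^-1 * (A / 2 <= X h')%R%:R)) h.
  apply: (expect_le alpha_le1) => h' _; case: (leP (A / 2) (X h')) => AXh /=.
    have rr : 0 < r^-1 by rewrite invr_gt0.
    have : 0 <= (r * X h' - 1) ^+ 2 / r by rewrite divr_ge0 ?sqr_ge0// ltW.
    have -> : (r * X h' - 1) ^+ 2 / r = r * X h' ^+ 2 - 2 * X h' + r^-1.
      by field; rewrite gt_eqF.
    by rewrite mulr1 [(2 * r)^-1]invfM; lra.
  have : 0 <= r * X h' ^+ 2 by rewrite mulr_ge0 ?sqr_ge0// ltW.
  lra.
rewrite !expectD expect_cst !expectZ -/P => H.
have : r / 2 * expect alpha n (fun h' => X h' ^+ 2) h <= r / 2 * B.
  by rewrite ler_wpM2l// divr_ge0// ltW.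
have rB : r / 2 * B = A / 4 by rewrite /r; field; rewrite gt_eqF.
rewrite rB => H2.
have : A / 4 <= (2 * r)^-1 * P by lra.
have r20 : 0 < 2 * r by lra.
rewrite (ler_pdivlMl _ _ r20) => H3; apply: le_trans H3.
by rewrite le_eqVlt; apply/orP; left; apply/eqP; rewrite /r; field; rewrite gt_eqF.
Qed.

End Tail.

(** * The martingale of a given horizon and its large increments *)

Section WalkMartingale.
Variables (R : realType) (alpha : R).
Hypothesis alpha_le1 : `|alpha| <= 1.

(* [mart a (walk_coef a N)] is a martingale up to time [N], with value [a * walk1] at [N]. *)
Definition walk_coef (a : R) (N k : nat) : R := a * alpha * harm R k N.

Lemma walk_coefP a N : mart_coef alpha a (walk_coef a N) N.
Proof.
move=> k /andP[k0 kN]; rewrite /walk_coef harm_recl// mulrDr addrC.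
by rewrite [in RHS]addrC addrC.
Qed.

Lemma const_coefP (e : R) N : mart_coef alpha 0 (fun=> e) N.
Proof. by move=> k _; rewrite !mul0r addr0. Qed.

Lemma qvar_const (e : R) N : qvar 0 (fun=> e) 1 N.+1 = e ^+ 2 * N%:R.
Proof. by rewrite /qvar sumr_const_nat expr0n add0r subn1 /= mulr_natr. Qed.

Lemma qvar_walk a N :
  qvar a (walk_coef a N) 1 N <= a ^+ 2 * ((1 + 2 * alpha ^+ 2) * N%:R).
Proof.
case: N => [|N]; first by rewrite /qvar big_geq// !mulr0.
have -> : qvar a (walk_coef a N.+1) 1 N.+1 =
    a ^+ 2 * (N%:R + alpha ^+ 2 * \sum_(1 <= k < N.+1) harm R k.+1 N.+1 ^+ 2).
  rewrite /qvar big_split/= sumr_const_nat subn1 /= mulrDr mulr_natr; congr (_ + _).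
  by rewrite !mulr_sumr; apply: eq_bigr => i _; rewrite /walk_coef; ring.
rewrite ler_wpM2l ?sqr_ge0// mulrDl mul1r lerD ?ler_nat//.
rewrite [leRHS](_ : _ = alpha ^+ 2 * (2 * N.+1%:R)); last by ring.
rewrite ler_wpM2l ?sqr_ge0//.
apply: (@le_trans _ _ (\sum_(1 <= k < N.+1) harm R k N.+1 ^+ 2)).
  by apply: ler_sum_nat => k _; rewrite lerXn2r ?nnegrE ?harm_ge0// harm_anti.
rewrite sum_sqr_harm -[N.+1%:R]natr1 mulrDr; have := harm_ge0 R 1 N.+1; lra.
Qed.

Lemma mart_walk_end a N h : size h = N -> mart a (walk_coef a N) h = a * walk1 R h.
Proof. by move=> hN; rewrite /mart hN /walk_coef harm_geq// mulr0 mul0r addr0. Qed.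

Lemma incr_norm (a d : R) h p : `|incr alpha a d h p| <= 2 * `|a| + `|d|.
Proof.
rewrite /incr (le_trans (ler_normD _ _))// !normrM sgn_norm mulr1 lerD2r mulrC.
rewrite ler_wpM2r// (le_trans (ler_normB _ _))// sgn_norm.
by rewrite -lerBrDl (le_trans (le_trans (drift_norm alpha h) alpha_le1))//; lra.
Qed.

(** After inversion this follows from [1 - x / 2 <= expR (- (x / 2))]. It turns a power of
    [1 + l ^ 2 / 16] back into an exponential. *)
Lemma expR_half_le (x : R) : 0 <= x <= 1 -> expR (x / 2) <= 1 + x.
Proof.
move=> /andP[x0 x1]; rewrite -[leRHS]invrK -[leLHS]invrK -expRN lef_pV2 ?posrE ?expR_gt0//.
  apply: le_trans (expR_ge1Dx _); rewrite -[leLHS]mul1r ler_pdivrMr; last by lra.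
  have : 0 <= x * (1 - x) by rewrite mulr_ge0// subr_ge0.
  lra.
by rewrite invr_gt0; lra.
Qed.

(* Paley-Zygmund applied to [expR (l * D)], [D] the increment of the martingale over
   the times from [M] to [4 ^ m * M], with [l ^+ 2 = L / (6 N)]. *)
Lemma walk1_large_increment m h (L : R) : let M := size h in let N := (4 ^ m * M)%N in
  (0 < m)%N -> (0 < M)%N -> 1536 * ln 2 <= L -> L * (2 + 3 * m%:R) ^+ 2 <= 24 * N%:R ->
  4^-1 * expR (- L) <= expect alpha (N - M) (fun h' =>
    (mart 1 (walk_coef 1 N) h + Num.sqrt (N%:R * L) / 1000 <= walk1 R h')%R%:R) h.
Proof.
move=> M N m0 M0 LL LN; set c := walk_coef 1 N.
have ME : M = size h by [].
have harmMN : harm R M N <= 3 * m%:R by exact: harm_pow4.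
have [Q NQ MQ] : exists2 Q, N = (4 * Q)%N & (M <= Q)%N.
  exists (4 ^ m.-1 * M)%N; first by rewrite /N mulnA -expnS prednK.
  by rewrite leq_pmull// expn_gt0.
clearbody N M.
have N0 : (0 < N)%N by lia.
have N0R : 0 < N%:R :> R by rewrite ltr0n.
have ln2 : 0 < ln 2 :> R by rewrite ln_gt0// ltr1n.
have L0 : 0 < L by lra.
(* Chosen so that [6 * l ^ 2 * N = L]: the second moment of [expR (l * D)] is then at most
   [expR L]. *)
pose l := Num.sqrt (L / (6 * N%:R)).
have l2 : l ^+ 2 = L / (6 * N%:R) by rewrite sqr_sqrtr// divr_ge0 ?ltW// mulr_gt0.
have l0 : 0 < l by rewrite sqrtr_gt0 divr_gt0// mulr_gt0.
have cle k : (M <= k)%N -> `|c k| <= 3 * m%:R.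
  move=> Mk; rewrite /c /walk_coef mul1r normrM (ger0_norm (harm_ge0 _ _ _)).
  apply: (@le_trans _ _ (harm R k N)); first by rewrite ler_piMl ?harm_ge0.
  by apply: le_trans (harm_anti _ _ Mk) _.
(* The hypothesis on [L * (2 + 3 m) ^ 2] says that [l * (2 + 3 m) <= 2], the range required by
   [expR_ge_quadratic]. *)
have lsmall k h' p : (M <= k)%N -> -2 <= l * incr alpha 1 (c k) h' p.
  move=> Mk; suff : `|l * incr alpha 1 (c k) h' p| <= 2 by rewrite ler_norml => /andP[].
  rewrite normrM gtr0_norm//; apply: (@le_trans _ _ (l * (2 + 3 * m%:R))).
    rewrite ler_wpM2l ?(ltW l0)//; apply: le_trans (incr_norm _ _ _ _) _.
    by rewrite normr1 mulr1 lerD2l cle.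
  have w0 : 0 <= 2 + 3 * m%:R :> R by rewrite addr_ge0// mulr_ge0.
  rewrite -(@ler_pXn2r _ 2) ?nnegrE//; last by rewrite mulr_ge0// ltW.
  rewrite exprMn l2 mulrAC ler_pdivrMr ?mulr_gt0//.
  by apply: le_trans LN _; rewrite le_eqVlt; apply/orP; left; apply/eqP; ring.
have cP : mart_coef alpha 1 c N by exact: walk_coefP.
pose f h' := expR (l * mart 1 c h').
have a2 : alpha ^+ 2 <= 1.
  by rewrite -(real_normK (num_real alpha)) -(expr1n _ 2) lerXn2r ?nnegrE.
have d2 h' : drift alpha h' ^+ 2 <= alpha ^+ 2.
  rewrite -(real_normK (num_real (drift _ _))) -[leRHS](real_normK (num_real _)).
  by rewrite lerXn2r ?nnegrE// drift_norm.
have sub1 h' : (M <= size h' < N)%N -> 1 * f h' <= ker alpha f h'.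
  move=> /andP[h1 h2]; rewrite mul1r.
  have h0 : (0 < size h' < N)%N by rewrite h2 (leq_trans M0).
  apply: (le_trans _ (ker_expR_ge alpha_le1 cP h0 _)) => [|p]; last first.
    by apply: lsmall; rewrite leqW.
  rewrite ler_peMr ?expR_ge0// lerDl mulr_ge0 ?divr_ge0 ?sqr_ge0//.
  rewrite addr_ge0 ?sqr_ge0// mulr_ge0 ?sqr_ge0// subr_ge0.
  exact: le_trans (d2 h') a2.
(* During the first [Q = N / 4] steps at least half of the horizon remains, so [c] is at least
   [alpha / 2] in absolute value and the conditional variance at least
   [1 - alpha ^ 2 + alpha ^ 2 / 4 >= 1 / 4], also when [alpha] is 1 or -1. *)
have sub2 h' : (M <= size h' < M + Q)%N -> (1 + l ^+ 2 / 16) * f h' <= ker alpha f h'.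
  move=> /andP[h1 h2].
  have h0 : (0 < size h' < N)%N by clear -h1 h2 NQ MQ M0; lia.
  have h3 : (N <= (N - (size h').+1) * 2)%N by clear -h1 h2 NQ MQ M0; lia.
  apply: (le_trans _ (ker_expR_ge alpha_le1 cP h0 _)) => [|p]; last first.
    by apply: lsmall; rewrite leqW.
  rewrite mulrC ler_wpM2l ?expR_ge0// lerD2l.
  rewrite (_ : l ^+ 2 / 16 = l ^+ 2 / 4 * 4^-1); last by field.
  rewrite ler_wpM2l ?divr_ge0 ?sqr_ge0// expr1n mul1r.
  have hh : 2^-1 <= harm R (size h').+1 N.
    apply: (le_trans _ (harm_ge _ _ _)) => //.
    by rewrite ler_pdivlMr// mulrC ler_pdivrMr ?ltr0n// -natrM ler_nat.
  have : (2^-1) ^+ 2 <= harm R (size h').+1 N ^+ 2.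
    by rewrite lerXn2r ?nnegrE ?harm_ge0// invr_ge0.
  move=> /(ler_wpM2l (sqr_ge0 alpha)); rewrite (_ : 2^-1 ^+ 2 = 4^-1 :> R); last by field.
  rewrite /c /walk_coef mul1r [(_ * harm _ _ _) ^+ 2]exprMn; have := d2 h'; lra.
pose D h' := mart 1 c h' - mart 1 c h.
pose X h' := expR (l * D h').
have XE h' : X h' = expR (- (l * mart 1 c h)) * f h'.
  by rewrite /X /f -expRD /D; congr expR; ring.
have NM : (N - M = Q + (3 * Q - M))%N by clear -NQ MQ; lia.
have /andP[lx0 lx1] : 0 <= l ^+ 2 / 16 <= 1.
  rewrite divr_ge0 ?sqr_ge0//= l2 ler_pdivrMr// mul1r ler_pdivrMr ?mulr_gt0//.
  have : L * 2 ^+ 2 <= L * (2 + 3 * m%:R) ^+ 2.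
    rewrite ler_wpM2l ?(ltW L0)// lerXn2r ?nnegrE// ?lerDl ?addr_ge0// mulr_ge0//.
  by lra.
(* From [(1 + l ^ 2 / 16) ^ Q >= expR (Q * l ^ 2 / 32)] with [Q = N / 4]. *)
pose A := expR (l ^+ 2 * N%:R / 128).
have EX : A <= expect alpha (N - M) X h.
  rewrite (@expect_eq _ _ alpha_le1 _ _ (fun h' => expR (- (l * mart 1 c h)) * f h'))//.
  rewrite expectZ NM expect_add.
  apply: (@le_trans _ _ (expR (- (l * mart 1 c h)) * expect alpha Q f h)); last first.
    rewrite ler_pM2l ?expR_gt0//; apply: (expect_le alpha_le1) => h' [sh' _].
    have := @expect_submart _ _ alpha_le1 (3 * Q - M) f h' 1 ler01.
    rewrite expr1n mul1r; apply => h''; rewrite sh' -ME => /andP[g1 g2]; apply: sub1.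
    rewrite (leq_trans MQ (leq_trans (leq_addr _ _) g1)) /=.
    by apply: leq_trans g2 _; clear -NQ MQ; lia.
  apply: (@le_trans _ _ (expR (- (l * mart 1 c h)) * ((1 + l ^+ 2 / 16) ^+ Q * f h))).
    rewrite mulrCA /f -expRD addNr expR0 mulr1 /A NQ natrM.
    have -> : l ^+ 2 * (4 * Q%:R) / 128 = Q%:R * (l ^+ 2 / 16 / 2) by field.
    by rewrite expRM_natl lerXn2r ?nnegrE ?expR_ge0 ?addr_ge0// expR_half_le// lx0.
  rewrite ler_pM2l ?expR_gt0//; apply: (expect_submart alpha_le1).
    by rewrite addr_ge0.
  by move=> h'; rewrite -ME; exact: sub2.
have EX2 : expect alpha (N - M) (fun h' => X h' ^+ 2) h <= expR L.
  rewrite (@expect_eq _ _ alpha_le1 _ _ (fun h' => expR (- (2 * l * mart 1 c h)) *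
    expR (2 * l * mart 1 c h'))); last first.
    by move=> h' _; rewrite /X -expRM_natl -expRD; congr expR; rewrite /D; ring.
  rewrite expectZ.
  have hs0 : (0 < size h)%N by rewrite -ME.
  have MN : (size h + (N - M) <= N)%N by clear -NQ MQ ME; lia.
  have := @expect_expR_le _ _ alpha_le1 1 c N (2 * l) (N - M) h cP hs0 MN.
  rewrite -(ler_pM2l (expR_gt0 (- (2 * l * mart 1 c h)))) => /le_trans; apply.
  rewrite -expRD addKr ler_expR.
  have -> : (2 * l) ^+ 2 / 2 = 2 * l ^+ 2 by field.
  have -> : L = 2 * l ^+ 2 * (3 * N%:R) by rewrite l2; field; rewrite gt_eqF.
  have l20 : 0 <= 2 * l ^+ 2 by rewrite mulr_ge0 ?sqr_ge0.
  apply: (ler_wpM2l l20).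
  apply: (@le_trans _ _ (qvar 1 c 1 N)).
    apply: (@le_trans _ _ (qvar 1 c (size h) N)); first exact: qvar_le.
    by rewrite (@qvar_cat _ 1 c 1 (size h) N) ?lerDr ?qvar_ge0// hs0 -ME NQ; clear -MQ; lia.
  apply: le_trans (qvar_walk _ _) _; rewrite expr1n mul1r ler_wpM2r//.
  by lra.
have := paley_zygmund alpha_le1 (fun h' => expR_ge0 (l * D h')) (expR_gt0 _) EX EX2.
move=> PZ; apply: (@le_trans _ _ (A ^+ 2 / (4 * expR L))).
  rewrite invfM mulrA [_ / 4]mulrC -mulrA ler_pM2l ?invr_gt0// expRN.
  rewrite -[leLHS]mul1r ler_wpM2r ?invr_ge0 ?expR_ge0//.
  rewrite -(expr1n _ 2) lerXn2r ?nnegrE ?expR_ge0//.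
  by rewrite -expR0 ler_expR divr_ge0// mulr_ge0 ?sqr_ge0.
apply: le_trans PZ _; apply: (expect_le alpha_le1) => h' [sh' _].
case: (leP (A / 2) (X h')) => //= AX.
rewrite ler1n lt0b -[walk1 R h']mul1r -(@mart_walk_end 1 N); last by clear -NQ MQ ME sh'; lia.
rewrite -/c -lerBrDl -/(D h').
have lD : l ^+ 2 * N%:R / 128 - ln 2 <= l * D h'.
  rewrite -ler_expR expRD expRN lnK ?posrE//.
(* Hence [ln A = L / 768], and [1536 * ln 2 <= L] lets half of it absorb the [ln 2] due to the
   threshold [A / 2]. *)
have l2N : l ^+ 2 * N%:R = L / 6 by rewrite l2; field; rewrite gt_eqF.
have lN : l * N%:R / 256 <= D h'.
  rewrite -(ler_pM2l l0); apply: le_trans lD.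
  rewrite !mulrA -expr2 l2N; lra.
apply: le_trans lN.
suff : Num.sqrt (N%:R * L) <= 3 * (l * N%:R).
  have : 0 <= Num.sqrt (N%:R * L) by rewrite sqrtr_ge0.
  lra.
rewrite -[leRHS]ger0_norm -?sqrtr_sqr; last by rewrite !mulr_ge0// ltW.
rewrite ler_sqrt ?sqr_ge0// exprMn [(l * _) ^+ 2]exprMn [_ ^+ 2 in X in _ * (_ * X)]expr2.
rewrite [_ * (N%:R * _)]mulrA l2N.
have : 0 <= N%:R * L by rewrite mulr_ge0// ltW.
lra.
Qed.

End WalkMartingale.

(** * The law of the model *)

Section Partition.
Context d (T : measurableType d) (R : realType) (P : probability T R).

Lemma measurable_finite_union (I : finType) (C : I -> set T) :
  (forall i, measurable (C i)) -> measurable (\bigcup_(i in [set: I]) C i).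
Proof.
by move=> mC; apply: fin_bigcup_measurable => // i _; exact: mC.
Qed.

(** The events must carry total mass 1 but need not cover [T]: outcomes with an index out of range
    are discarded in this way. *)
Lemma probability_partition (I : finType) (C : I -> set T) (A : set T) :
  (forall i, measurable (C i)) -> trivIset setT C ->
  (\sum_i P (C i) = 1)%E -> measurable A ->
  P A = (\sum_i P (A `&` C i))%E.
Proof.
move=> mC tC C1 mA.
have mU := measurable_finite_union mC.
have fsE (F : I -> set T) : (forall i, measurable (F i)) -> trivIset setT F ->
    P (\bigcup_(i in [set: I]) F i) = (\sum_i P (F i))%E.
  move=> mF tF; rewrite measure_fin_bigcup//; last exact: finite_finset.
  rewrite [RHS](@fsbig_seq _ _ _ I (index_enum I) (fun i => P (F i))) ?index_enum_uniq//.
  congr (\big[_/_]_(i \in _) _).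
  by apply/seteqP; split => i //= _; rewrite mem_index_enum.
set U := \bigcup_(i in _) _ in mU *.
have -> : P A = (P (A `\` U) + P (A `&` U))%E by exact: measureDI.
have -> : P (A `\` U) = 0%E; last rewrite add0e.
  apply: (@subset_measure0 _ _ _ P _ (~` U)).
  - exact: measurableD.
  - exact: measurableC.
  - by move=> w [].
  - transitivity (1 - P U)%E; first exact: probability_setC.
    by rewrite fsE// C1 subee.
rewrite setI_bigcupr fsE//.
  by move=> i; exact: measurableI.
exact: trivIset_setIl.
Qed.

End Partition.

(** * Reversed boolean histories *)

Section BoolHistory.
Variables (T : Type) (b0 : bool * bool) (xi1 xi2 : nat -> T -> bool) (u1 u2 : nat -> T -> nat).

(* The history [ew_hist], reversed and with boolean steps. *)
Fixpoint bhist (w : T) (n : nat) : hist :=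
  match n with
  | 0 => [::]
  | m.+1 =>
    match m with
    | 0 => [:: b0]
    | _.+1 =>
      let h := bhist w m in
      (xi1 m.+1 w == (nth b0 h (m - u2 m w)).2,
       xi2 m.+1 w == (nth b0 h (m - u1 m w)).1) :: h
    end
  end.

Lemma size_bhist w n : size (bhist w n) = n.
Proof. by elim: n => // -[|n] //= ->. Qed.

Lemma bhistS w n : bhist w n.+2 =
  (xi1 n.+2 w == (nth b0 (bhist w n.+1) (n.+1 - u2 n.+1 w)).2,
   xi2 n.+2 w == (nth b0 (bhist w n.+1) (n.+1 - u1 n.+1 w)).1) :: bhist w n.+1.
Proof. by []. Qed.

Lemma drop_bhist w n m : (m <= n)%N -> drop (n - m) (bhist w n) = bhist w m.
Proof.
elim: n => [|n IH] mn; first by move: mn; rewrite leqn0 => /eqP ->.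
move: mn; rewrite leq_eqVlt => /predU1P[->|mn]; first by rewrite subnn drop0.
rewrite subSn//; case: n IH mn => [|n] IH mn.
  by move: mn; rewrite ltnS leqn0 => /eqP ->.
by rewrite bhistS /= IH.
Qed.

Lemma hits_bhist (B : hist -> bool) w n k :
  (0 < k <= n)%N -> B (bhist w k) -> hits B (bhist w n).
Proof.
elim: n => [|n IH] /andP[k0 kn] Bk; first by move: k0; rewrite ltnNge kn.
have E : exists p, bhist w n.+1 = p :: bhist w n.
  by case: n {IH kn} => [|n]; [exists b0|eexists; exact: bhistS].
have [p Ep] := E; move: kn; rewrite leq_eqVlt => /predU1P[kn|kn].
  by rewrite -kn in Ep *; move: Bk; rewrite Ep /= => ->.
by rewrite Ep /= IH ?orbT// k0 -ltnS.
Qed.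

Definition int_step (b : bool) : int := if b then 1 else -1.

(** Equality of booleans is multiplication of signs, which is why [bhist] forms a step with [==]. *)
Lemma int_step_eqb a b : int_step (a == b) = int_step a * int_step b.
Proof. by case: a; case: b. Qed.

(** Position [u] from the first step is index [n - u] from the last one as long as [u] is in range;
    out of range the two encodings can disagree. *)
Lemma ew_hist_bhist w n :
  (forall k, (0 < k)%N -> (0 < u1 k w <= k)%N && (0 < u2 k w <= k)%N) ->
  ew_hist (int_step b0.1) (int_step b0.2) xi1 xi2 u1 u2 w n =
  rev [seq (int_step p.1, int_step p.2) | p <- bhist w n].
Proof.
move=> uP; elim: n => [//|[//|n] IH].
rewrite bhistS [LHS]/= -[X in rcons X _]/(ew_hist _ _ xi1 xi2 u1 u2 w n.+1).
rewrite -/(ew_hist _ _ xi1 xi2 u1 u2 w n.+1).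
rewrite IH map_cons rev_cons; congr rcons.
have /andP[/andP[a1 a2] /andP[b1 b2]] := uP n.+1 (ltn0Sn n).
have nthE i : (0 < i <= n.+1)%N ->
    nth (0, 0) (rev [seq (int_step p.1, int_step p.2) | p <- bhist w n.+1]) i.-1 =
    (int_step (nth b0 (bhist w n.+1) (n.+1 - i)).1,
     int_step (nth b0 (bhist w n.+1) (n.+1 - i)).2).
  move=> /andP[i0 i1]; rewrite nth_rev size_map size_bhist; last by rewrite prednK.
  by rewrite prednK// (nth_map b0)// size_bhist; lia.
by rewrite !nthE ?a1 ?b1//= !int_step_eqb; congr (_ * _, _ * _); case: (_ n.+2 w).
Qed.

End BoolHistory.

(** * Range and measurability of the model variables *)

Section Bridge.
Context d (T : measurableType d) (R : realType) (P : probability T R).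
Variables (p1 : R) (xi1 xi2 : nat -> T -> bool) (u1 u2 : nat -> T -> nat).
Hypothesis model : two_elephant_model P p1 (2^-1) xi1 xi2 u1 u2.
Let alpha := 2 * p1 - 1.
Let Z := ew_var xi1 xi2 u1 u2.

(** The [k] admissible values have probability [1 / k] each and so exhaust the mass. *)
Lemma u_range_ae : {ae P, forall w k, (0 < k)%N ->
  (0 < u1 k w <= k)%N && (0 < u2 k w <= k)%N}.
Proof.
case: model => _ _ U1 U2 [mZ _].
have H (u : nat -> T -> nat) : (forall n, (0 < n)%N -> forall v, measurable [set w | u n w = v]) ->
    (forall n k, (1 <= n)%N -> (1 <= k <= n)%N -> P [set w | u n w = k] = (n%:R^-1)%:E) ->
    {ae P, forall w k, (0 < k)%N -> (0 < u k w <= k)%N}.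
  move=> mu Pu; apply/ae_foralln => -[|k]; first by apply: aeW => w.
  pose C (i : 'I_k.+1) := [set w | u k.+1 w = i.+1].
  have mC i : measurable (C i) by exact: mu.
  have tC : trivIset setT C.
    move=> i j _ _ [w [ci cj]]; apply: val_inj; apply: succn_inj.
    by rewrite -[RHS]cj -[LHS]ci.
  have sC : (\sum_i P (C i) = 1)%E.
    rewrite (eq_bigr (fun=> (k.+1%:R^-1)%:E)); last first.
      by move=> i _; rewrite /C Pu /=.
    rewrite sumEFin sumr_const card_ord -[_^-1 *+ _]mulr_natr mulVf ?pnatr_eq0//.
  have mU := measurable_finite_union mC.
  exists (~` \bigcup_(i in setT) C i); split.
  - exact: measurableC.
  - apply: etrans; first by apply: (probability_partition mC tC sC); exact: measurableC.
    rewrite big1// => i _; rewrite (_ : _ `&` _ = set0) ?measure0//.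
    by apply/seteqP; split => // w [/= nC Cw]; apply: nC; exists i.
  - move=> w /= nw [i _ /= uw]; apply: nw => _; rewrite uw /=; exact: ltn_ord.
have h1 := H u1 (fun n n0 => mZ (IU1 n) n0) U1.
have h2 := H u2 (fun n n0 => mZ (IU2 n) n0) U2.
by apply: filterS2 h1 h2 => w a b k k0; rewrite a// b.
Qed.

Definition on_values (s : seq ew_idx) (v : ew_idx -> nat) : set T :=
  [set w | forall i, i \in s -> Z i w = v i].

Lemma measurable_value (A : set nat) i : ew_valid i -> measurable [set w | A (Z i w)].
Proof.
case: model => _ _ _ _ [mZ _] vi.
rewrite (_ : [set _ | _] = \bigcup_(v in A) [set w | Z i w = v]); last first.
  apply/seteqP; split => [w /= Aw|w [v /= Av ->]//]; by exists (Z i w).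
by apply: bigcup_measurable => v _; exact: mZ.
Qed.

Lemma measurable_on_values s v : all ew_valid s -> measurable (on_values s v).
Proof.
elim: s => [|i s IH] /=.
  by rewrite (_ : on_values _ _ = setT)//; apply/seteqP; split.
move=> /andP[vi vs]; rewrite (_ : on_values _ _ = [set w | Z i w = v i] `&` on_values s v).
  by apply: measurableI; [exact: (measurable_value [set x | x = v i])|exact: IH].
apply/seteqP; split => [w h|w [h1 h2] j].
  by split; [apply: h; rewrite mem_head|move=> j js; apply: h; rewrite in_cons js orbT].
by rewrite in_cons => /predU1P[->|]; [exact: h1|exact: h2].
Qed.

Lemma probability_on_values s v : uniq s -> all ew_valid s ->
  P (on_values s v) = (\prod_(i <- s) P [set w | Z i w = v i])%E.
Proof.
case: model => _ _ _ _ [_ indep] us vs; rewrite -indep//; congr (P _).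
Qed.

Lemma measurable_bhist b0 n h : measurable [set w | bhist b0 xi1 xi2 u1 u2 w n = h].
Proof.
elim: n h => [|[|n] IH] h.
- have [<-|hn] := eqVneq [::] h.
    by rewrite (_ : [set _ | _] = setT)//; apply/seteqP; split.
  by rewrite (_ : [set _ | _] = set0)//; apply/seteqP; split => // w /= /eqP; rewrite (negPf hn).
- have [<-|hn] := eqVneq [:: b0] h.
    by rewrite (_ : [set _ | _] = setT)//; apply/seteqP; split.
  by rewrite (_ : [set _ | _] = set0)//; apply/seteqP; split => // w /= /eqP; rewrite (negPf hn).
- case: h => [|p h]; first by rewrite (_ : [set _ | _] = set0)//; apply/seteqP; split.
  pose q1 (x : bool) (k : nat) := p.1 == (x == (nth b0 h (n.+1 - k)).2).
  pose q2 (x : bool) (k : nat) := p.2 == (x == (nth b0 h (n.+1 - k)).1).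
  pose E1 x := [set w | Z (IXi1 n.+2) w = nat_of_bool x] `&` [set w | q1 x (Z (IU2 n.+1) w)].
  pose E2 x := [set w | Z (IXi2 n.+2) w = nat_of_bool x] `&` [set w | q2 x (Z (IU1 n.+1) w)].
  rewrite (_ : [set _ | _] = [set w | bhist b0 xi1 xi2 u1 u2 w n.+1 = h] `&`
    ((E1 true `|` E1 false) `&` (E2 true `|` E2 false))).
    apply: measurableI; first exact: IH.
    have mE1 x : measurable (E1 x).
      apply: measurableI; first exact: (measurable_value [set y | y = nat_of_bool x]).
      exact: (measurable_value [set k | q1 x k]).
    have mE2 x : measurable (E2 x).
      apply: measurableI; first exact: (measurable_value [set y | y = nat_of_bool x]).
      exact: (measurable_value [set k | q2 x k]).
    by apply: measurableI; apply: measurableU.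
  apply/seteqP; split => w.
    rewrite /= -/(bhist b0 xi1 xi2 u1 u2 w n.+1) => -[pE hE]; split=> //.
    rewrite /E1 /E2 /q1 /q2 /= -hE -pE /=.
    split.
      by case E : (xi1 n.+2 w); [left|right]; split; rewrite /= ?E ?eqxx.
    by case E : (xi2 n.+2 w); [left|right]; split; rewrite /= ?E ?eqxx.
  move=> [hE [h1 h2]]; rewrite /= -/(bhist b0 xi1 xi2 u1 u2 w n.+1) hE.
  congr cons; case: p @q1 @q2 @E1 @E2 h1 h2 => a b /=.
  move=> h1 h2; congr pair.
    by case: h1 => -[/= + /eqP ->]; case: (xi1 _ _).
  by case: h2 => -[/= + /eqP ->]; case: (xi2 _ _).
Qed.

End Bridge.

(** * The law of the history *)

Section Law.
Context d (T : measurableType d) (R : realType) (P : probability T R).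
Variables (p1 : R) (xi1 xi2 : nat -> T -> bool) (u1 u2 : nat -> T -> nat).
Hypothesis model : two_elephant_model P p1 (2^-1) xi1 xi2 u1 u2.
Hypothesis p1_itv : 0 <= p1 <= 1.
Variable b0 : bool * bool.
Let alpha := 2 * p1 - 1.
Let Z := ew_var xi1 xi2 u1 u2.
Let onv : seq ew_idx -> (ew_idx -> nat) -> set T := on_values xi1 xi2 u1 u2.
Let bh := bhist b0 xi1 xi2 u1 u2.

Let alpha_le1 : `|alpha| <= 1.
Proof. by case/andP: p1_itv => ? ?; rewrite ler_norml /alpha; lra. Qed.

Let pr1 (e : bool) : R := (1 + sgn R e * alpha) / 2.

Let pw (p : bool * bool) h : R := (1 + sgn R p.1 * drift alpha h) / 4.

Lemma expect_eq_cons n p h0 h :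
  expect alpha n.+1 (fun g => (g == p :: h0)%:R) h =
  pw p h0 * expect alpha n (fun g => (g == h0)%:R) h.
Proof.
rewrite expectSr -expectZ; apply: (expect_eq alpha_le1) => g _.
rewrite /ker !eqseq_cons /pw; have [->|_] := eqVneq g h0; last first.
  by rewrite !andbF !addr0 !mulr0 addr0 mulr0.
by case: p => [[] []]; rewrite /sgn /= ?mulr1n ?mulr0n; field.
Qed.

Lemma walk2_rev n h : size h = n ->
  \sum_(k < n) sgn R (nth b0 h (n - k.+1)).2 = walk2 R h.
Proof.
move=> sh; rewrite /walk2 (big_nth b0) big_mkord sh (reindex_inj rev_ord_inj) /=.
by apply: eq_bigr => i _; rewrite subnSK ?ltn_ord// subKn// ltnW ?ltn_ord.
Qed.

(** The next pair of steps when [u1], [u2] are [i.1.1.+1], [i.1.2.+1] and the coins are [i.2]; it is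
    [u2] that feeds the first walk. *)
Let compat n h (i : ('I_n.+1 * 'I_n.+1) * (bool * bool)) : bool * bool :=
  (i.2.1 == (nth b0 h (n.+1 - i.1.2.+1)).2, i.2.2 == (nth b0 h (n.+1 - i.1.1.+1)).1).

(** Total probability for one step: averaging over [u2] turns the partner's step into
    [walk2 / size], and the fair second coin erases what [u1] selected. *)
Lemma sum_compat n p h : size h = n.+1 ->
  \sum_(i : ('I_n.+1 * 'I_n.+1) * (bool * bool))
    (compat h i == p)%:R * (pr1 i.2.1 * 2^-1 * (n.+1%:R^-1 * n.+1%:R^-1)) = pw p h.
Proof.
move=> sh; rewrite -(pair_bigA _ (fun k e =>
  (compat h (k, e) == p)%:R * (pr1 e.1 * 2^-1 * (n.+1%:R^-1 * n.+1%:R^-1)))) /=.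
rewrite (eq_bigr (fun k : 'I_n.+1 * 'I_n.+1 =>
  (1 + sgn R p.1 * alpha * sgn R (nth b0 h (n.+1 - k.2.+1)).2) / 4
  * (n.+1%:R^-1 * n.+1%:R^-1))); last first.
  move=> k _; rewrite -(pair_bigA _ (fun e1 e2 =>
    (compat h (k, (e1, e2)) == p)%:R * (pr1 e1 * 2^-1 * (n.+1%:R^-1 * n.+1%:R^-1)))) /=.
  rewrite !big_bool /compat /=; set x := (nth _ _ _).2; set y := (nth _ _ _).1.
  by case: p => [[] []]; case: x; case: y; rewrite /pr1 /sgn /= ?mulr1n ?mulr0n; field.
rewrite -(pair_bigA _ (fun k1 k2 : 'I_n.+1 =>
  (1 + sgn R p.1 * alpha * sgn R (nth b0 h (n.+1 - k2.+1)).2) / 4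
  * (n.+1%:R^-1 * n.+1%:R^-1))) /=.
rewrite sumr_const card_ord -mulr_suml -mulr_suml big_split/= -mulr_sumr walk2_rev//.
rewrite sumr_const card_ord -[X in X = _]mulr_natr /pw /drift sh.
have : n.+1%:R != 0 :> R by rewrite pnatr_eq0.
by move: (n.+1%:R) => x x0; field.
Qed.

Let Pxi2 n (e : bool) : (2 <= n)%N -> P [set w | nat_of_bool (xi2 n w) = e] = (2^-1)%:E.
Proof.
case: model => _ X2 _ _ [mZ _] n2.
have E1 : [set w | nat_of_bool (xi2 n w) = true] = [set w | xi2 n w].
  by apply/seteqP; split => w /=; case: (xi2 n w).
case: e; first by rewrite E1 X2.
have -> : [set w | nat_of_bool (xi2 n w) = false] = ~` [set w | xi2 n w].
  by apply/seteqP; split => w /=; case: (xi2 n w).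
have m1 : measurable [set w | xi2 n w] by rewrite -E1; exact: (mZ (IXi2 n)).
transitivity (1 - P [set w | xi2 n w])%E; first exact: probability_setC.
by rewrite X2// -EFinB; congr EFin; lra.
Qed.

Let Pxi1 n (e : bool) : (2 <= n)%N -> P [set w | nat_of_bool (xi1 n w) = e] = (pr1 e)%:E.
Proof.
case: model => X1 _ _ _ [mZ _] n2.
have E1 : [set w | nat_of_bool (xi1 n w) = true] = [set w | xi1 n w].
  by apply/seteqP; split => w /=; case: (xi1 n w).
case: e; first by rewrite E1 X1// /pr1 /sgn /alpha; congr EFin; lra.
have -> : [set w | nat_of_bool (xi1 n w) = false] = ~` [set w | xi1 n w].
  by apply/seteqP; split => w /=; case: (xi1 n w).
have m1 : measurable [set w | xi1 n w] by rewrite -E1; exact: (mZ (IXi1 n)).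
transitivity (1 - P [set w | xi1 n w])%E; first exact: probability_setC.
by rewrite X1// -EFinB /pr1 /sgn /alpha; congr EFin; lra.
Qed.

Definition later n (i : ew_idx) : bool :=
  match i with
  | IXi1 m | IXi2 m => (n < m)%N
  | IU1 m | IU2 m => (n <= m)%N
  end.

(* Keeping the variables of later times [s] free is what makes the induction go through. *)
Lemma law_on_values n h s v : uniq s -> all ew_valid s -> all (later n.+1) s ->
  P ([set w | bh w n.+1 = h] `&` onv s v) =
  ((expect alpha n (fun g => (g == h)%:R) [:: b0])%:E * P (onv s v))%E.
Proof.
elim: n h s v => [|n IH] h s v us vs ls.
  have [hE|hE] := eqVneq [:: b0] h.
    rewrite /= hE eqxx mul1e (_ : [set _ | _] = setT) ?setTI//.
    by apply/seteqP; split.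
  rewrite /= (negPf hE) mul0e (_ : _ `&` _ = set0) ?measure0//.
  by apply/seteqP; split => // w [/= /eqP]; rewrite (negPf hE).
case: h => [|p h].
  rewrite (_ : _ `&` _ = set0); last by apply/seteqP; split => // w [].
  rewrite measure0 (@expect_eq _ _ alpha_le1 _ _ (fun=> 0)) ?expect_cst ?mul0e//.
  by move=> g [sg _]; case: g sg.
have [sh|sh] := eqVneq (size h) n.+1; last first.
  rewrite (_ : _ `&` _ = set0); last first.
    apply/seteqP; split => // w [/= [_ /(congr1 size)]].
    by rewrite -/(bhist b0 xi1 xi2 u1 u2 w n.+1) size_bhist => /esym/eqP; rewrite (negPf sh).
  rewrite measure0 (@expect_eq _ _ alpha_le1 _ _ (fun=> 0)) ?expect_cst ?mul0e//.
  move=> g [sg _]; case: eqP => // gE; move: sg; rewrite gE /= addn1 => -[/eqP].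
  by rewrite (negPf sh).
rewrite expect_eq_cons.
(* The four variables that create the next step are prescribed by [i], all others by [v]; ordinals
   start at 0, hence the successors. *)
pose vi (i : ('I_n.+1 * 'I_n.+1) * (bool * bool)) (j : ew_idx) : nat :=
  match j with
  | IXi1 m => if m == n.+2 then nat_of_bool i.2.1 else v j
  | IXi2 m => if m == n.+2 then nat_of_bool i.2.2 else v j
  | IU1 m => if m == n.+1 then i.1.1.+1 else v j
  | IU2 m => if m == n.+1 then i.1.2.+1 else v j
  end.
pose s0 := [:: IXi1 n.+2; IXi2 n.+2; IU1 n.+1; IU2 n.+1].
pose C i := onv s0 (vi i).
have us0 : uniq s0 by [].
have vs0 : all ew_valid s0 by [].
have us1 : uniq (s0 ++ s).
  rewrite cat_uniq us0 us andbT; apply/hasPn => j /(allP ls) lj; apply/negP.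
  by rewrite /s0 !in_cons in_nil orbF => H; case/or4P: H lj => /eqP -> /=; rewrite ltnn.
have vs1 : all ew_valid (s0 ++ s) by rewrite all_cat vs0 vs.
have ls1 : all (later n.+1) (s0 ++ s).
  rewrite all_cat /= !leqnn /=; apply: sub_all ls => -[] m /=; exact: ltnW.
have visE i j : j \in s -> vi i j = v j.
  move=> /(allP ls); case: j => m /= lm; case: eqP => // mE; by rewrite mE ltnn in lm.
have catE i : onv (s0 ++ s) (vi i) = C i `&` onv s v.
  apply/seteqP; split => [w h1|w [h1 h2] j].
    split=> [j js|j js]; first by apply: h1; rewrite mem_cat js.
    by rewrite -(visE i)//; apply: h1; rewrite mem_cat js orbT.
  by rewrite mem_cat => /orP[js|js]; [exact: h1|rewrite visE//; exact: h2].
pose wt (i : ('I_n.+1 * 'I_n.+1) * (bool * bool)) : R :=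
  pr1 i.2.1 * 2^-1 * (n.+1%:R^-1 * n.+1%:R^-1).
have PC4 i (r : seq ew_idx) : (\prod_(j <- s0 ++ r) P [set w | Z j w = vi i j] =
    (wt i)%:E * \prod_(j <- r) P [set w | Z j w = vi i j])%E.
  case: model => _ _ U1 U2 _.
  rewrite /s0 /= !big_cons !muleA; congr (_ * _)%E; rewrite /Z /= !eqxx.
  by rewrite Pxi1// Pxi2// U1 ?ltn_ord// U2 ?ltn_ord// -!EFinM /wt mulrA.
have PC i : P (C i) = (wt i)%:E.
  rewrite /C /onv (probability_on_values model)// -/Z -[s0]cats0 PC4.
  by rewrite big_nil mule1.
have PCs i : P (onv (s0 ++ s) (vi i)) = ((wt i)%:E * P (onv s v))%E.
  rewrite /onv !(probability_on_values model)// -/Z PC4; congr (_ * _)%E.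
  by apply: eq_big_seq => j js; rewrite visE.
have mC i : measurable (C i) by exact: (measurable_on_values model).
have tC : trivIset setT C.
  move=> i j _ _ [w [ci cj]]; case: i ci => [[k1 k2] [e1 e2]] ci.
  case: j cj => [[k1' k2'] [e1' e2']] cj.
  have E l : l \in s0 -> vi (k1, k2, (e1, e2)) l = vi (k1', k2', (e1', e2')) l.
    by move=> ls0; rewrite -(ci l ls0) -(cj l ls0).
  have := E (IXi1 n.+2); have := E (IXi2 n.+2); have := E (IU1 n.+1); have := E (IU2 n.+1).
  rewrite /s0 !inE !eqxx !orbT /= !eqxx => /(_ isT) [K2] /(_ isT) [K1].
  move=> /(_ isT) F2 /(_ isT) F1.
  congr (_, _, (_, _)); [exact: val_inj|exact: val_inj| |].
  - by case: e1 e1' F1 {ci cj E} => -[].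
  - by case: e2 e2' F2 {ci cj E} => -[].
(* Grouped by the resulting step, the weights [wt] are those of [ker], which preserves constants. *)
have sC : (\sum_i P (C i) = 1)%E.
  rewrite (eq_bigr (fun i => (wt i)%:E)); last by move=> i _; exact: PC.
  rewrite sumEFin; congr EFin.
  have := expect_cst alpha 1 1 h.
  rewrite /= /ker => <-.
  have S p' := sum_compat p' sh.
  rewrite (eq_bigr (fun i => \sum_(p' : bool * bool) (compat h i == p')%:R * wt i)); last first.
    move=> i _; rewrite -mulr_suml (bigD1 (compat h i))//= eqxx big1 ?addr0 ?mul1r//.
    by move=> p' /negPf; rewrite eq_sym => ->.
  rewrite exchange_big /= (eq_bigr (fun p' => pw p' h)); last by move=> p' _; exact: S.
  by rewrite -(pair_bigA _ (fun a b => pw (a, b) h)) /= !big_bool /pw /sgn /=; field.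
have mA : measurable ([set w | bh w n.+2 = p :: h] `&` onv s v).
  by apply: measurableI; [exact: (measurable_bhist model)|exact: (measurable_on_values model)].
rewrite (probability_partition mC tC sC mA).
(* On [C i] the next step is determined, so what remains is an event about [h] and the values on
   [s0 ++ s], covered by the induction hypothesis. *)
have AC i : P ([set w | bh w n.+2 = p :: h] `&` onv s v `&` C i) =
    (((compat h i == p)%:R * wt i)%:E *
    ((expect alpha n (fun g => (g == h)%:R) [:: b0])%:E * P (onv s v)))%E.
  rewrite EFinM -muleA [X in (_ * X)%E]muleCA -PCs -(IH h _ _ us1 vs1 ls1) catE.
  have stepE w : C i w -> bh w n.+2 = compat (bh w n.+1) i :: bh w n.+1.
    move=> ci; rewrite /bh bhistS /compat.
    have := ci (IXi1 n.+2); have := ci (IXi2 n.+2).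
    have := ci (IU1 n.+1); have := ci (IU2 n.+1).
    rewrite /s0 !inE !eqxx !orbT /= !eqxx => /(_ isT) -> /(_ isT) ->.
    move=> /(_ isT) F2 /(_ isT) F1.
    have -> : xi1 n.+2 w = i.2.1 by move: F1; case: (xi1 _ _); case: (i.2.1).
    by have -> : xi2 n.+2 w = i.2.2 by move: F2; case: (xi2 _ _); case: (i.2.2).
  case: eqP => cp; last first.
    rewrite mul0e (_ : _ `&` _ `&` _ = set0) ?measure0//.
    apply/seteqP; split => // w [[hw _] /stepE]; rewrite hw => -[pE hE].
    by apply: cp; rewrite pE -hE.
  rewrite mul1e; congr (P _); apply/seteqP; split => w.
    by move=> [[hw vw] /[dup] cw /stepE]; rewrite hw => -[_ hE]; split.
  move=> [hE [cw vw]]; have e : bh w n.+2 = p :: h by rewrite (stepE _ cw) hE cp.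
  exact: (conj (conj e vw) cw).
rewrite (eq_bigr _ (fun i _ => AC i)) -ge0_sume_distrl; last first.
  move=> i _; rewrite lee_fin mulr_ge0// /wt !mulr_ge0 ?invr_ge0// /pr1.
  move: alpha_le1; rewrite ler_norml => /andP[a1 a2].
  by rewrite /sgn; case: ifP => _; lra.
by rewrite sumEFin sum_compat// EFinM muleA.
Qed.

Lemma law_bhist n h : P [set w | bh w n.+1 = h] =
  (expect alpha n (fun g => (g == h)%:R) [:: b0])%:E.
Proof.
have := @law_on_values n h [::] (fun=> 0) isT isT isT.
have -> : onv [::] (fun=> 0) = setT by apply/seteqP; split.
by rewrite setIT probability_setT mule1.
Qed.

Lemma measurable_bhist_event n (B : hist -> bool) :
  measurable [set w | B (bh w n.+1)].
Proof.
rewrite (_ : [set _ | _] = \bigcup_(t in [set t : n.+1.-tuple (bool * bool) | B (tval t)])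
  [set w | bh w n.+1 = tval t]).
  by apply: fin_bigcup_measurable => // t _; exact: (measurable_bhist model).
apply/seteqP; split => [w Bw|w [t /= Bt ->]//].
have sw : size (bh w n.+1) == n.+1 by rewrite size_bhist.
by exists (Tuple sw).
Qed.

(** Point masses are summed over all tuples of length [n.+1]. The first pair of steps is given, so
    [n] applications of [ker] suffice. *)
Lemma probability_bhist n (B : hist -> bool) :
  P [set w | B (bh w n.+1)] = (expect alpha n (fun g => (B g)%:R) [:: b0])%:E.
Proof.
pose F (t : n.+1.-tuple (bool * bool)) := [set w | bh w n.+1 = tval t].
have mF t : measurable (F t) by exact: (measurable_bhist model).
have tF : trivIset setT F.
  by move=> s t _ _ [w [fs ft]]; apply: val_inj; rewrite /= -fs -ft.
have mem_exp g : size g = n.+1 -> (\sum_(t : n.+1.-tuple (bool * bool)) (g == t)%:R = 1 :> R).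
  move=> sg; have gs : size g == n.+1 by rewrite sg.
  rewrite (bigD1 (Tuple gs))//= eqxx big1 ?addr0// => t /eqP tg.
  by case: eqP => // gt; case: tg; apply: val_inj; rewrite /= gt.
have sF : (\sum_t P (F t) = 1)%E.
  rewrite (eq_bigr (fun t : n.+1.-tuple (bool * bool) =>
    (expect alpha n (fun g => (g == tval t)%:R) [:: b0])%:E)); last first.
    by move=> t _; exact: law_bhist.
  rewrite sumEFin; congr EFin.
  rewrite -(expect_sum alpha_le1); transitivity (expect alpha n (fun=> 1) [:: b0]).
    by apply: (expect_eq alpha_le1) => g [sg _]; rewrite mem_exp// sg /= addn1.
  exact: expect_cst.
have mA := measurable_bhist_event n B.
rewrite (probability_partition mF tF sF mA).
rewrite (eq_bigr (fun t : n.+1.-tuple (bool * bool) => ((B t)%:R *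
   expect alpha n (fun g => (g == t)%:R) [:: b0])%:E)); last first.
  move=> t _; have [Bt|Bt] := boolP (B t).
    rewrite mul1r -law_bhist; congr (P _); apply/seteqP; split => [w []//|w Fw].
    have Bw : B (bh w n.+1) by rewrite (Fw : bh w n.+1 = t).
    exact: (conj Bw Fw).
  rewrite mul0r (_ : _ `&` _ = set0) ?measure0//; apply/seteqP; split => // w [Bw Fw].
  by have : B (bh w n.+1) := Bw; rewrite (Fw : bh w n.+1 = t) (negPf Bt).
rewrite sumEFin; congr EFin; under eq_bigr do rewrite -expectZ.
rewrite -(expect_sum alpha_le1); apply: (expect_eq alpha_le1) => g [sg _].
rewrite addn1 in sg; transitivity ((B g)%:R * \sum_(t : n.+1.-tuple (bool * bool)) (g == t)%:R : R).
  rewrite mulr_sumr; apply: eq_bigr => t _.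
  by have [->|gt] := eqVneq g (tval t); rewrite ?eqxx ?(negPf gt) ?mulr0.
by rewrite mem_exp// mulr1.
Qed.

End Law.

(** * Upper half of the law of the iterated logarithm *)

Section BorelCantelli.
Context d (T : measurableType d) (R : realType) (P : probability T R).

Lemma borel_cantelli_telescope (A : nat -> set T) (u : nat -> R) :
  (forall j, measurable (A j)) -> (forall j, 0 <= u j) ->
  (forall j, (P (A j) <= (u j - u j.+1)%:E)%E) ->
  {ae P, forall w, exists J, forall j, (J <= j)%N -> ~ A j w}.
Proof.
move=> mA u0 PA.
have ps n : (\sum_(0 <= i < n) P (A i) <= (u 0%N)%:E)%E.
  apply: (@le_trans _ _ (u 0%N - u n)%:E); last by rewrite lee_fin gerBl.
  elim: n => [|n IH]; first by rewrite big_geq// subrr.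
  rewrite big_nat_recr//=; apply: le_trans (leeD IH (PA n)) _.
  by rewrite -EFinD lee_fin; lra.
have sA : (\sum_(n <oo) P (A n) < +oo)%E.
  apply: le_lt_trans (ltry (u 0%N)); apply: lime_le; first exact: is_cvg_nneseries.
  by apply: nearW => n; exact: ps.
have L0 := lim_sup_set_cvg0 mA sA.
exists (lim_sup_set A); split => //.
  apply: bigcap_measurable => // k _; apply: bigcup_measurable => j _; exact: mA.
move=> w /= nw n _; apply: contrapT => H; apply: nw; exists n => j nj Aj.
by apply: H; exists j.
Qed.

(** This amounts to comparing [(j + 2) ^ - (1 + x)] with the integral of [t ^ - (1 + x)] over
    [[j + 1, j + 2]]. *)
Lemma zeta_telescope (x : R) j : 0 < x ->
  expR (- ((1 + x) * ln j.+2%:R)) <=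
  x^-1 * expR (- (x * ln j.+1%:R)) - x^-1 * expR (- (x * ln j.+2%:R)).
Proof.
move=> x0; rewrite -mulrBr ler_pdivlMl//.
have j1 : 0 < j.+1%:R :> R by rewrite ltr0n.
have j2 : 0 < j.+2%:R :> R by rewrite ltr0n.
have -> : expR (- (x * ln j.+1%:R)) =
    expR (- (x * ln j.+2%:R)) * expR (x * (ln j.+2%:R - ln j.+1%:R)) :> R.
  by rewrite -expRD; congr expR; ring.
rewrite mulrDl mul1r opprD expRD [expR (- ln _)]expRN lnK ?posrE//.
have := @invS_le_lnB R j; move: (_^-1) (ln _ - ln _) => q D qD.
have h1 := expR_ge1Dx (x * D); have h2 : x * q <= x * D by rewrite ler_wpM2l// ltW.
move: (expR (- _)) (expR_ge0 (- (x * ln j.+2%:R))) (expR (x * D)) h1 => e e0 E h1.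
have h3 : x * q <= E - 1 by lra.
by have := ler_wpM2l e0 h3; lra.
Qed.

End BorelCantelli.

(** * Logarithmic growth and geometric horizons *)

Section Growth.
Variable R : realType.

(** Along horizons growing like [expR (k * j)], [ln (ln n)] is about [ln (k * j)]; this compares it
    with the [ln j] required by Borel-Cantelli. *)
Lemma ln_shift_le (k x : R) : 0 < k -> 0 < x ->
  exists J, forall j, (J <= j)%N ->
    1 < j%:R * k /\ ln j.+3%:R <= (1 + x) * ln (j%:R * k).
Proof.
move=> k0 x0.
pose B := Num.max (expR ((ln 4 - ln k) / x)) 1 / k.
exists (Num.bound `|B|).+1 => j Jj.
have Bj : B < j%:R.
  apply: (@lt_le_trans _ _ (Num.bound `|B|)%:R); last by rewrite ler_nat ltnW.
  by apply: le_lt_trans (ler_norm _) (archi_boundP (normr_ge0 B)).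
have j0 : 0 < j%:R :> R by rewrite ltr0n (leq_trans _ Jj).
have : Num.max (expR ((ln 4 - ln k) / x)) 1 < j%:R * k by rewrite -ltr_pdivrMr.
rewrite gt_max => /andP[h1 h2]; split=> //.
have h3 : (ln 4 - ln k) / x < ln (j%:R * k).
  by rewrite -ltr_expR lnK ?posrE ?mulr_gt0.
rewrite mulrDl mul1r [X in _ <= X + _]lnM ?posrE//.
apply: (@le_trans _ _ (ln 4 + ln j%:R)).
  rewrite -lnM ?posrE ?mulr_gt0// ler_ln ?posrE ?mulr_gt0// -natrM ler_nat; lia.
by move: h3; rewrite ltr_pdivrMr// => h3; lra.
Qed.

Lemma ln_le_sqrt (x : R) : 0 < x ->
  exists N0, forall N, (N0 <= N)%N -> 3 + ln N%:R <= x * Num.sqrt N%:R.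
Proof.
(* In terms of the fourth root [s] of [N] the left side is at most [3 + 4 s <= 7 s], and
   [7 s <= x * s ^ 2] once [s] exceeds [7 / x]. *)
move=> x0; pose B := (Num.max (7 / x) 1) ^+ 4.
exists (Num.bound `|B|).+1 => N NN.
have BN : B < N%:R.
  apply: (@lt_le_trans _ _ (Num.bound `|B|)%:R); last by rewrite ler_nat ltnW.
  by apply: le_lt_trans (ler_norm _) (archi_boundP (normr_ge0 B)).
have N0 : 0 < N%:R :> R by rewrite ltr0n (leq_trans _ NN).
set s := Num.sqrt (Num.sqrt (N%:R : R)).
have s0 : 0 < s by rewrite !sqrtr_gt0.
have s2 : s ^+ 2 = Num.sqrt N%:R by rewrite sqr_sqrtr ?sqrtr_ge0.
have s4 : s ^+ 4 = N%:R by rewrite (exprM s 2 2) s2 sqr_sqrtr// ltW.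
have : Num.max (7 / x) 1 < s.
  by rewrite -(@ltr_pXn2r _ 4) ?nnegrE ?s4 ?(ltW s0)// le_max ler01 orbT.
rewrite gt_max ltr_pdivrMr// => /andP[h1 h2].
rewrite -s2 -s4 lnXn// -[ln s *+ 4]mulr_natl.
have : ln s <= s by exact/ltW/ln_sublinear.
have : s * 7 <= s * (s * x) by rewrite ler_wpM2l// ltW.
rewrite expr2; lra.
Qed.

(* An integer version of [m * (1 + 1/m) ^ j]. *)
Fixpoint geo (m j : nat) : nat :=
  if j is i.+1 then (geo m i + geo m i %/ m)%N else m.

Lemma geo_ge m j : (m <= geo m j)%N.
Proof. by elim: j => //= j IH; rewrite (leq_trans IH) ?leq_addr. Qed.

Lemma geo_lt m j : (0 < m)%N -> (geo m j < geo m j.+1)%N.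
Proof. by move=> m0; rewrite /= -[ltnLHS]addn0 ltn_add2l divn_gt0 ?geo_ge. Qed.

Lemma geo_mono m i j : (0 < m)%N -> (i <= j)%N -> (geo m i <= geo m j)%N.
Proof.
move=> m0; elim: j => [|j IH]; first by rewrite leqn0 => /eqP ->.
rewrite leq_eqVlt => /predU1P[->//|/IH h].
exact: leq_trans h (ltnW (geo_lt _ m0)).
Qed.

Lemma geo_sub m j : ((geo m j.+1 - geo m j) * m <= geo m j)%N.
Proof. by rewrite /= addKn leq_divM. Qed.

(** As [g >= m], the integer quotient of [g] by [m] is at least [g / (2 m)]. *)
Lemma geo_lower m j : (0 < m)%N ->
  (1 + (2 * m%:R)^-1) ^+ j <= (geo m j)%:R :> R.
Proof.
move=> m0; have m0R : 0 < m%:R :> R by rewrite ltr0n.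
elim: j => [|j IH]; first by rewrite ler1n.
rewrite exprSr; set g := geo m j in IH *.
apply: (@le_trans _ _ (g%:R * (1 + (2 * m%:R)^-1))).
  by rewrite ler_wpM2r// addr_ge0// invr_ge0 mulr_ge0// ltW.
rewrite mulrDr mulr1 /= -/g natrD lerD2l ler_pdivrMr ?mulr_gt0//.
rewrite -!natrM ler_nat.
have := divn_eq g m; have := ltn_pmod g m0.
have : (0 < g %/ m)%N by rewrite divn_gt0 ?geo_ge.
by move: (g %/ m)%N (g %% m)%N => q r q0 rm ->; nia.
Qed.

Lemma geo_between m n : (0 < m)%N -> (m < n)%N ->
  exists j, (geo m j < n <= geo m j.+1)%N.
Proof.
move=> m0 mn.
have ex : exists j, (n <= geo m j)%N.
  exists n; elim: n {mn} => // n IH; exact: leq_ltn_trans IH (geo_lt _ m0).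
have [[|j] nj minj] := ex_minnP ex; first by move: nj; rewrite leqNgt mn.
exists j; rewrite nj andbT ltnNge; apply/negP => /minj; by rewrite ltnn.
Qed.

End Growth.

Section UpperLIL.
Context d (T : measurableType d) (R : realType) (P : probability T R).
Variables (p1 : R) (xi1 xi2 : nat -> T -> bool) (u1 u2 : nat -> T -> nat).
Hypothesis model : two_elephant_model P p1 (2^-1) xi1 xi2 u1 u2.
Hypothesis p1_itv : 0 <= p1 <= 1.
Variable b0 : bool * bool.
Let alpha := 2 * p1 - 1.
Let bh := bhist b0 xi1 xi2 u1 u2.

Let alpha_le1 : `|alpha| <= 1.
Proof. by case/andP: p1_itv => ? ?; rewrite ler_norml /alpha; lra. Qed.

(** The threshold makes the Gaussian tail equal to [(j + 2) ^ - (1 + x)], which is summable.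
    Coefficients depending on the horizon let one lemma serve both walks. *)
Lemma no_hit_eventually (a x : R) (c : nat -> nat -> R) (V b : nat -> R) (N : nat -> nat) :
  0 < x -> (forall n, mart_coef alpha a (c n) n) ->
  (forall n, (0 < n)%N -> 0 < V n) -> (forall n, (0 < n)%N -> qvar a (c n) 1 n <= V n) ->
  (forall n, (0 < n)%N -> mart a (c n) [:: b0] <= b n) -> (forall j, (0 < N j)%N) ->
  {ae P, forall w, exists J, forall j, (J <= j)%N -> forall k, (0 < k <= N j)%N ->
    mart a (c (N j)) (bh w k) <
    Num.sqrt (2 * V (N j) * ((1 + x) * ln j.+2%:R)) + b (N j)}.
Proof.
move=> x0 cP V0 qV mb N0.
pose y j := Num.sqrt (2 * V (N j) * ((1 + x) * ln j.+2%:R)).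
pose B j h := y j + b (N j) <= mart a (c (N j)) h.
pose A j := [set w | hits (B j) (bh w (N j))].
have NS j : N j = (N j).-1.+1 by rewrite prednK.
have mA j : measurable (A j) by rewrite /A NS; exact: (measurable_bhist_event model).
pose u j := x^-1 * expR (- (x * ln j.+1%:R)).
have u0 j : 0 <= u j by rewrite mulr_ge0 ?expR_ge0// invr_ge0 ltW.
have PA j : (P (A j) <= (u j - u j.+1)%:E)%E.
  rewrite /A {1}NS (probability_bhist model p1_itv) lee_fin.
  apply: le_trans (zeta_telescope _ x0).
  apply: (@le_trans _ _ (expR (- (y j ^+ 2 / (2 * V (N j)))))).
    apply: (expect_hits_le alpha_le1) => //; rewrite -?NS; [exact: cP|exact: sqrtr_ge0|..].
    - exact: V0.
    - exact: qV.
    - exact: mb.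
  rewrite ler_expR lerN2 sqr_sqrtr; last first.
    by rewrite !mulr_ge0 ?ltW ?V0// ?addr_gt0// ln_gt0// ltr1n.
  rewrite le_eqVlt; apply/orP; left; apply/eqP; field.
  by rewrite gt_eqF// V0.
apply: filterS (borel_cantelli_telescope mA u0 PA) => w [J HJ].
exists J => j Jj k kN; rewrite ltNge; apply/negP => Bk; apply: (HJ j Jj).
by rewrite /A /=; apply: (@hits_bhist _ _ _ _ _ _ (B j) w (N j) k kN).
Qed.

End UpperLIL.

Section Transfer.
Variable R : realType.

Definition lil (n : nat) : R := Num.sqrt (2 * n%:R * ln (ln n%:R)).

Lemma lil_ge0 n : 0 <= lil n.
Proof. exact: sqrtr_ge0. Qed.

Lemma ln2_ge : 2^-1 <= ln 2 :> R.
Proof.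
rewrite -[ln 2]opprK -lnV ?posrE// lerNr.
rewrite [X in ln X](_ : _ = 1 + - 2^-1); last by lra.
by apply: le_ln1Dx; lra.
Qed.

(** Going from the horizon [N] down to [n] loses three factors [1 + x] under the root:
    [N <= (1 + x) n], the exponent [1 + x], and [ln i] against [ln (ln n)]. Their product is below
    the square of [(1 + x) ^ 2], and raising [s] to [s + x] absorbs the logarithmic remainder. *)
Lemma geo_transfer (m J : nat) (s : R) (F : nat -> R) : (0 < m)%N -> 0 <= s ->
  let x := m%:R^-1 in
  (forall i n, (J <= i)%N -> (geo m i < n <= geo m i.+1)%N ->
    F n <= s * Num.sqrt (2 * (geo m i.+1)%:R * ((1 + x) * ln i.+3%:R))
           + (3 + ln (geo m i.+1)%:R)) ->
  exists n0, forall n, (n0 <= n)%N -> F n <= (s + x) * (1 + x) ^+ 2 * lil n.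
Proof.
move=> m0 s0 x HF.
have m0R : 0 < m%:R :> R by rewrite ltr0n.
have x0 : 0 < x by rewrite invr_gt0.
pose k : R := ln (1 + (2 * m%:R)^-1).
have k0 : 0 < k by rewrite ln_gt0// ltrDl invr_gt0 mulr_gt0.
have [J1 HJ1] := ln_shift_le k0 x0.
have [N1 HN1] := ln_le_sqrt x0.
pose J2 := maxn J J1.
exists (maxn (geo m J2.+1) N1).+1 => n nn.
have mn : (m < n)%N.
  by apply: leq_ltn_trans nn; rewrite (leq_trans (geo_ge m J2.+1)) ?leq_maxl.
have [i /andP[gn ng]] := geo_between m0 mn.
have iJ : (J2 <= i)%N.
  rewrite leqNgt; apply/negP => /(geo_mono m0) h.
  have : (geo m i.+1 < n)%N.
    apply: leq_ltn_trans nn; rewrite (leq_trans h)// (leq_trans _ (leq_maxl _ _))//.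
    exact: ltnW (geo_lt _ m0).
  by rewrite ltnNge ng.
have [h1 h2] := HJ1 i (leq_trans (leq_maxr _ _) iJ).
apply: le_trans (HF i n (leq_trans (leq_maxl _ _) iJ) _) _; first by rewrite gn ng.
set N := geo m i.+1 in ng *.
have N0 : 0 < N%:R :> R by rewrite ltr0n (leq_trans _ ng)// (leq_trans _ mn).
have L0 : 2^-1 <= ln i.+3%:R :> R.
  by apply: le_trans ln2_ge _; rewrite ler_ln ?posrE ?ltr0n// ler_nat.
have x1 : 0 <= 1 + x by rewrite addr_ge0// ltW.
have Lp : 0 <= ln i.+3%:R :> R by apply: le_trans L0; rewrite invr_ge0.
set q := Num.sqrt (2 * N%:R * _).
have q1 : 3 + ln N%:R <= x * q.
  apply: le_trans (HN1 N _) _.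
    by apply: leq_trans ng; apply: leq_trans (ltnW nn); rewrite leq_maxr.
  rewrite ler_wpM2l ?(ltW x0)// ler_sqrt ?mulr_ge0//.
  rewrite mulrAC -[leLHS]mul1r ler_wpM2r ?(ltW N0)//.
  have : 0 <= x * ln i.+3%:R by rewrite mulr_ge0 ?(ltW x0)//; lra.
  lra.
apply: (@le_trans _ _ ((s + x) * q)); first by rewrite mulrDl lerD2l.
rewrite -mulrA ler_wpM2l ?addr_ge0 ?(ltW x0)//.
have gi : (geo m i)%:R <= n%:R :> R by rewrite ler_nat ltnW.
have gi0 : 0 < (geo m i)%:R :> R by rewrite ltr0n (leq_trans m0) ?geo_ge.
have Nn : N%:R <= (1 + x) * n%:R.
  apply: (@le_trans _ _ ((1 + x) * (geo m i)%:R)); last first.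
    by rewrite ler_wpM2l// addr_ge0// ltW.
  rewrite mulrDl mul1r -lerBlDl -natrB; last exact: ltnW (geo_lt _ m0).
  by rewrite /x mulrC ler_pdivlMr// -natrM ler_nat geo_sub.
have lnn : i%:R * k <= ln n%:R :> R.
  have v0 : 0 < 1 + (2 * m%:R)^-1 :> R by rewrite addr_gt0// invr_gt0 mulr_gt0.
  rewrite mulr_natl /k -lnXn// ler_ln ?posrE ?exprn_gt0//; last exact: lt_le_trans gi.
  by apply: le_trans gi; exact: geo_lower.
have LL : ln i.+3%:R <= (1 + x) * ln (ln n%:R).
  apply: le_trans h2 _; rewrite ler_wpM2l ?addr_ge0 ?(ltW x0)//.
  by rewrite ler_ln ?posrE//; lra.
rewrite /q /lil; set y := 1 + x in Nn LL *.
have y1 : 1 <= y by rewrite lerDl ltW.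
have ll0 : 0 <= ln (ln n%:R) :> R by apply: ln_ge0; lra.
rewrite -[y ^+ 2]ger0_norm ?sqr_ge0// -sqrtr_sqr -sqrtrM ?sqr_ge0//.
have n0 : 0 <= n%:R :> R by [].
rewrite ler_sqrt; last first.
  by apply: mulr_ge0; [exact: sqr_ge0|apply: mulr_ge0 => //; apply: mulr_ge0].
  apply: (@le_trans _ _ (2 * (y * n%:R) * (y * (y * ln (ln n%:R))))).
    have y0 : 0 <= y by lra.
    by apply: ler_pM; rewrite ?mulr_ge0 ?ler_wpM2l.
  have -> : 2 * (y * n%:R) * (y * (y * ln (ln n%:R))) =
     y ^+ 3 * (2 * n%:R * ln (ln n%:R)) by ring.
  rewrite ler_wpM2r ?mulr_ge0// (_ : (y ^+ 2) ^+ 2 = y ^+ 3 * y); last by ring.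
  by rewrite ler_peMr// exprn_ge0//; lra.
Qed.

End Transfer.

Section UpperLILWalks.
Context d (T : measurableType d) (R : realType) (P : probability T R).
Variables (p1 : R) (xi1 xi2 : nat -> T -> bool) (u1 u2 : nat -> T -> nat).
Hypothesis model : two_elephant_model P p1 (2^-1) xi1 xi2 u1 u2.
Hypothesis p1_itv : 0 <= p1 <= 1.
Variable b0 : bool * bool.
Let alpha := 2 * p1 - 1.
Let bh := bhist b0 xi1 xi2 u1 u2.

Let alpha_le1 : `|alpha| <= 1.
Proof. by case/andP: p1_itv => ? ?; rewrite ler_norml /alpha; lra. Qed.

Lemma walk2_eventually (e x : R) m : `|e| = 1 -> 0 < x -> (0 < m)%N ->
  {ae P, forall w, exists J, forall j, (J <= j)%N -> forall k, (0 < k <= geo m j)%N ->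
    e * walk2 R (bh w k) <
    Num.sqrt (2 * (geo m j)%:R * ((1 + x) * ln j.+2%:R)) + 1}.
Proof.
move=> e1 x0 m0; have N0 j : (0 < geo m j)%N by rewrite (leq_trans m0) ?geo_ge.
have e2 : e ^+ 2 = 1 by rewrite -(real_normK (num_real e)) e1 expr1n.
have := @no_hit_eventually d T R P p1 xi1 xi2 u1 u2 model p1_itv b0 0 x (fun _ _ => e)
  (fun n => n%:R) (fun=> 1) (geo m) x0 (const_coefP _ _).
have V0 n : (0 < n)%N -> 0 < n%:R :> R by rewrite ltr0n.
have qV n : (0 < n)%N -> qvar 0 (fun=> e) 1 n <= n%:R.
  by case: n => // n _; rewrite qvar_const e2 mul1r ler_nat.
have mb n : (0 < n)%N -> mart 0 (fun=> e) [:: b0] <= 1.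
  move=> _; rewrite /mart mul0r add0r walk2_cons /walk2 big_nil addr0.
  by apply: le_trans (ler_norm _) _; rewrite normrM e1 sgn_norm mulr1.
move=> /(_ V0 qV mb N0); apply: filterS => w [J HJ]; exists J => j Jj k kj.
by have := HJ j Jj k kj; rewrite /mart mul0r add0r.
Qed.

Lemma walk2_lil (e : R) : `|e| = 1 ->
  {ae P, forall w, exists n0, forall n, (n0 <= n)%N -> e * walk2 R (bh w n) <= 2 * lil R n}.
Proof.
move=> e1; have x0 : 0 < 4%:R^-1 :> R by rewrite invr_gt0.
apply: filterS (@walk2_eventually e _ 4 e1 x0 isT) => w [J HJ].
(* With [s = 1] and [x = 1 / 4] the constant is [(5 / 4) ^ 3 = 125 / 64 < 2]. *)
have [|n0 Hn0] := @geo_transfer R 4 J 1 (fun n => e * walk2 R (bh w n)) isT ler01.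
  move=> i n Ji /andP[n1 n2]; rewrite mul1r.
  have := HJ i.+1 (leqW Ji) n; rewrite n2 (leq_ltn_trans _ n1)// => /(_ isT)/ltW/le_trans; apply.
  rewrite lerD2l; have : 0 <= ln (geo 4 i.+1)%:R :> R.
    by apply: ln_ge0; rewrite ler1n (leq_ltn_trans _ (leq_trans n1 n2)).
  lra.
exists n0 => n nn; apply: le_trans (Hn0 n nn) _; rewrite ler_wpM2r ?lil_ge0//.
lra.
Qed.

(** At a time [n] in the block ending at [N], the martingale differs from [e * walk1] by
    [e * alpha * harm n N * walk2], where [harm n N <= x]. Bounds on [walk2] of both signs make this
    a fraction [x] of the main term. *)
Lemma walk1_lil (e K : R) : `|e| = 1 -> Num.sqrt (1 + 2 * alpha ^+ 2) < K ->
  {ae P, forall w, exists n0, forall n, (n0 <= n)%N -> e * walk1 R (bh w n) <= K * lil R n}.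
Proof.
set s := Num.sqrt _ => e1 sK.
have e2 : e ^+ 2 = 1 by rewrite -(real_normK (num_real e)) e1 expr1n.
have s0 : 0 <= s by exact: sqrtr_ge0.
have v0 : 0 < 1 + 2 * alpha ^+ 2 by rewrite ltr_pwDl// mulr_ge0 ?sqr_ge0.
(* This [m] gives [x * (8 + 3 s) <= K - s], which with [x <= 1] yields the final
   [(s + 2 x) * (1 + 3 x) <= K]. *)
pose B := (8 + 3 * s) / (K - s); pose m := (Num.bound `|B|).+1.
have m0 : (0 < m)%N by [].
pose x : R := m%:R^-1.
have x0 : 0 < x by rewrite invr_gt0 ltr0n.
have x1 : x <= 1 by rewrite invf_le1 ?ltr0n// ler1n.
have xK : x * (8 + 3 * s) <= K - s.
  rewrite mulrC ler_pdivrMr ?ltr0n// -ler_pdivrMl ?subr_gt0// mulrC -/B.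
  apply: le_trans (ler_norm _) _; apply: ltW; apply: lt_le_trans (archi_boundP (normr_ge0 B)) _.
  by rewrite ler_nat.
have N0 j : (0 < geo m j)%N by rewrite (leq_trans m0) ?geo_ge.
have ne1 : `|- e| = 1 by rewrite normrN.
have h1 := walk2_eventually e1 x0 m0; have h2 := walk2_eventually ne1 x0 m0.
have := @no_hit_eventually d T R P p1 xi1 xi2 u1 u2 model p1_itv b0 e x (walk_coef alpha e)
  (fun n => (1 + 2 * alpha ^+ 2) * n%:R) (fun n => 2 + ln n%:R) (geo m) x0 (walk_coefP _ _).
have V0 n : (0 < n)%N -> 0 < (1 + 2 * alpha ^+ 2) * n%:R :> R.
  by move=> n0; rewrite mulr_gt0// ltr0n.
have qV n : (0 < n)%N -> qvar e (walk_coef alpha e n) 1 n <= (1 + 2 * alpha ^+ 2) * n%:R.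
  by move=> _; apply: le_trans (qvar_walk _ _ _) _; rewrite e2 mul1r.
have mb n : (0 < n)%N -> mart e (walk_coef alpha e n) [:: b0] <= 2 + ln n%:R.
  move=> n0; rewrite /mart walk1_cons walk2_cons /walk1 /walk2 !big_nil !addr0 /=.
  apply: le_trans (ler_norm _) _; apply: le_trans (ler_normD _ _) _.
  rewrite !normrM !sgn_norm !mulr1 e1 mul1r (ger0_norm (harm_ge0 _ _ _)).
  have : `|alpha| * harm R 1 n <= harm R 1 n by rewrite ler_piMl ?harm_ge0.
  have := harm_ln R n0; lra.
move=> /(_ V0 qV mb N0) h0; near=> w.
have [J0 H0] : exists J, forall j, (J <= j)%N -> forall k, (0 < k <= geo m j)%N ->
    mart e (walk_coef alpha e (geo m j)) (bh w k) <
    Num.sqrt (2 * ((1 + 2 * alpha ^+ 2) * (geo m j)%:R) * ((1 + x) * ln j.+2%:R)) +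
      (2 + ln (geo m j)%:R) by near: w.
have [J1 H1] : exists J, forall j, (J <= j)%N -> forall k, (0 < k <= geo m j)%N ->
    e * walk2 R (bh w k) <
    Num.sqrt (2 * (geo m j)%:R * ((1 + x) * ln j.+2%:R)) + 1 by near: w.
have [J2 H2] : exists J, forall j, (J <= j)%N -> forall k, (0 < k <= geo m j)%N ->
    - e * walk2 R (bh w k) <
    Num.sqrt (2 * (geo m j)%:R * ((1 + x) * ln j.+2%:R)) + 1 by near: w.
have sx0 : 0 <= s + x by rewrite addr_ge0// ltW.
have [|n0 Hn0] := @geo_transfer R m (J0 + J1 + J2) (s + x)
    (fun n => e * walk1 R (bh w n)) m0 sx0.
  move=> i n Ji /andP[n1 n2].
  have n0 : (0 < n)%N by exact: leq_ltn_trans n1.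
  have ni : (0 < n <= geo m i.+1)%N by rewrite n0.
  have l0 : (J0 <= i.+1)%N by clear -Ji; lia.
  have l1 : (J1 <= i.+1)%N by clear -Ji; lia.
  have l2 : (J2 <= i.+1)%N by clear -Ji; lia.
  have := H0 i.+1 l0 n ni; have := H1 i.+1 l1 n ni; have := H2 i.+1 l2 n ni; rewrite -/x.
  set N := geo m i.+1; set W := walk2 R _.
  have -> : 2 * ((1 + 2 * alpha ^+ 2) * N%:R) * ((1 + x) * ln i.+3%:R) =
     (1 + 2 * alpha ^+ 2) * (2 * N%:R * ((1 + x) * ln i.+3%:R)) by ring.
  rewrite [Num.sqrt ((1 + 2 * alpha ^+ 2) * _)]sqrtrM ?(ltW v0)// -/s.
  set y := Num.sqrt _ => W2 W1.
  rewrite /mart size_bhist -/W => S0.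
  have y0 : 0 <= y by exact: sqrtr_ge0.
  have Wy : `|e * W| <= y + 1 by rewrite ler_norml; apply/andP; split; lra.
  have cW : `|alpha * harm R n N * (e * W)| <= x * (y + 1).
    rewrite normrM ler_pM// normrM (ger0_norm (harm_ge0 _ _ _)).
    apply: (@le_trans _ _ (harm R n N)); first by rewrite ler_piMl ?harm_ge0.
    apply: le_trans (harm_le _ _ n0) _; rewrite ler_pdivrMr ?ltr0n//.
    rewrite /x mulrC ler_pdivlMr ?ltr0n// -natrM ler_nat.
    apply: leq_trans (ltnW n1); apply: leq_trans (geo_sub m i).
    by rewrite leq_mul2r leq_sub2l ?orbT// ltnW.
  move: cW; rewrite ler_norml => /andP[cW _].
  move: S0; rewrite /walk_coef -/N -/W.
  rewrite (_ : e * alpha * harm R n N * W = alpha * harm R n N * (e * W)); last by ring.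
  lra.
exists n0 => n nn; apply: le_trans (Hn0 n nn) _; rewrite ler_wpM2r ?lil_ge0// -/x.
have xx : 0 <= x * (1 - x) by rewrite mulr_ge0 ?subr_ge0// ltW.
have h3 : (1 + x) ^+ 2 <= 1 + 3 * x by rewrite expr2; lra.
have : (s + x + x) * (1 + x) ^+ 2 <= (s + x + x) * (1 + 3 * x).
  by rewrite ler_wpM2l// !addr_ge0// ltW.
lra.
Unshelve. all: by end_near. Qed.

End UpperLILWalks.

(** * Lower half of the law of the iterated logarithm *)

Section LowerLIL.
Context d (T : measurableType d) (R : realType) (P : probability T R).
Variables (p1 : R) (xi1 xi2 : nat -> T -> bool) (u1 u2 : nat -> T -> nat).
Hypothesis model : two_elephant_model P p1 (2^-1) xi1 xi2 u1 u2.
Hypothesis p1_itv : 0 <= p1 <= 1.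
Variable b0 : bool * bool.
Let alpha := 2 * p1 - 1.
Let bh := bhist b0 xi1 xi2 u1 u2.

Let alpha_le1 : `|alpha| <= 1.
Proof. by case/andP: p1_itv => ? ?; rewrite ler_norml /alpha; lra. Qed.

Variable m : nat.
Hypothesis m_gt0 : (0 < m)%N.
Hypothesis m_large : 24 * 1000 * (1 + m%:R) <= 2 ^+ m :> R.

Let N j := ((4 ^ m) ^ j)%N.
Let L (j : nat) : R := ln j.+2%:R.

Let N_gt0 j : (0 < N j)%N.
Proof. by rewrite !expn_gt0. Qed.

Let NS j : N j.+1 = (4 ^ m * N j)%N.
Proof. by rewrite /N expnS. Qed.

Let N_le j : (N j <= N j.+1)%N.
Proof. by rewrite NS leq_pmull// expn_gt0. Qed.

Let N_ge j : (j < N j)%N.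
Proof.
elim: j => [|j IH]; first exact: N_gt0.
rewrite NS; have : (1 < 4 ^ m)%N by rewrite -[ltnLHS](expn0 4) ltn_exp2l.
by move: IH; move: (4 ^ m)%N (N j) => a b; nia.
Qed.

(* At the time [N j.+1] the walk exceeds the martingale value at [N j] by a multiple
   of [sqrt (N j.+1 * log j)]. *)
Definition jump j (h : hist) : bool :=
  mart 1 (walk_coef alpha 1 (N j.+1)) (drop (N j.+1 - N j) h)
    + Num.sqrt ((N j.+1)%:R * L j) / 1000 <= walk1 R h.

Fixpoint no_jump J n (h : hist) : bool :=
  if n is k.+1 then
    no_jump J k (drop (N (J + k).+1 - N (J + k)) h) && ~~ jump (J + k) h
  else true.

Let jump_threshold := exists J0, forall j, (J0 <= j)%N ->
  1536 * ln 2 <= L j /\ L j * (2 + 3 * m%:R) ^+ 2 <= 24 * (N j.+1)%:R.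

Let jump_thresholdP : jump_threshold.
Proof.
pose B : R := expR (1536 * ln 2).
exists (Num.bound B) => j Bj; split.
  rewrite /L -ler_expR lnK ?posrE ?ltr0n// -/B; apply: ltW.
  apply: lt_le_trans (archi_boundP (expR_ge0 _)) _.
  by rewrite ler_nat (leq_trans Bj)// -addn2 leq_addr.
have m0 : 0 <= m%:R :> R by [].
have mm : (2 + 3 * m%:R) ^+ 2 <= (4 ^ m)%:R :> R.
  rewrite natrX (_ : 4%:R = 2 ^+ 2); last by ring.
  rewrite -exprM mulnC exprM lerXn2r ?nnegrE ?exprn_ge0 ?addr_ge0 ?mulr_ge0//.
  apply: le_trans m_large; lra.
have Lj : L j <= 24 * (N j)%:R.
  apply: (@le_trans _ _ j.+2%:R); first by apply/ltW/ln_sublinear; rewrite ltr0n.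
  by rewrite -natrM ler_nat; have := N_ge j; move: (N j) => a; clear; lia.
rewrite NS natrM mulrA [24 * _]mulrC -mulrA mulrC ler_pM// ?sqr_ge0//.
by apply: ln_ge0; rewrite ler1n.
Qed.

(** This is [((J + 2) / (J + n + 2)) ^ (1 / 4)], a closed-form majorant of the product of the
    factors [1 - 1 / (4 (j + 2))]. *)
Let decay J n : R := expR (- ((ln (J + n).+2%:R - ln J.+2%:R) / 4)).

(** The lower bound on the jump probability holds for every history at time [N j], so failure
    probabilities multiply across blocks although the blocks are dependent. *)
Lemma expect_no_jump J n :
  (forall j, (J <= j)%N -> 1536 * ln 2 <= L j /\
    L j * (2 + 3 * m%:R) ^+ 2 <= 24 * (N j.+1)%:R) ->
  expect alpha (N (J + n)).-1 (fun h => (no_jump J n h)%:R) [:: b0] <= decay J n.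
Proof.
move=> JP; elim: n => [|n IH].
  by rewrite addn0 /decay addn0 subrr mul0r oppr0 expR0 expect_cst.
set j := (J + n)%N; have [c1 c2] := JP j (leq_addr _ _).
have -> : (N (J + n.+1)).-1 = ((N j).-1 + (N j.+1 - N j))%N.
  rewrite addnS -/j; have := N_le j; have := N_gt0 j.
  move: (N j) (N j.+1) => a b; clear; lia.
set q : R := 1 - 4^-1 * expR (- L j).
have eL : expR (- L j) = j.+2%:R^-1 by rewrite expRN lnK ?posrE ?ltr0n.
have qd : q * decay J n <= decay J n.+1.
  have -> : decay J n.+1 = expR (- ((ln j.+3%:R - ln j.+2%:R) / 4)) * decay J n.
    by rewrite /decay -expRD addnS; congr expR; rewrite -/j; field.
  rewrite ler_pM2r ?expR_gt0//; apply: le_trans (expR_ge1Dx _).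
  have qE (a b : R) : a <= b -> 1 - 4^-1 * b <= 1 + - (a / 4) by lra.
  rewrite /q eL; apply: qE.
  rewrite -ln_div ?posrE ?ltr0n//.
  have -> : j.+3%:R / j.+2%:R = 1 + j.+2%:R^-1 :> R.
    by rewrite -[j.+3%:R]natr1 mulrDl divff ?pnatr_eq0// mul1r.
  by apply: le_ln1Dx; apply: lt_le_trans (_ : 0 <= _); rewrite ?ltrN10 ?invr_ge0.
apply: le_trans qd; rewrite expect_add.
apply: (@le_trans _ _ (q * expect alpha (N j).-1 (fun h => (no_jump J n h)%:R) [:: b0])).
  rewrite -expectZ; apply: (expect_le alpha_le1) => g [sg _].
  have {}sg : size g = N j by rewrite sg /= addn1 prednK.
  pose F g h' : R := (no_jump J n g)%:R *
    (1 - (mart 1 (walk_coef alpha 1 (N j.+1)) g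
           + Num.sqrt ((N j.+1)%:R * L j) / 1000 <= walk1 R h')%R%:R).
  rewrite (@expect_eq _ _ alpha_le1 _ _ (fun h' => F (drop (N j.+1 - N j) h') h')); last first.
    move=> h' _; rewrite /F /= -/j /jump; case: (no_jump _ _ _); rewrite ?mul0r//=.
    by case: (_ <= _); rewrite mul1r ?subrr ?subr0.
  rewrite (expect_drop alpha_le1) /F expectZ mulrC ler_wpM2r//.
  rewrite (expectB alpha_le1) expect_cst /q lerD2l lerN2.
  have := @walk1_large_increment R alpha alpha_le1 m g (L j).
  by lazy zeta; rewrite sg -NS; apply.
rewrite ler_wpM2l// /q eL subr_ge0 -invfM -[leRHS]invr1 lef_pV2 ?posrE ?mulr_gt0 ?ltr0n//.
by rewrite -natrM ler1n.
Qed.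

Lemma no_jump_bhist J n w :
  (forall j, (J <= j)%N -> ~~ jump j (bh w (N j.+1))) -> no_jump J n (bh w (N (J + n))).
Proof.
move=> H; elim: n => //= n IH; rewrite addnS H ?leq_addr// andbT.
by rewrite /bh drop_bhist//; exact: N_le.
Qed.

Lemma jump_io : {ae P, forall w, forall J, exists2 j, (J <= j)%N & jump j (bh w (N j.+1))}.
Proof.
have [J0 HJ0] := jump_thresholdP.
apply/ae_foralln => J0'; set J := maxn J0 J0'.
have HJ j : (J <= j)%N -> 1536 * ln 2 <= L j /\
    L j * (2 + 3 * m%:R) ^+ 2 <= 24 * (N j.+1)%:R.
  by move=> Jj; apply: HJ0; exact: leq_trans (leq_maxl _ _) Jj.
pose A n := [set w | no_jump J n (bh w (N (J + n)))].
have Np n : N (J + n) = (N (J + n)).-1.+1 by rewrite prednK.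
have mA n : measurable (A n) by rewrite /A Np; exact: (measurable_bhist_event model).
have PA n : (P (A n) <= (decay J n)%:E)%E.
  by rewrite /A {1}Np (probability_bhist model p1_itv) lee_fin expect_no_jump.
have mI : measurable (\bigcap_n A n) by apply: bigcap_measurable => // n _; exact: mA.
exists (\bigcap_n A n); split=> //.
  apply/eqP; rewrite eq_le measure_ge0 andbT; apply/lee_addgt0Pr => e e0.
  rewrite add0e.
  pose n := Num.bound (expR (ln J.+2%:R - 4 * ln e)).
  apply: (@le_trans _ _ (P (A n))).
    by apply: le_measure; rewrite ?inE// => w; apply.
  apply: le_trans (PA n) _; rewrite lee_fin /decay -[leRHS]lnK ?posrE// ler_expR.
  suff : ln J.+2%:R - 4 * ln e <= ln (J + n).+2%:R by lra.
  rewrite -ler_expR [leRHS]lnK ?posrE ?ltr0n//; apply: ltW.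
  apply: lt_le_trans (archi_boundP (expR_ge0 _)) _; rewrite ler_nat -/n; lia.
move=> w /= nw n _; apply: no_jump_bhist => j Jj; apply/negP => jj.
by apply: nw; exists j => //; exact: leq_trans (leq_maxr _ _) Jj.
Qed.

End LowerLIL.

Section LowerLILPath.
Context d (T : measurableType d) (R : realType) (P : probability T R).
Variables (p1 : R) (xi1 xi2 : nat -> T -> bool) (u1 u2 : nat -> T -> nat).
Hypothesis model : two_elephant_model P p1 (2^-1) xi1 xi2 u1 u2.
Hypothesis p1_itv : 0 <= p1 <= 1.
Variable b0 : bool * bool.
Let alpha := 2 * p1 - 1.
Let bh := bhist b0 xi1 xi2 u1 u2.

Let alpha_le1 : `|alpha| <= 1.
Proof. by case/andP: p1_itv => ? ?; rewrite ler_norml /alpha; lra. Qed.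

Lemma exists_large_exponent : exists2 m, (0 < m)%N & 24 * 1000 * (1 + m%:R) <= 2 ^+ m :> R.
Proof.
(* [24000 * 21 = 504000], whereas [2 ^ 20] exceeds one million. *)
exists 20 => //; rewrite (exprM 2 10 2).
have -> : 2 ^+ 10 = 1024 :> R by ring.
rewrite expr2; lra.
Qed.

Lemma sqrt_bound3 : Num.sqrt (1 + 2 * alpha ^+ 2) < 3.
Proof.
have a2 : alpha ^+ 2 <= 1.
  by rewrite -(real_normK (num_real alpha)) -(expr1n _ 2) lerXn2r ?nnegrE.
have a0 := sqr_ge0 alpha.
have -> : 3 = Num.sqrt (3 ^+ 2) :> R by rewrite sqrtr_sqr ger0_norm.
by rewrite ltr_sqrt ?exprn_gt0// expr2; lra.
Qed.

(** With [r = sqrt (M * ln (j + 2))] the jump gains [2 ^ m * r / 1000]. The martingale value at [M]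
    costs at most [6 r] through the first walk and [3 m * 4 r] through the second, together at most
    [12 (1 + m) r], which [mL] keeps below half the gain. As [lil N <= 2 * 2 ^ m * r], the constant
    is 4000. *)
Lemma walk1_lil_io : {ae P, forall w, forall n0, exists2 n, (n0 <= n)%N &
  lil R n <= 4000 * walk1 R (bh w n)}.
Proof.
have [m m0 mL] := exists_large_exponent.
have n1 : `|1 : R| = 1 by rewrite normr1.
have nN1 : `|- 1 : R| = 1 by rewrite normrN normr1.
have hS := walk1_lil model p1_itv b0 nN1 sqrt_bound3.
have hW1 := walk2_lil model p1_itv b0 n1.
have hW2 := walk2_lil model p1_itv b0 nN1.
have hJ := jump_io model p1_itv b0 m0 mL.
near=> w.
have [a0 A0] : exists n0, forall n, (n0 <= n)%N -> -1 * walk1 R (bh w n) <= 3 * lil R n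
  by near: w.
have [a1 A1] : exists n0, forall n, (n0 <= n)%N -> 1 * walk2 R (bh w n) <= 2 * lil R n
  by near: w.
have [a2 A2] : exists n0, forall n, (n0 <= n)%N -> -1 * walk2 R (bh w n) <= 2 * lil R n
  by near: w.
have J : forall J, exists2 j, (J <= j)%N & jump p1 m j (bh w ((4 ^ m) ^ j.+1)%N)
  by near: w.
move=> n0.
pose k : R := m%:R * ln 4.
have k0 : 0 < k by rewrite mulr_gt0 ?ltr0n// ln_gt0// ltr1n.
have [j jJ jN] := J (a0 + a1 + a2 + n0 + Num.bound k).+1.
set N := ((4 ^ m) ^ j.+1)%N; set M := ((4 ^ m) ^ j)%N.
have NM : N = (4 ^ m * M)%N by rewrite /N /M expnS.
have Mj : (j < M)%N.
  by rewrite /M -expnM; apply: leq_trans (ltn_expl j (isT : (1 < 4)%N)) _;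
    rewrite leq_exp2l// leq_pmull.
have MN : (M <= N)%N by rewrite NM leq_pmull// expn_gt0.
have lnN i : ln ((4 ^ m) ^ i)%N%:R = i%:R * k :> R.
  by rewrite -expnM natrX lnXn// /k -[ln _ *+ _]mulr_natl natrM; ring.
have L0 : 0 < ln j.+2%:R :> R by rewrite ln_gt0// ltr1n.
have kj : k <= j.+2%:R.
  apply/ltW; apply: lt_le_trans (archi_boundP (ltW k0)) _.
  by rewrite ler_nat; clear -jJ; lia.
have j0 : (0 < j)%N by clear -jJ; lia.
(* The logarithm of the horizon is [i * k <= (j + 2) ^ 2], so its logarithm is at most
   [2 * ln (j + 2)]. *)
have lil_le i : (0 < i <= j.+1)%N ->
    lil R ((4 ^ m) ^ i)%N <= 2 * Num.sqrt (((4 ^ m) ^ i)%N%:R * ln j.+2%:R).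
  move=> /andP[i0 ij]; rewrite /lil lnN.
  rewrite -[2 in leRHS]ger0_norm// -sqrtr_sqr -sqrtrM ?sqr_ge0//.
  rewrite ler_sqrt; last by rewrite mulr_ge0 ?sqr_ge0// mulr_ge0 ?(ltW L0).
  have -> : 2 ^+ 2 * (((4 ^ m) ^ i)%N%:R * ln j.+2%:R) =
    2 * ((4 ^ m) ^ i)%N%:R * (2 * ln j.+2%:R) :> R by ring.
  rewrite ler_wpM2l ?mulr_ge0//.
  have -> : 2 * ln j.+2%:R = ln (j.+2%:R ^+ 2) :> R by rewrite lnXn ?ltr0n// mulr_natl.
  have ik : 0 < i%:R * k by rewrite mulr_gt0 ?ltr0n.
  have jj : 0 < j.+2%:R ^+ 2 :> R by rewrite exprn_gt0 ?ltr0n.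
  rewrite ler_ln ?posrE// expr2; apply: ler_pM => //; first exact: ltW.
  by rewrite ler_nat leqW.
have lilN := lil_le j.+1 (leqnn _); have lilM := lil_le j _.
rewrite -/N -/M j0 leqnSn in lilN lilM; have {}lilM := lilM isT.
move: jN; rewrite /jump -/N -/M /bh drop_bhist// -/bh => jN.
have sqNM : Num.sqrt (N%:R * ln j.+2%:R) = 2 ^+ m * Num.sqrt (M%:R * ln j.+2%:R) :> R.
  rewrite NM natrM -mulrA sqrtrM ?ler0n//; congr (_ * _).
  rewrite natrX (_ : 4%:R = 2 ^+ 2); last by ring.
  by rewrite exprAC sqrtr_sqr ger0_norm// exprn_ge0.
have hMN : harm R M N <= 3 * m%:R by rewrite NM; apply: harm_pow4; exact: leq_ltn_trans Mj.
have M_ge : (a0 + a1 + a2 + n0 < M)%N.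
  by apply: leq_ltn_trans Mj; clear -jJ; lia.
have g0 : (a0 <= M)%N by clear -M_ge; lia.
have g1 : (a1 <= M)%N by clear -M_ge; lia.
have g2 : (a2 <= M)%N by clear -M_ge; lia.
have S0 := A0 M g0; have S1 := A1 M g1; have S2 := A2 M g2.
exists N; first by apply: leq_trans MN; clear -M_ge; lia.
apply: le_trans lilN _; move: jN; rewrite sqNM /mart size_bhist /walk_coef.
set r := Num.sqrt (M%:R * _) in lilM *.
have r0 : 0 <= r by exact: sqrtr_ge0.
set W := walk2 R _ in S1 S2 *; set S := walk1 R (bh w M) in S0 *.
have Wr : `|W| <= 4 * r by rewrite ler_norml; apply/andP; split; lra.
have cW : `|1 * alpha * harm R M N * W| <= 3 * m%:R * (4 * r).
  rewrite normrM ler_pM// mul1r normrM (ger0_norm (harm_ge0 _ _ _)).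
  by apply: le_trans hMN; rewrite ler_piMl ?harm_ge0.
move: cW; rewrite ler_norml => /andP[cW _].
rewrite -/alpha; have := ler_wpM2r r0 mL; lra.
Unshelve. all: by end_near. Qed.

End LowerLILPath.

(** * The central limit theorem *)

Section StandardNormal.
Variable R : realType.

Let N01 : probability (measurableTypeR R) R := normal_prob (0 : R) 1.

Definition Phi (x : R) : R := fine (normal_prob (0 : R) 1 `]-oo, x]).
Definition phi (x : R) : R := normal_pdf 0 1 x.

Lemma PhiE (x : R) : (Phi x)%:E = normal_prob (0 : R) 1 `]-oo, x].
Proof. by rewrite /Phi fineK// (@fin_num_measure _ _ _ N01). Qed.

Lemma phiE (x : R) : phi x = normal_peak 1 * expR (- (x * x) / 2).
Proof.
rewrite /phi normal_pdfE ?oner_neq0// /normal_fun subr0 expr2.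
by rewrite expr1n mulr2n -[1 + 1]/(2%:R).
Qed.

Lemma phi_ge0 x : 0 <= phi x.
Proof. exact: normal_pdf_ge0. Qed.

Lemma normal_peak_le1 : normal_peak 1 <= 1 :> R.
Proof.
rewrite /normal_peak expr1n mul1r invf_le1; last first.
  by rewrite sqrtr_gt0 mulrn_wgt0// pi_gt0.
rewrite -[leLHS]sqrtr1 ler_sqrt; last by rewrite mulrn_wge0// pi_ge0.
by rewrite mulr2n; have := @pi_ge2 R; lra.
Qed.

Lemma phi_le x : phi x <= expR (- (x * x) / 2).
Proof. by rewrite phiE ler_piMl ?expR_ge0// normal_peak_le1. Qed.

Lemma phi_le1 x : phi x <= 1.
Proof.
apply: le_trans (phi_le x) _; rewrite -[leRHS]expR0 ler_expR.
by have := sqr_ge0 x; rewrite expr2; lra.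
Qed.

Lemma phi_sqr_le x : x ^+ 2 * phi x <= 2.
Proof.
apply: (@le_trans _ _ (x ^+ 2 * expR (- (x * x) / 2))).
  by rewrite ler_wpM2l ?sqr_ge0// phi_le.
have -> : - (x * x) / 2 = - (x ^+ 2 / 2) :> R by rewrite expr2; lra.
rewrite expRN ler_pdivrMr ?expR_gt0//; have := expR_ge1Dx (x ^+ 2 / 2); lra.
Qed.

Lemma phi_exp4_le x : x ^+ 4 * phi x <= 16.
Proof.
apply: (@le_trans _ _ (x ^+ 4 * expR (- (x * x) / 2))).
  by rewrite ler_wpM2l ?exprn_even_ge0// phi_le.
have -> : - (x * x) / 2 = - (2%:R * (x ^+ 2 / 4)) :> R by rewrite expr2; lra.
rewrite expRN expRM_natl ler_pdivrMr ?exprn_gt0 ?expR_gt0//.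
have h := expR_ge1Dx (x ^+ 2 / 4); have h0 := sqr_ge0 x.
have : (x ^+ 2 / 4) ^+ 2 <= expR (x ^+ 2 / 4) ^+ 2.
  by rewrite lerXn2r ?nnegrE ?expR_ge0 ?divr_ge0//; lra.
have -> : (x ^+ 2 / 4) ^+ 2 = x ^+ 4 / 16 by field.
lra.
Qed.

Lemma is_derive_Phi (x : R) : is_derive x 1 Phi (phi x).
Proof.
have xx1 : x < x + 1 by rewrite ltrDl.
have iphi : lebesgue_measure.-integrable [set` `]-oo, x + 1]] (EFin \o phi).
  by apply: (integrableS _ _ (subsetT _)) => //; exact: integrable_normal_pdf.
have cphi : {for x, continuous phi} by apply: continuous_normal_pdf; rewrite oner_eq0.
have [] := continuous_FTC1 xx1 iphi _ cphi; first by rewrite ltNyr.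
move=> d1 d2; apply: DeriveDef; first exact: d1.
by rewrite -derive1E; exact: d2.
Qed.

Lemma is_derive_phi (x : R) : is_derive x 1 phi (- x * phi x).
Proof.
have -> : phi = fun y => normal_peak 1 * expR (- (y * y) / 2).
  by apply/funext => y; exact: phiE.
apply: (is_derive_mul (is_derive_const _ _) (is_derive_chain (is_derive_expR _)
  (is_derive_mul (is_derive_opp (is_derive_mul (is_derive_id x 1) (is_derive_id x 1) erefl)
     erefl) (is_derive_const _ _) erefl) erefl)).
by field.
Qed.

Lemma Phi_le x y : x <= y -> Phi x <= Phi y.
Proof.
move=> xy; rewrite -lee_fin !PhiE; apply: (@le_measure _ _ _ N01); rewrite ?inE//.
exact: subitvPr.
Qed.

Lemma Phi_lip x y : x <= y -> Phi y - Phi x <= y - x.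
Proof.
move=> xy; have [c|c|c c0 ->] := @MVT_segment R Phi phi x y xy.
- by move=> _; exact: is_derive_Phi.
- apply: derivable_within_continuous => z _.
  by have [] := is_derive_Phi z.
- by rewrite ler_piMl ?subr_ge0// phi_le1.
Qed.

Let idTR : measurableTypeR R -> R := idfun.

#[local] HB.instance Definition _ :=
  @isMeasurableFun.Build _ _ _ _ idTR (@measurable_id _ _ setT).

Let cdf_idTR x : cdf (idTR : {RV N01 >-> R}) x = (Phi x)%:E.
Proof. by rewrite PhiE. Qed.

Lemma Phi_tails (e : R) : 0 < e ->
  exists2 M, 1 <= M & Phi (- M) <= e /\ 1 - e <= Phi M.
Proof.
move=> e0.
have cy : Phi x @[x --> +oo] --> (1 : R).
  have := cvg_cdfy1 (idTR : {RV N01 >-> R}).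
  rewrite (_ : cdf _ = EFin \o Phi); last by apply/funext => x; exact: cdf_idTR.
  by move/fine_cvgP => [].
have cNy : Phi x @[x --> -oo] --> (0 : R).
  have := cvg_cdfNy0 (idTR : {RV N01 >-> R}).
  rewrite (_ : cdf _ = EFin \o Phi); last by apply/funext => x; exact: cdf_idTR.
  by move/fine_cvgP => [].
move/cvgrPdist_le : cy => /(_ e e0)[M1 [_ H1]].
move/cvgrPdist_le : cNy => /(_ e e0)[M2 [_ H2]].
pose M := Num.max 1 (Num.max (M1 + 1) (- M2 + 1)).
have a1 : 1 <= M by rewrite le_max lexx.
have a2 : M1 + 1 <= M by rewrite !le_max lexx !orbT.
have a3 : - M2 + 1 <= M by rewrite !le_max lexx !orbT.
exists M => //; split.
  have : - M < M2 by lra.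
  move=> /H2; rewrite sub0r normrN => /(le_trans (ler_norm _)); exact.
have : M1 < M by lra.
by move=> /H1 /= /(le_trans (ler_norm _)); lra.
Qed.

End StandardNormal.

(** * Taylor estimates *)

Section Taylor.
Variable R : realType.

Lemma mvt_abs (f f1 : R -> R) (d M : R) : 0 <= d ->
  (forall t, 0 <= t <= d -> is_derive t 1 f (f1 t)) ->
  (forall t, 0 <= t <= d -> `|f1 t| <= M) -> `|f d - f 0| <= M * d.
Proof.
move=> d0 df fM.
have itvP (t : R) : t \in `[0, d] -> 0 <= t <= d by rewrite in_itv.
have [c|c|c /itvP c0 ->] := @MVT_segment R f f1 0 d d0.
- by rewrite in_itv /= => /andP[c0 cd]; apply: df; rewrite !ltW.
- by apply: derivable_within_continuous => t /itvP t0; have [] := df t t0.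
- by rewrite subr0 normrM (ger0_norm d0) ler_wpM2r// fM.
Qed.

(** The mean value inequality is iterated, which loses only the factorial in the remainder. *)
Lemma taylor2 (f f1 f2 : R -> R) (d B : R) : 0 <= d ->
  (forall t, 0 <= t <= d -> is_derive t 1 f (f1 t)) ->
  (forall t, 0 <= t <= d -> is_derive t 1 f1 (f2 t)) ->
  (forall t, 0 <= t <= d -> `|f2 t| <= B) ->
  `|f d - f 0 - d * f1 0| <= B * d ^+ 2.
Proof.
move=> d0 df df1 fB.
have B0 : 0 <= B by apply: le_trans (fB 0 _); rewrite ?lexx.
have := @mvt_abs (fun t => f t - t * f1 0) (fun t => f1 t - f1 0) d (B * d) d0.
rewrite mul0r subr0 expr2 mulrA addrAC; apply.
  move=> t t0; apply: (is_derive_add (df t t0) (is_derive_opp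
    (is_derive_mul (is_derive_id t 1) (is_derive_const _ _) erefl) erefl)).
  by ring.
move=> t /andP[t0 td]; apply: (@le_trans _ _ (B * t)); last by rewrite ler_wpM2l.
by apply: (@mvt_abs f1 f2) => // r /andP[r0 rt]; [apply: df1|apply: fB];
  rewrite r0 (le_trans rt).
Qed.

Lemma taylor3 (f f1 f2 f3 : R -> R) (d B : R) : 0 <= d ->
  (forall t, 0 <= t <= d -> is_derive t 1 f (f1 t)) ->
  (forall t, 0 <= t <= d -> is_derive t 1 f1 (f2 t)) ->
  (forall t, 0 <= t <= d -> is_derive t 1 f2 (f3 t)) ->
  (forall t, 0 <= t <= d -> `|f3 t| <= B) ->
  `|f d - f 0 - d * f1 0 - d ^+ 2 / 2 * f2 0| <= B * d ^+ 3.
Proof.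
move=> d0 df df1 df2 fB.
have B0 : 0 <= B by apply: le_trans (fB 0 _); rewrite ?lexx.
have := @mvt_abs (fun t => f t - t * f1 0 - t * t / 2 * f2 0)
  (fun t => f1 t - f1 0 - t * f2 0) d (B * d ^+ 2) d0.
rewrite !mul0r !subr0 -expr2 -[B * _ * d]mulrA -exprSr.
rewrite (_ : f d - d * f1 0 - d ^+ 2 / 2 * f2 0 - f 0 =
  f d - f 0 - d * f1 0 - d ^+ 2 / 2 * f2 0); last by ring.
apply.
  move=> t t0; apply: (is_derive_add (is_derive_add (df t t0) (is_derive_opp
    (is_derive_mul (is_derive_id t 1) (is_derive_const _ _) erefl) erefl) erefl)
    (is_derive_opp (is_derive_mul (is_derive_mul (is_derive_mul (is_derive_id t 1)
      (is_derive_id t 1) erefl) (is_derive_const _ _) erefl) (is_derive_const _ _) erefl) erefl)).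
  by field.
move=> t /andP[t0 td]; apply: (@le_trans _ _ (B * t ^+ 2)); last first.
  by rewrite ler_wpM2l// lerXn2r ?nnegrE.
by apply: (@taylor2 f1 f2 f3) => // r /andP[r0 rt]; [apply: df1|apply: df2|apply: fB];
  rewrite r0 (le_trans rt).
Qed.

(** A negative [d] is handled along the ray [y + e * t], with [e] the sign of [d]. *)
Lemma taylor3_sym (f f1 f2 f3 : R -> R) (y d B : R) :
  (forall t : R, is_derive t 1 f (f1 t)) -> (forall t : R, is_derive t 1 f1 (f2 t)) ->
  (forall t : R, is_derive t 1 f2 (f3 t)) -> (forall t, `|f3 t| <= B) ->
  `|f (y + d) - (f y + d * f1 y + d ^+ 2 / 2 * f2 y)| <= B * `|d| ^+ 3.
Proof.
move=> df df1 df2 fB.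
have E (a b c e : R) : a - (b + c + e) = a - b - c - e by ring.
have shift (e : R) (g g1 : R -> R) (t : R) : (forall t : R, is_derive t 1 g (g1 t)) ->
    is_derive t 1 (fun t => g (y + e * t)) (e * g1 (y + e * t)).
  move=> dg; apply: (is_derive_chain (dg _) (is_derive_add (is_derive_const y t)
    (is_derive_lin e t) erefl)); ring.
have [e [e1 de]] : exists e, e ^+ 2 = 1 /\ d = e * `|d|.
  have [d0|d0] := leP 0 d.
    by exists 1; rewrite expr1n mul1r ger0_norm.
  by exists (-1); rewrite sqrrN expr1n ltr0_norm//; split=> //; ring.
have en : `|e| = 1.
  by apply/eqP; rewrite -(@eqrXn2 _ 2)// ?normr_ge0// real_normK ?num_real// e1 expr1n.
have := @taylor3 (fun t => f (y + e * t)) (fun t => e * f1 (y + e * t))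
  (fun t => e * (e * f2 (y + e * t))) (fun t => e * (e * (e * f3 (y + e * t)))) `|d| B
  (normr_ge0 d) (fun t _ => shift e f f1 t df).
rewrite !mulr0 !addr0 -de.
have d2 : `|d| ^+ 2 = d ^+ 2 by rewrite real_normK ?num_real.
have dd (x : R) : `|d| * (e * x) = d * x by rewrite {2}de; ring.
have d22 (x : R) : `|d| ^+ 2 / 2 * (e * (e * x)) = d ^+ 2 / 2 * x.
  by rewrite d2 (mulrA e) -expr2 e1 mul1r.
rewrite dd d22 E => H; apply: H.
by move=> t _; rewrite !normrM en !mul1r.
Qed.

End Taylor.

(** * The heat flow started from the normal distribution function *)

Section Heat.
Variables (R : realType) (a : R).

Let z (rho x : R) := (a - x) / rho.

Let is_derive_z (rho x : R) : is_derive x 1 (z rho) (- rho^-1).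
Proof.
apply: (is_derive_mul (is_derive_add (is_derive_const a x)
  (is_derive_opp (is_derive_id x 1) erefl) erefl) (is_derive_const _ _)).
by ring.
Qed.

(* As a function of [s = rho ^ 2] and [x], [heat] solves [u_s = u_xx / 2]. *)
Definition heat (rho x : R) : R := Phi ((a - x) / rho).
Definition heat_x (rho x : R) : R := - (phi (z rho x) / rho).
Definition heat_xx (rho x : R) : R := - (z rho x * phi (z rho x) / rho ^+ 2).
Definition heat_xxx (rho x : R) : R := (1 - z rho x ^+ 2) * phi (z rho x) / rho ^+ 3.

Lemma is_derive_heat (rho x : R) : is_derive x 1 (heat rho) (heat_x rho x).
Proof.
apply: (is_derive_chain (is_derive_Phi _) (is_derive_z rho x)).
by rewrite /heat_x mulrN.
Qed.

Lemma is_derive_heat_x (rho x : R) : rho != 0 ->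
  is_derive x 1 (heat_x rho) (heat_xx rho x).
Proof.
move=> r0; apply: (is_derive_opp (is_derive_mul
  (is_derive_chain (is_derive_phi _) (is_derive_z rho x) erefl) (is_derive_const _ _) erefl)).
by rewrite /heat_xx; field.
Qed.

Lemma is_derive_heat_xx (rho x : R) : rho != 0 ->
  is_derive x 1 (heat_xx rho) (heat_xxx rho x).
Proof.
move=> r0; apply: (is_derive_opp (is_derive_mul (is_derive_mul (is_derive_z rho x)
  (is_derive_chain (is_derive_phi _) (is_derive_z rho x) erefl) erefl)
  (is_derive_const _ _) erefl)).
by rewrite /heat_xxx; field.
Qed.

Lemma phi_abs_le (w : R) : `|w * phi w| <= 2.
Proof.
rewrite normrM (ger0_norm (phi_ge0 w)).
apply: (@le_trans _ _ ((1 + w ^+ 2) / 2 * phi w)).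
  rewrite ler_wpM2r ?phi_ge0//.
  have := sqr_ge0 (`|w| - 1); rewrite sqrrB real_normK ?num_real//; lra.
by have := phi_sqr_le w; have := phi_le1 w; lra.
Qed.

Lemma phi_cube_le (w : R) : `|w ^+ 3 * phi w| <= 9.
Proof.
rewrite normrM (ger0_norm (phi_ge0 w)).
apply: (@le_trans _ _ ((w ^+ 2 + w ^+ 4) / 2 * phi w)).
  rewrite ler_wpM2r ?phi_ge0// normrX -(real_normK (num_real w)).
  have -> : w ^+ 4 = `|w| ^+ 4 by rewrite -normrX ger0_norm// exprn_even_ge0.
  have -> : `|w| ^+ 3 = `|w| * `|w| ^+ 2 by rewrite -exprS.
  have -> : `|w| ^+ 4 = (`|w| ^+ 2) ^+ 2 by rewrite -exprM.
  have : 0 <= (`|w| ^+ 2 - `|w|) ^+ 2 by rewrite sqr_ge0.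
  lra.
have := phi_sqr_le w; have := phi_exp4_le w.
by rewrite mulrAC mulrDl; lra.
Qed.

Section Bounds.
Variable kappa : R.
Hypothesis kappa_itv : 0 < kappa <= 1.
(** One constant for all derivatives: each is at most 4 over a power of [rho] of degree at most 4,
    with [kappa <= rho] and [kappa <= 1]. *)
Let B : R := 4 / kappa ^+ 4.

Let k0 : 0 < kappa. Proof. by case/andP: kappa_itv. Qed.
Let k1 : kappa <= 1. Proof. by case/andP: kappa_itv. Qed.

Let bound_pow (c rho : R) n : 0 <= c <= 4 -> kappa <= rho -> (n <= 4)%N ->
  c / rho ^+ n <= B.
Proof.
move=> /andP[c0 c4] kr n4; rewrite /B.
apply: ler_pM => //; first by rewrite invr_ge0 exprn_ge0// (le_trans (ltW k0)).
rewrite lef_pV2 ?posrE ?exprn_gt0// ?(lt_le_trans k0)//.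
apply: (@le_trans _ _ (kappa ^+ n)); last first.
  by rewrite lerXn2r ?nnegrE ?(ltW k0)// (le_trans (ltW k0)).
by rewrite ler_wiXn2l// ltW.
Qed.

Lemma heat_xx_le (rho x : R) : kappa <= rho -> `|heat_xx rho x| <= B.
Proof.
move=> kr; have r0 : 0 < rho by exact: lt_le_trans kr.
rewrite /heat_xx normrN normrM normfV (ger0_norm (exprn_ge0 _ (ltW r0))).
apply: le_trans (@bound_pow 2 rho 2 _ kr isT); last by rewrite ler0n ler_nat.
by rewrite ler_wpM2r ?invr_ge0 ?exprn_ge0 ?(ltW r0)// phi_abs_le.
Qed.

Lemma heat_xxx_le (rho x : R) : kappa <= rho -> `|heat_xxx rho x| <= B.
Proof.
move=> kr; have r0 : 0 < rho by exact: lt_le_trans kr.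
rewrite /heat_xxx normrM normfV (ger0_norm (exprn_ge0 _ (ltW r0))).
apply: le_trans (@bound_pow 3 rho 3 _ kr isT); last by rewrite ler0n ler_nat.
rewrite ler_wpM2r ?invr_ge0 ?exprn_ge0 ?(ltW r0)//.
set w := z rho x; rewrite mulrBl mul1r (le_trans (ler_normB _ _))//.
rewrite (ger0_norm (phi_ge0 w)) (ger0_norm (mulr_ge0 (sqr_ge0 w) (phi_ge0 w))).
by have := phi_sqr_le w; have := phi_le1 w; lra.
Qed.

Let rho_of (t : R) := Num.sqrt (t + kappa ^+ 2).

(** The first-order term is [heat_xx / 2] by the heat equation; it will cancel the conditional
    variance of the martingale. *)
Lemma heat_time (x s v : R) : 0 <= s -> 0 <= v ->
  `|heat (rho_of (s + v)) x - heat (rho_of s) x - v * (heat_xx (rho_of s) x / 2)|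
    <= B * v ^+ 2.
Proof.
move=> s0 v0; have kk : 0 < kappa ^+ 2 by rewrite exprn_gt0.
pose r (t : R) : R := rho_of (s + t).
have p0 (t : R) : 0 <= t -> 0 < s + t + kappa ^+ 2 by move=> t0; rewrite ltr_wpDl// addr_ge0.
have r0 (t : R) : 0 <= t -> 0 < r t by move=> t0; rewrite sqrtr_gt0 p0.
have r2 (t : R) : 0 <= t -> r t ^+ 2 = s + t + kappa ^+ 2.
  by move=> t0; rewrite sqr_sqrtr// ltW// p0.
have kr (t : R) : 0 <= t -> kappa <= r t.
  move=> t0; rewrite -(@ler_pXn2r _ 2) ?nnegrE ?(ltW k0) ?(ltW (r0 t t0))// r2//; lra.
have dr (t : R) : 0 <= t -> is_derive t 1 r ((2 * r t)^-1).
  move=> t0; rewrite /r /rho_of.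
  apply: (is_derive_chain (f := Num.sqrt) (g := fun t => s + t + kappa ^+ 2) 
    (is_derive1_sqrt (p0 t t0)) (is_derive_add
    (is_derive_add (is_derive_const s t) (is_derive_id t 1) erefl)
    (is_derive_const _ _) erefl)).
  by rewrite add0r addr0 mulr1.
pose w (t : R) : R := (a - x) / r t.
have dw (t : R) : 0 <= t -> is_derive t 1 w (- w t / (2 * r t ^+ 2)).
  move=> t0; have rn := r0 t t0.
  apply: (is_derive_mul (is_derive_const (a - x) t) (is_derive_inv _ (dr t t0) erefl)).
    by rewrite gt_eqF.
  by rewrite /w; field; rewrite gt_eqF.
pose f1 (t : R) : R := - (w t * phi (w t)) / (2 * (r t * r t)).
(* The second time derivative; its numerator is at most [(2 + 9) / 4 + 2 / 2 <= 4]. *)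
pose f2 (t : R) : R := (w t * (1 - w t ^+ 2) * phi (w t) / 4 + w t * phi (w t) / 2) / r t ^+ 4.
have := @taylor2 R (fun t => Phi (w t)) f1 f2 v B v0.
rewrite /f1 /w /r !addr0 => H.
rewrite (_ : heat_xx _ x / 2 = - ((a - x) / rho_of s * phi ((a - x) / rho_of s)) /
  (2 * (rho_of s * rho_of s))).
  apply: H.
  - move=> t /andP[t0 _]; have rn := r0 t t0.
    apply: (is_derive_chain (is_derive_Phi _) (dw t t0)); rewrite -/(w t).
    by rewrite -/(r t); field; rewrite gt_eqF.
  - move=> t /andP[t0 _]; have rn := r0 t t0.
    apply: (is_derive_mul (is_derive_opp (is_derive_mul (dw t t0)
      (is_derive_chain (is_derive_phi _) (dw t t0) erefl) erefl) erefl)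
      (is_derive_inv _ (is_derive_mul (is_derive_const 2 t)
      (is_derive_mul (dr t t0) (dr t t0) erefl) erefl) erefl)).
      by rewrite !mulf_neq0 ?gt_eqF.
    by rewrite /f2 -/(r t); field; rewrite gt_eqF.
  - move=> t /andP[t0 _]; have rn := r0 t t0.
    rewrite /f2 normrM normfV (ger0_norm (exprn_ge0 4 (ltW rn))).
    apply: le_trans (@bound_pow 4 (r t) 4 _ (kr t t0) isT); last by rewrite ler0n ler_nat.
    rewrite ler_wpM2r ?invr_ge0 ?exprn_ge0 ?(ltW rn)//; set y := w t.
    have := phi_abs_le y; have := phi_cube_le y; rewrite !ler_norml.
    have -> : y * (1 - y ^+ 2) * phi y = y * phi y - y ^+ 3 * phi y by ring.
    move=> /andP[c1 c2] /andP[c3 c4]; apply/andP; split; lra.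
rewrite /heat_xx /z; field.
have : 0 < rho_of s by have := r0 0 (lexx 0); rewrite /r addr0.
by move=> h; rewrite gt_eqF.
Qed.

End Bounds.

End Heat.

(** * The heat flow along the process *)

Section HeatTelescope.
Variables (R : realType) (alpha : R).
Hypothesis alpha_le1 : `|alpha| <= 1.

Lemma ker_dist (F G : hist -> R) h e : (forall p, `|F (p :: h) - G (p :: h)| <= e) ->
  `|ker alpha F h - ker alpha G h| <= e.
Proof.
move=> FG; rewrite ler_distl; apply/andP; split.
  rewrite -(ker_cst alpha e h) -mulN1r -kerZ -kerD; apply: (ker_le alpha_le1) => p.
  by have := FG p; rewrite ler_distl => /andP[+ _]; lra.
rewrite -(ker_cst alpha e h) -kerD; apply: (ker_le alpha_le1) => p.
by have := FG p; rewrite ler_distl => /andP[_]; lra.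
Qed.

Lemma expect_walk2_sqr n b0 : expect alpha n (fun h => walk2 R h ^+ 2) [:: b0] = n.+1%:R.
Proof.
elim: n => [|n IH].
  rewrite /= walk2_cons /walk2 big_nil addr0.
  by rewrite -(real_normK (num_real _)) sgn_norm expr1n.
rewrite expectSr -[RHS]natr1 -IH -[X in _ + X](expect_cst alpha n 1 [:: b0]) -expectD.
apply: (expect_eq alpha_le1) => h _.
by rewrite /ker !walk2_cons /sgn /=; field.
Qed.

(** The second walk has variance equal to its length. Hence the [drift ^ 2] terms omitted from
    [qvar] add up to only a logarithm. *)
Lemma expect_drift_sqr n b0 :
  expect alpha n (fun h => drift alpha h ^+ 2) [:: b0] <= n.+1%:R^-1.
Proof.
rewrite (@expect_eq _ _ alpha_le1 _ _ (fun h => alpha ^+ 2 / n.+1%:R ^+ 2 * walk2 R h ^+ 2)).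
  rewrite expectZ expect_walk2_sqr.
  have n0 : 0 < n.+1%:R :> R by rewrite ltr0n.
  have a2 : alpha ^+ 2 <= 1.
    by rewrite -(real_normK (num_real alpha)) -(expr1n _ 2) lerXn2r ?nnegrE.
  rewrite (_ : _ / _ * _ = alpha ^+ 2 * n.+1%:R^-1); last by field; rewrite gt_eqF.
  by rewrite ler_piMl ?invr_ge0.
move=> h [sh _]; rewrite /drift sh addn1 !exprMn exprVn; ring.
Qed.

Lemma expect_telescope n (G : hist -> R) b0 (E F : R) : 0 <= F ->
  (forall h, (0 < size h <= n)%N -> `|ker alpha G h - G h| <= E + F * drift alpha h ^+ 2) ->
  `|expect alpha n G [:: b0] - G [:: b0]| <= n%:R * E + F * harm R 1 n.+1.
Proof.
move=> F0; elim: n => [|n IH] H.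
  by rewrite subrr normr0 mul0r harm_geq// mulr0 addr0.
have -> : expect alpha n.+1 G [:: b0] - G [:: b0] =
    expect alpha n (fun h => ker alpha G h - G h) [:: b0] +
    (expect alpha n G [:: b0] - G [:: b0]).
  by rewrite expectSr (expectB alpha_le1); ring.
apply: le_trans (ler_normD _ _) _.
apply: (@le_trans _ _ ((E + F * n.+1%:R^-1) + (n%:R * E + F * harm R 1 n.+1))); last first.
  by rewrite (@harm_recr _ 1 n.+1)// -[n.+1%:R]natr1 le_eqVlt; apply/orP; left;
    apply/eqP; ring.
apply: lerD; last first.
  by apply: IH => h /andP[h0 hn]; apply: H; rewrite h0 leqW.
apply: le_trans (expect_norm alpha_le1 _ _ _) _.
apply: (@le_trans _ _ (expect alpha n (fun h => E + F * drift alpha h ^+ 2) [:: b0])).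
  by apply: (expect_le alpha_le1) => h [sh _]; apply: H; rewrite sh /= addn1 leqnn.
by rewrite expectD expect_cst expectZ lerD2l ler_wpM2l// expect_drift_sqr.
Qed.

Section Horizon.
Variables (a kappa : R) (N : nat).
Hypothesis kappa_itv : 0 < kappa <= 1.
Hypothesis N_gt0 : (0 < N)%N.
Let c := walk_coef alpha 1 N.
Let B : R := 4 / kappa ^+ 4.

(** Dominates all martingale increments up to the horizon, since [2 + harm 1 N <= 3 + ln N]. *)
Definition log_factor : R := 3 + ln N%:R.
Local Notation lam := log_factor.

Definition norming : R := (Num.sqrt ((1 + 2 * alpha ^+ 2) * N%:R))^-1.
Local Notation theta := norming.

Let N0 : 0 < N%:R :> R. Proof. by rewrite ltr0n. Qed.

Let s1 : 1 <= 1 + 2 * alpha ^+ 2.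
Proof. by rewrite lerDl mulr_ge0 ?sqr_ge0. Qed.

Lemma norming_gt0 : 0 < theta.
Proof. by rewrite invr_gt0 sqrtr_gt0 mulr_gt0// (lt_le_trans ltr01). Qed.

Lemma norming_sqr : theta ^+ 2 * ((1 + 2 * alpha ^+ 2) * N%:R) = 1.
Proof.
have h : 0 < (1 + 2 * alpha ^+ 2) * N%:R by rewrite mulr_gt0// (lt_le_trans ltr01).
by rewrite exprVn sqr_sqrtr ?ltW// mulVf// gt_eqF.
Qed.

Lemma norming_sqr_le : theta ^+ 2 <= N%:R^-1.
Proof.
have h : theta ^+ 2 * N%:R <= theta ^+ 2 * ((1 + 2 * alpha ^+ 2) * N%:R).
  by rewrite ler_wpM2l ?sqr_ge0// ler_peMl// ltW.
by rewrite -[leRHS]mul1r ler_pdivlMr// (le_trans h) ?norming_sqr.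
Qed.

Lemma log_factor_ge3 : 3 <= lam.
Proof. by rewrite lerDl ln_ge0// ler1n. Qed.

Let c_le k : (0 < k)%N -> `|c k| <= lam - 2.
Proof.
move=> k0; rewrite /c /walk_coef mul1r normrM (ger0_norm (harm_ge0 _ _ _)).
apply: (@le_trans _ _ (harm R k N)); first by rewrite ler_piMl ?harm_ge0.
apply: le_trans (harm_anti _ _ k0) _; have := harm_ln R N_gt0.
by rewrite /log_factor; lra.
Qed.

(** Heat time is the variance still to come, plus [kappa ^ 2]. At the horizon only the smoothed
    indicator [Phi ((a - theta * walk1) / kappa)] is left. *)
Definition heat_mart (h : hist) : R :=
  heat a (Num.sqrt (theta ^+ 2 * qvar 1 c (size h) N + kappa ^+ 2)) (theta * mart 1 c h).

(** The space expansion and the time expansion share the term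
    [theta ^ 2 / 2 * (1 + d ^ 2) * heat_xx], which cancels; the remainders and the [drift ^ 2] term
    stay. *)
Lemma heat_mart_step h : (0 < size h < N)%N ->
  `|ker alpha heat_mart h - heat_mart h| <=
  B * ((theta * lam) ^+ 3 + (theta ^+ 2 * lam ^+ 2) ^+ 2) +
  B * theta ^+ 2 * drift alpha h ^+ 2.
Proof.
move=> hN; have [h0 hN'] := andP hN; have [k0 k1] := andP kappa_itv.
have cP : mart_coef alpha 1 c N by exact: walk_coefP.
have t0 := norming_gt0; have l3 := log_factor_ge3.
have B0 : 0 <= B by rewrite divr_ge0// exprn_ge0// ltW.
set k := size h; set d := c k.+1.
set s := theta ^+ 2 * qvar 1 c k.+1 N; set v := theta ^+ 2 * (1 + d ^+ 2).
have s0 : 0 <= s by rewrite mulr_ge0 ?sqr_ge0 ?qvar_ge0.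
have v0 : 0 <= v by rewrite mulr_ge0 ?addr_ge0 ?sqr_ge0.
have dl : `|d| <= lam - 2 by exact: c_le.
have d2 : d ^+ 2 <= (lam - 2) ^+ 2.
  by rewrite -(real_normK (num_real d)) lerXn2r ?nnegrE//; lra.
have vl : v <= theta ^+ 2 * lam ^+ 2.
  rewrite ler_wpM2l ?sqr_ge0//; move: d2; rewrite sqrrB; lra.
set rho := Num.sqrt (s + kappa ^+ 2); set y := theta * mart 1 c h.
have rk : kappa <= rho.
  by rewrite -[leLHS]ger0_norm ?(ltW k0)// -sqrtr_sqr ler_sqrt ?addr_ge0 ?sqr_ge0// lerDr.
have r0 : rho != 0 by rewrite gt_eqF// (lt_le_trans k0).
have Gh : heat_mart h = heat a (Num.sqrt (s + v + kappa ^+ 2)) y.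
  rewrite /heat_mart (_ : theta ^+ 2 * qvar 1 c (size h) N = s + v)//.
  by rewrite /qvar big_ltn// -/(qvar 1 c k.+1 N) expr1n /s /v -/d -/k; ring.
have Gp p : heat_mart (p :: h) = heat a rho (y + theta * incr alpha 1 d h p).
  by rewrite /heat_mart (mart_cons _ cP hN) mulrDr.
pose T p := heat a rho y + (theta * incr alpha 1 d h p) * heat_x a rho y +
   (theta * incr alpha 1 d h p) ^+ 2 / 2 * heat_xx a rho y.
pose TG h' := if h' is p :: _ then T p else 0.
have GT p : `|heat_mart (p :: h) - TG (p :: h)| <= B * (theta * lam) ^+ 3.
  rewrite Gp /TG /T.
  have := @taylor3_sym R (heat a rho) (heat_x a rho) (heat_xx a rho) (heat_xxx a rho)
    y (theta * incr alpha 1 d h p) B (fun t => is_derive_heat a rho t)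
    (fun t => is_derive_heat_x a t r0) (fun t => is_derive_heat_xx a t r0)
    (fun t => heat_xxx_le a kappa_itv t rk).
  move=> /le_trans; apply; rewrite ler_wpM2l//.
  rewrite lerXn2r ?nnegrE ?mulr_ge0 ?(ltW t0)//; first by lra.
  rewrite normrM gtr0_norm// ler_wpM2l ?(ltW t0)//.
  by apply: le_trans (incr_norm alpha_le1 _ _ _ _) _; rewrite normr1; lra.
have kT : ker alpha TG h = heat a rho y +
    theta ^+ 2 / 2 * heat_xx a rho y * (1 - drift alpha h ^+ 2 + d ^+ 2).
  rewrite (@ker_incr _ _ 1 d h TG (heat a rho y) (theta * heat_x a rho y)
    (theta ^+ 2 / 2 * heat_xx a rho y)); first by rewrite expr1n mul1r.
  by move=> p; rewrite /TG /T exprMn; ring.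
have := ker_dist GT; have := heat_time a kappa_itv y s0 v0.
rewrite -Gh -/rho kT /v.
have xx := heat_xx_le a kappa_itv y rk.
set f2 := heat_xx a rho y in xx *; set f := heat a rho y.
set G := heat_mart h; set KG := ker _ _ _; set m2 := drift _ _ ^+ 2.
have m20 : 0 <= m2 by exact: sqr_ge0.
rewrite -/v => HT HK.
have vv : B * v ^+ 2 <= B * (theta ^+ 2 * lam ^+ 2) ^+ 2.
  by rewrite ler_wpM2l// lerXn2r ?nnegrE// mulr_ge0 ?sqr_ge0.
have th2 : 0 <= theta ^+ 2 / 2 by apply: divr_ge0 => //; exact: sqr_ge0.
have thm := mulr_ge0 th2 m20.
have fm : `|theta ^+ 2 / 2 * m2 * f2| <= B * theta ^+ 2 * m2.
  rewrite normrM (ger0_norm thm); apply: (@le_trans _ _ (theta ^+ 2 / 2 * m2 * B)).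
    by rewrite ler_wpM2l.
  have : 0 <= theta ^+ 2 / 2 * m2 * B by rewrite mulr_ge0.
  by move: (theta ^+ 2) => q; lra.
rewrite mulrDr.
have -> : KG - G = (KG - (f + theta ^+ 2 / 2 * f2 * (1 - m2 + d ^+ 2)))
   - (G - f - theta ^+ 2 * (1 + d ^+ 2) * (f2 / 2)) - theta ^+ 2 / 2 * m2 * f2 by field.
apply: le_trans (ler_normB _ _) _; apply: lerD => //.
apply: le_trans (ler_normB _ _) _; apply: lerD => //.
exact: le_trans HT vv.
Qed.

Lemma expect_Phi_walk1 b0 :
  `|expect alpha N.-1 (fun h => Phi ((a - theta * walk1 R h) / kappa)) [:: b0] -
    Phi ((a - theta * mart 1 c [:: b0]) /
         Num.sqrt (theta ^+ 2 * qvar 1 c 1 N + kappa ^+ 2))|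
  <= 3 * B * (lam ^+ 4 / Num.sqrt N%:R).
Proof.
have [k0 k1] := andP kappa_itv.
have B0 : 0 <= B by rewrite divr_ge0// exprn_ge0// ltW.
have t0 := norming_gt0; have l3 := log_factor_ge3; have t2 := norming_sqr_le.
rewrite (@expect_eq _ _ alpha_le1 _ _ heat_mart); last first.
  move=> h [sh _]; have {}sh : size h = N by rewrite sh /= addn1 prednK.
  rewrite /heat_mart mart_walk_end// mul1r sh /qvar big_geq// mulr0 add0r sqrtr_sqr.
  by rewrite ger0_norm ?ltW.
have BF : 0 <= B * theta ^+ 2 by rewrite mulr_ge0 ?sqr_ge0.
have := @expect_telescope N.-1 heat_mart b0
  (B * ((theta * lam) ^+ 3 + (theta ^+ 2 * lam ^+ 2) ^+ 2)) (B * theta ^+ 2) BF.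
move=> H; apply: le_trans (H _) _.
  by move=> h /andP[h0 hN]; apply: heat_mart_step; rewrite h0; case: N N_gt0 hN.
rewrite prednK//; set S := Num.sqrt N%:R.
have S0 : 0 < S by rewrite sqrtr_gt0.
have S2 : S ^+ 2 = N%:R by rewrite sqr_sqrtr// ltW.
have S1 : 1 <= S by rewrite -sqrtr1 ler_sqrt ?ler1n// ltW.
have tS : theta <= S^-1.
  rewrite -(@ler_pXn2r _ 2) ?nnegrE ?invr_ge0 ?(ltW t0) ?(ltW S0)//.
  by rewrite [S^-1 ^+ 2]exprVn S2.
have l0 : 0 <= lam by lra.
have e1 : N%:R * (theta * lam) ^+ 3 <= lam ^+ 4 / S.
  apply: (@le_trans _ _ (S ^+ 2 * (S^-1 * lam) ^+ 3)).
    by rewrite S2 ler_wpM2l ?(ltW N0)// lerXn2r ?nnegrE ?mulr_ge0 ?invr_ge0 ?(ltW t0) ?(ltW S0)//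
      ler_wpM2r.
  have -> : S ^+ 2 * (S^-1 * lam) ^+ 3 = lam ^+ 3 / S by field; rewrite gt_eqF.
  by rewrite ler_wpM2r ?invr_ge0 ?(ltW S0)// [leRHS]exprS ler_peMl ?exprn_ge0//; lra.
have SS : lam ^+ 4 / S ^+ 2 <= lam ^+ 4 / S.
  rewrite ler_wpM2l ?exprn_ge0// lef_pV2 ?posrE ?exprn_gt0//.
  by rewrite expr2 ler_peMl// ltW.
have e2 : N%:R * (theta ^+ 2 * lam ^+ 2) ^+ 2 <= lam ^+ 4 / S.
  apply: le_trans SS; apply: (@le_trans _ _ (S ^+ 2 * ((S ^+ 2)^-1 * lam ^+ 2) ^+ 2)).
    rewrite S2 ler_wpM2l ?(ltW N0)// lerXn2r ?nnegrE ?mulr_ge0 ?invr_ge0 ?sqr_ge0 ?(ltW N0)//.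
    by rewrite ler_wpM2r ?sqr_ge0.
  by rewrite le_eqVlt; apply/orP; left; apply/eqP; field; rewrite gt_eqF.
have e3 : theta ^+ 2 * harm R 1 N <= lam ^+ 4 / S.
  apply: le_trans SS; rewrite S2 mulrC ler_pM ?harm_ge0 ?sqr_ge0//.
  apply: (@le_trans _ _ lam); first by have := harm_ln R N_gt0; rewrite /log_factor; lra.
  by rewrite exprS ler_peMr// exprn_ege1//; lra.
have n1 : N.-1%:R <= N%:R :> R by rewrite ler_nat leq_pred.
have X0 : 0 <= (theta * lam) ^+ 3 + (theta ^+ 2 * lam ^+ 2) ^+ 2.
  by rewrite addr_ge0 ?sqr_ge0// exprn_ge0// mulr_ge0// ltW.
have : N.-1%:R * (B * ((theta * lam) ^+ 3 + (theta ^+ 2 * lam ^+ 2) ^+ 2)) <=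
  B * (2 * (lam ^+ 4 / S)).
  rewrite mulrCA ler_wpM2l//.
  apply: (@le_trans _ _ (N%:R * ((theta * lam) ^+ 3 + (theta ^+ 2 * lam ^+ 2) ^+ 2))).
    by rewrite ler_wpM2r.
  by rewrite mulrDr; lra.
have : B * theta ^+ 2 * harm R 1 N <= B * (lam ^+ 4 / S) by rewrite -mulrA ler_wpM2l.
lra.
Qed.

End Horizon.

End HeatTelescope.

(** * Convergence of the distribution functions *)

Section CLT.
Variable R : realType.

Lemma Phi_ge0 (x : R) : 0 <= Phi x.
Proof. by rewrite -lee_fin PhiE. Qed.

Lemma Phi_le1 (x : R) : Phi x <= 1.
Proof. by rewrite -lee_fin PhiE; exact: (probability_le1 (normal_prob (0 : R) 1)). Qed.

Lemma Phi_dist (x y : R) : `|Phi x - Phi y| <= `|x - y|.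
Proof.
wlog xy : x y / x <= y.
  by move=> H; have [/H//|/ltW/H] := leP x y; rewrite distrC [leRHS]distrC.
rewrite distrC [leRHS]distrC !ger0_norm ?subr_ge0//; [exact: Phi_lip|exact: Phi_le].
Qed.

(** With [q] the sixteenth root of [N], [3 + ln N <= 19 q] and [sqrt N = q ^ 8], so the quotient is
    at most [19 ^ 4 / q ^ 4]. *)
Lemma log_factor_small (e : R) : 0 < e ->
  exists N0, forall N, (N0 <= N)%N -> (0 < N)%N /\
    log_factor R N ^+ 4 / Num.sqrt N%:R <= e.
Proof.
move=> e0; pose C := Num.max (19 ^+ 4 / e) 1; pose D := C ^+ 16.
exists (Num.bound `|D|).+1 => N NN.
have N0n : (0 < N)%N by exact: leq_trans NN.
have DN : D < N%:R.
  apply: (@lt_le_trans _ _ (Num.bound `|D|)%:R); last by rewrite ler_nat ltnW.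
  by apply: le_lt_trans (ler_norm _) (archi_boundP (normr_ge0 D)).
have N0 : 0 < N%:R :> R by rewrite ltr0n.
split=> //; set S := Num.sqrt N%:R.
have S0 : 0 < S by rewrite sqrtr_gt0.
set q := Num.sqrt (Num.sqrt (Num.sqrt S)).
have q0 : 0 < q by rewrite !sqrtr_gt0.
have qS : q ^+ 8 = S.
  by rewrite (exprM q 2 4) sqr_sqrtr ?sqrtr_ge0// (exprM _ 2 2) sqr_sqrtr ?sqrtr_ge0//
    sqr_sqrtr ?sqrtr_ge0.
have qN : q ^+ 16 = N%:R by rewrite (exprM q 8 2) qS sqr_sqrtr// ltW.
have : C < q.
  by rewrite -(@ltr_pXn2r _ 16) ?nnegrE ?qN ?(ltW q0)// le_max ler01 orbT.
rewrite gt_max => /andP[h1 h2].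
have lq : log_factor R N <= 19 * q.
  rewrite /log_factor -qN lnXn// -[ln q *+ 16]mulr_natl.
  have := ltW (ln_sublinear q0); lra.
have l0 : 0 <= log_factor R N by have := @log_factor_ge3 R N N0n; lra.
rewrite -qS ler_pdivrMr ?exprn_gt0//.
apply: (@le_trans _ _ ((19 * q) ^+ 4)); first by rewrite lerXn2r ?nnegrE ?mulr_ge0// ltW.
have -> : e * q ^+ 8 = (e * q ^+ 4) * q ^+ 4 by ring.
rewrite exprMn; apply: ler_wpM2r; first by rewrite exprn_ge0// ltW.
rewrite mulrC -ler_pdivrMr//; apply: (le_trans (ltW h1)).
rewrite exprS ler_peMr ?(ltW q0)// exprn_ege1// ltW//.
Qed.

Variable alpha : R.
Hypothesis alpha_le1 : `|alpha| <= 1.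

Section Horizon.
Variable N : nat.
Hypothesis N_gt0 : (0 < N)%N.
Let c := walk_coef alpha 1 N.
Local Notation lam := (log_factor R N).
Local Notation theta := (norming alpha N).
Let rate : R := lam ^+ 4 / Num.sqrt N%:R.

Let N0 : 0 < N%:R :> R. Proof. by rewrite ltr0n. Qed.

Let a2 : alpha ^+ 2 <= 1.
Proof. by rewrite -(real_normK (num_real alpha)) -(expr1n _ 2) lerXn2r ?nnegrE. Qed.

Lemma qvar_walkE :
  qvar 1 c 1 N = N.-1%:R + alpha ^+ 2 * (2 * N.-1%:R - harm R 1 N - harm R 1 N ^+ 2).
Proof.
rewrite /c -(prednK N_gt0) /=; move: N.-1 => n.
rewrite /qvar big_split/= sumr_const_nat subn1 /= expr1n; congr (_ + _).
have -> : 2 * n%:R - harm R 1 n.+1 - harm R 1 n.+1 ^+ 2 =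
    \sum_(1 <= k < n.+1) harm R k.+1 n.+1 ^+ 2.
  have := @telescope_sumr R 1 n.+1 (fun k => harm R k n.+1 ^+ 2) isT.
  rewrite big_split/= sumrN sum_sqr_harm (@harm_geq _ n.+1)//; lra.
rewrite mulr_sumr; apply: eq_bigr => k _; rewrite /walk_coef; ring.
Qed.

Let lam_ge3 : 3 <= lam. Proof. exact: log_factor_ge3. Qed.

Let rate_ge (u : R) : 0 <= u -> u <= lam ^+ 2 -> u / N%:R <= rate.
Proof.
move=> u0 ul; rewrite /rate; apply: ler_pM => //.
  apply: le_trans ul _; rewrite (exprD _ 2 2) ler_peMl ?sqr_ge0// exprn_ege1//.
  by apply: le_trans lam_ge3; rewrite ler1n.
rewrite lef_pV2 ?posrE ?sqrtr_gt0// -[leRHS](sqr_sqrtr (ltW N0)) expr2 ler_peMl ?sqrtr_ge0//.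
by rewrite -[leLHS]sqrtr1 ler_sqrt ?ler1n// ltW.
Qed.

Lemma var_close : 1 - rate <= theta ^+ 2 * qvar 1 c 1 N <= 1.
Proof.
have nz := norming_sqr alpha N_gt0; have nl := norming_sqr_le alpha N_gt0.
apply/andP; split; last first.
  rewrite -[leRHS]nz ler_wpM2l ?sqr_ge0//.
  by apply: le_trans (qvar_walk _ _ _) _; rewrite expr1n mul1r.
have h0 := harm_ge0 R 1 N; have hl := harm_ln R N_gt0.
set h := harm R 1 N in h0 hl; set u := 1 + alpha ^+ 2 * (2 + h + h ^+ 2).
have E : theta ^+ 2 * qvar 1 c 1 N = 1 - theta ^+ 2 * u.
  rewrite -[X in _ = X - _]nz -mulrBr; congr (_ * _); rewrite qvar_walkE -/h /u.
  have -> : N%:R = N.-1%:R + 1 :> R by rewrite natr1 prednK.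
  by ring.
have h2 : 0 <= 2 + h + h ^+ 2 by rewrite !addr_ge0// sqr_ge0.
have u0 : 0 <= u by rewrite addr_ge0// mulr_ge0// sqr_ge0.
rewrite E lerD2l lerN2; apply: (@le_trans _ _ (u / N%:R)).
  by rewrite mulrC ler_wpM2l.
apply: rate_ge => //.
apply: (@le_trans _ _ (3 + h + h ^+ 2)).
  have : alpha ^+ 2 * (2 + h + h ^+ 2) <= 2 + h + h ^+ 2 by rewrite ler_piMl.
  by rewrite /u; lra.
have h3 : h <= lam - 2 by rewrite /log_factor; lra.
have : h ^+ 2 <= (lam - 2) ^+ 2 by rewrite lerXn2r ?nnegrE//; move: lam_ge3; lra.
by move: lam_ge3; rewrite sqrrB; lra.
Qed.

Lemma start_close b0 : `|theta * mart 1 c [:: b0]| <= rate.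
Proof.
have t0 := norming_gt0 alpha N_gt0; have nl := norming_sqr_le alpha N_gt0.
have hl := harm_ln R N_gt0.
have ml : `|mart 1 c [:: b0]| <= lam.
  rewrite /mart walk1_cons walk2_cons /walk1 /walk2 !big_nil !addr0 mul1r /=.
  apply: le_trans (ler_normD _ _) _; rewrite normrM !sgn_norm mulr1.
  rewrite /c /walk_coef mul1r normrM (ger0_norm (harm_ge0 _ _ _)).
  have : `|alpha| * harm R 1 N <= harm R 1 N by rewrite ler_piMl ?harm_ge0.
  by rewrite /log_factor; lra.
have tS : theta <= (Num.sqrt N%:R)^-1.
  rewrite -(@ler_pXn2r _ 2) ?nnegrE ?invr_ge0 ?sqrtr_ge0 ?(ltW t0)//.
  by rewrite [(Num.sqrt N%:R)^-1 ^+ 2]exprVn sqr_sqrtr// ltW.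
rewrite normrM gtr0_norm// mulrC /rate ler_pM ?(ltW t0)//.
apply: le_trans ml _; rewrite exprS ler_peMr ?exprn_ege1//; move: lam_ge3; lra.
Qed.

End Horizon.

Lemma clt_target (x e y S t : R) : 0 < e <= 1 -> t <= e -> t <= 2^-1 -> 0 <= S ->
  `|y| <= t -> 1 - t <= S ^+ 2 <= 1 + e -> forall a, `|a - x| <= e ->
  `|Phi ((a - y) / S) - Phi x| <= 4 * (1 + `|x|) * e.
Proof.
move=> /andP[e0 e1] te t2 S0 yt /andP[S1 S2] a ax.
apply: le_trans (Phi_dist _ _) _.
have hS : 2^-1 <= S.
  rewrite -(@ler_pXn2r _ 2) ?nnegrE// (_ : 2^-1 ^+ 2 = 4^-1); last by field.
  lra.
have SS : `|1 - S| <= e.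
  have : `|1 - S| <= `|1 - S| * (1 + S) by rewrite ler_peMr// lerDl.
  rewrite -[X in _ * X]ger0_norm ?addr_ge0// -normrM => /le_trans; apply.
  rewrite (_ : (1 - S) * (1 + S) = 1 - S ^+ 2); last by ring.
  by rewrite ler_norml; apply/andP; split; lra.
have Sp : 0 < S by lra.
rewrite (_ : (a - y) / S - x = ((a - x) - y + x * (1 - S)) / S); last first.
  by field; rewrite gt_eqF.
rewrite normrM normfV (gtr0_norm Sp) ler_pdivrMr//.
apply: (@le_trans _ _ (2 * (1 + `|x|) * e)); last first.
  have : 0 <= (1 + `|x|) * e by rewrite mulr_ge0 ?addr_ge0 ?(ltW e0).
  by move=> h; have := ler_wpM2l h hS; lra.
apply: le_trans (ler_normD _ _) _; rewrite normrM.
have h1 := ler_normB (a - x) y.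
have h2 : `|x| * `|1 - S| <= `|x| * e by rewrite ler_wpM2l.
have : 0 <= `|x| * e by rewrite mulr_ge0// ltW.
by lra.
Qed.

(** As [e / kappa = M], the indicator of [y <= x] lies between
    [Phi ((x - e - y) / kappa) - Phi (- M)] and [Phi ((x + e - y) / kappa) + 1 - Phi M]. The tails
    cost [e], the heat estimate [e], and [clt_target] the remaining [4 (1 + |x|) e]. *)
Lemma clt_kernel b0 (x e : R) : 0 < e <= 1 ->
  exists N0, forall N, (N0 <= N)%N ->
    `|expect alpha N.-1 (fun h => (norming alpha N * walk1 R h <= x)%R%:R) [:: b0] - Phi x|
      <= (6 + 4 * `|x|) * e.
Proof.
move=> /andP[e0 e1]; have [M M1 [PM1 PM2]] := Phi_tails e0.
have M0 : 0 < M by lra.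
pose kappa := e / M.
have k0 : 0 < kappa by rewrite divr_gt0.
have ke : kappa <= e by rewrite ler_pdivrMr// ler_peMr// ltW.
have k1 : 0 < kappa <= 1 by rewrite k0 (le_trans ke).
pose B : R := 4 / kappa ^+ 4.
have B0 : 0 < B by rewrite divr_gt0// exprn_gt0.
pose t := Num.min (Num.min e 2^-1) (e / (3 * B)).
have t0 : 0 < t by rewrite !lt_min e0 invr_gt0 ltr0n divr_gt0// mulr_gt0.
have [N0 HN] := log_factor_small t0.
exists N0 => N /HN[N_gt0]; set rate := _ / _ => rt.
have [te t2 tB] : [/\ rate <= e, rate <= 2^-1 & 3 * B * rate <= e].
  move: rt; rewrite /t !le_min => /andP[/andP[-> ->] h]; split=> //.
  by rewrite mulrC -ler_pdivlMr// mulr_gt0.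
have kk : kappa / kappa = 1 by rewrite divff// gt_eqF.
have kM : e / kappa = M by rewrite /kappa invf_div mulrC divfK// gt_eqF.
set y0 := norming alpha N * mart 1 (walk_coef alpha 1 N) [:: b0].
set S := Num.sqrt (norming alpha N ^+ 2 * qvar 1 (walk_coef alpha 1 N) 1 N + kappa ^+ 2).
have /andP[v1 v2] := var_close N_gt0; rewrite -/rate in v1.
have yr : `|y0| <= rate by exact: start_close.
have k2 : kappa ^+ 2 <= e.
  by rewrite expr2 -[leRHS]mulr1 ler_pM ?(ltW k0)//; case/andP: k1.
have k20 : 0 <= kappa ^+ 2 by exact: sqr_ge0.
have S2 : S ^+ 2 = norming alpha N ^+ 2 * qvar 1 (walk_coef alpha 1 N) 1 N + kappa ^+ 2.
  by rewrite sqr_sqrtr// addr_ge0// mulr_ge0 ?sqr_ge0 ?qvar_ge0.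
have Sb : 1 - rate <= S ^+ 2 <= 1 + e by rewrite S2; apply/andP; split; lra.
have ee : 0 < e <= 1 by rewrite e0.
have T a : `|a - x| <= e -> `|Phi ((a - y0) / S) - Phi x| <= 4 * (1 + `|x|) * e.
  by apply: clt_target yr Sb a => //; exact: sqrtr_ge0.
have K a := expect_Phi_walk1 alpha_le1 a k1 N_gt0 b0.
rewrite ler_distl; apply/andP; split.
  have xe : `|(x - e) - x| <= e by rewrite addrAC subrr sub0r normrN gtr0_norm.
  have := T _ xe; have := K (x - e); rewrite -/y0 -/S -/B -/rate.
  rewrite !ler_distl => /andP[K1 _] /andP[T1 _].
  have : expect alpha N.-1 (fun h => Phi ((x - e - norming alpha N * walk1 R h) / kappa)
       - Phi (- M)) [:: b0] <=
      expect alpha N.-1 (fun h => (norming alpha N * walk1 R h <= x)%R%:R) [:: b0].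
    apply: (expect_le alpha_le1) => h _; case: (leP _ x) => hx /=.
      by have := Phi_le1 ((x - e - norming alpha N * walk1 R h) / kappa);
        have := Phi_ge0 (- M); lra.
    rewrite subr_le0; apply: Phi_le; rewrite -kM -[- (e / kappa)]mulNr.
    rewrite ler_wpM2r ?invr_ge0 ?(ltW k0)//.
    by lra.
  rewrite (expectB alpha_le1) expect_cst; lra.
have xe : `|(x + e) - x| <= e by rewrite addrAC subrr add0r gtr0_norm.
have := T _ xe; have := K (x + e); rewrite -/y0 -/S -/B -/rate.
rewrite !ler_distl => /andP[_ K1] /andP[_ T1].
have : expect alpha N.-1 (fun h => (norming alpha N * walk1 R h <= x)%R%:R) [:: b0] <=
   expect alpha N.-1 (fun h => Phi ((x + e - norming alpha N * walk1 R h) / kappa)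
     + (1 - Phi M)) [:: b0].
  apply: (expect_le alpha_le1) => h _; case: (leP _ x) => hx /=.
    have : Phi M <= Phi ((x + e - norming alpha N * walk1 R h) / kappa).
      apply: Phi_le; rewrite -kM ler_wpM2r ?invr_ge0 ?(ltW k0)//; lra.
    lra.
  by rewrite addr_ge0 ?Phi_ge0// subr_ge0 Phi_le1.
rewrite expectD expect_cst; lra.
Qed.

End CLT.

(** * Almost sure statements for the model *)

Section LimSup.
Variable R : realType.
Implicit Type u : nat -> \bar R.

Lemma limn_esup_le u (k : \bar R) N : (forall n, (N <= n)%N -> (u n <= k)%E) ->
  (limn_esup u <= k)%E.
Proof.
move=> uk; rewrite limn_esup_lim; apply: lime_le; first exact: is_cvg_esups.
exists N => // n /= Nn; apply: ge_ereal_sup => _ [m /= nm <-]; apply: uk.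
exact: leq_trans nm.
Qed.

Lemma limn_esup_ge u (k : \bar R) : (forall N, exists2 n, (N <= n)%N & (k <= u n)%E) ->
  (k <= limn_esup u)%E.
Proof.
move=> uk; rewrite limn_esup_lim; apply: lime_ge; first exact: is_cvg_esups.
apply: nearW => n; have [m nm km] := uk n.
by apply: le_trans km _; apply: ereal_sup_ubound; exists m.
Qed.

End LimSup.

Section DiscreteMeasurability.
Context d (T : measurableType d).

(** For countable types measurable fibres suffice, so lists need no sigma-algebra. *)
Definition discretely_measurable (A : Type) (f : T -> A) :=
  forall a, measurable [set w | f w = a].

Lemma discretely_measurable_event (A : countType) (f : T -> A) (Q : set A) :
  discretely_measurable f -> measurable [set w | Q (f w)].
Proof.
move=> mf; pose G n := if @unpickle A n is Some a then [set w | f w = a /\ Q a] else set0.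
rewrite (_ : [set _ | _] = \bigcup_n G n).
  apply: bigcup_measurable => n _; rewrite /G; case: unpickle => [a|]; last exact: measurable0.
  have [Qa|Qa] := pselect (Q a).
    by rewrite (_ : [set _ | _] = [set w | f w = a])//; apply/seteqP; split => // w [].
  by rewrite (_ : [set _ | _] = set0)//; apply/seteqP; split => // w [].
apply/seteqP; split => [w Qw|w [n _]].
  by exists (pickle (f w)) => //; rewrite /G pickleK.
by rewrite /G; case: unpickle => // a [/= ->].
Qed.

Lemma discretely_measurable_comp (A : countType) (B : Type) (f : T -> A) (F : A -> B) :
  discretely_measurable f -> discretely_measurable (F \o f).
Proof. by move=> mf b; exact: (discretely_measurable_event (fun a => F a = b) mf). Qed.

Lemma discretely_measurable_pair (A B : Type) (f : T -> A) (g : T -> B) :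
  discretely_measurable f -> discretely_measurable g ->
  discretely_measurable (fun w => (f w, g w)).
Proof.
move=> mf mg [a b]; rewrite (_ : [set _ | _] = [set w | f w = a] `&` [set w | g w = b]).
  exact: measurableI.
by apply/seteqP; split => w /=; [move=> [-> ->]|move=> [-> ->]].
Qed.

End DiscreteMeasurability.

(** At the first time from [m] on when the path is at least [z], a step of size at most 1 cannot
    have passed over [z]. *)
Lemma discrete_ivt (s : nat -> int) (z : int) m n : (m <= n)%N ->
  (forall k, `|s k.+1 - s k| <= 1) -> s m <= z -> z <= s n ->
  exists2 k, (m <= k)%N & s k = z.
Proof.
move=> mn s1 sm sn.
have ex : exists k, (m <= k)%N && (z <= s k) by exists n; rewrite mn.
have [k /andP[mk zk] kmin] := ex_minnP ex; exists k => //.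
move: mk; rewrite leq_eqVlt => /predU1P[mk|mk].
  by apply/eqP; rewrite eq_le zk -mk sm.
case: k mk zk kmin => // k mk zk kmin.
have sk : s k < z.
  by rewrite ltNge; apply/negP => zk'; have := kmin k; rewrite -ltnS mk zk' ltnn => /(_ isT).
have := s1 k; rewrite ler_norml => /andP[_ h]; apply/eqP; rewrite eq_le zk andbT.
lia.
Qed.

Section Assembly.
Context d (T : measurableType d) (R : realType) (P : probability T R).
Variables (p1 : R) (xi1 xi2 : nat -> T -> bool) (u1 u2 : nat -> T -> nat).
Hypothesis model : two_elephant_model P p1 (2^-1) xi1 xi2 u1 u2.
Hypothesis p1_itv : 0 <= p1 <= 1.
Variables (x1 x2 : int).
Let alpha := 2 * p1 - 1.
Let S1 := ew_S1 x1 x2 xi1 xi2 u1 u2.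

(** [ew_S1] agrees with the boolean walk only off a null set, so measurability of its events does
    not carry over from [bhist]. *)
Lemma measurable_ew_hist n :
  discretely_measurable (fun w => ew_hist x1 x2 xi1 xi2 u1 u2 w n).
Proof.
have mx1 k : (2 <= k)%N -> discretely_measurable (xi1 k).
  move=> k2 e; rewrite (_ : [set _ | _] = [set w | nat_of_bool (xi1 k w) = e]).
    exact: (measurable_value model (fun y => y = nat_of_bool e) (i := IXi1 k)).
  by apply/seteqP; split => w /=; [move=> ->|case: (xi1 k w); case: e].
have mx2 k : (2 <= k)%N -> discretely_measurable (xi2 k).
  move=> k2 e; rewrite (_ : [set _ | _] = [set w | nat_of_bool (xi2 k w) = e]).
    exact: (measurable_value model (fun y => y = nat_of_bool e) (i := IXi2 k)).
  by apply/seteqP; split => w /=; [move=> ->|case: (xi2 k w); case: e].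
have mu1 k : (1 <= k)%N -> discretely_measurable (u1 k).
  by move=> k1 v; exact: (measurable_value model (fun y => y = v) (i := IU1 k)).
have mu2 k : (1 <= k)%N -> discretely_measurable (u2 k).
  by move=> k1 v; exact: (measurable_value model (fun y => y = v) (i := IU2 k)).
elim: n => [|[|n] IH].
- exact: (discretely_measurable_comp (fun=> [::]) (mu1 1 isT)).
- exact: (discretely_measurable_comp (fun=> [:: (x1, x2)]) (mu1 1 isT)).
pose F (t : seq (int * int) * ((bool * bool) * (nat * nat))) :=
  let: (h, ((e1, e2), (k1, k2))) := t in
  rcons h ((if e1 then 1 else -1) * (nth (0, 0) h k2.-1).2,
           (if e2 then 1 else -1) * (nth (0, 0) h k1.-1).1).
apply: (discretely_measurable_comp F (discretely_measurable_pair IH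
  (discretely_measurable_pair (discretely_measurable_pair (mx1 n.+2 isT) (mx2 n.+2 isT))
    (discretely_measurable_pair (mu1 n.+1 isT) (mu2 n.+1 isT))))).
Qed.

Hypothesis x1_pm : x1 = 1 \/ x1 = -1.
Hypothesis x2_pm : x2 = 1 \/ x2 = -1.
Let b0 := (x1 == 1, x2 == 1).
Let bh := bhist b0 xi1 xi2 u1 u2.
Let int_walk (h : hist) : int := \sum_(p <- h) int_step p.1.

Let int_walkE h : (int_walk h)%:~R = walk1 R h.
Proof.
rewrite /int_walk /walk1 rmorph_sum; apply: eq_bigr => p _ /=.
by rewrite /int_step /sgn; case: p.1; rewrite ?rmorphN rmorph1.
Qed.

Lemma ew_S1_ae : {ae P, forall w n, S1 n w = int_walk (bh w n)}.
Proof.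
apply: filterS (u_range_ae model) => w uw n.
have e1 : x1 = int_step b0.1 by rewrite /b0 /=; case: x1_pm => ->.
have e2 : x2 = int_step b0.2 by rewrite /b0 /=; case: x2_pm => ->.
rewrite /S1 /ew_S1 {1}e1 {1}e2 (ew_hist_bhist b0 xi1 xi2)//.
by rewrite (perm_big _ (permEl (perm_rev _))) /= big_map.
Qed.

(** For [n >= 16], [ln (ln n) >= ln 2 >= 1 / 2], so [lil n >= sqrt n]. *)
Lemma lil_unbounded (A : R) : exists n0, forall n, (n0 <= n)%N -> 0 < lil R n /\ A <= lil R n.
Proof.
exists (Num.bound (A ^+ 2) + 16)%N => n nn.
have n16 : (16 <= n)%N by apply: leq_trans nn; rewrite leq_addl.
have n0 : 0 < n%:R :> R by rewrite ltr0n; exact: leq_trans n16.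
have l2 := ln2_ge R.
have ln16 : 2 <= ln n%:R :> R.
  apply: (@le_trans _ _ (ln (2 ^+ 4))); first by rewrite lnXn// -[ln 2 *+ 4]mulr_natl; lra.
  by rewrite ler_ln ?posrE ?exprn_gt0// -natrX ler_nat.
have lln : 2^-1 <= ln (ln n%:R) :> R.
  by apply: le_trans l2 _; rewrite ler_ln ?posrE//; lra.
have An : A ^+ 2 <= n%:R.
  apply: ltW; apply: lt_le_trans (archi_boundP (sqr_ge0 A)) _.
  by rewrite ler_nat; apply: leq_trans nn; rewrite leq_addr.
have nl : n%:R <= 2 * n%:R * ln (ln n%:R) :> R.
  have := ler_wpM2l (ltW n0) lln; lra.
have l0 : Num.sqrt n%:R <= lil R n by rewrite /lil ler_sqrt// (le_trans (ltW n0)).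
split; first by apply: lt_le_trans l0; rewrite sqrtr_gt0.
apply: le_trans l0; apply: le_trans (ler_norm A) _.
by rewrite -sqrtr_sqr ler_sqrt// ltW.
Qed.

Let negp (p : bool * bool) := (~~ p.1, ~~ p.2).

Let nth_negp h i : nth (negp b0) (map negp h) i = negp (nth b0 h i).
Proof.
have [ih|hi] := ltnP i (size h); first by rewrite (nth_map b0).
by rewrite !nth_default ?size_map.
Qed.

Let bhist_negp w n : bhist (negp b0) xi1 xi2 u1 u2 w n = map negp (bh w n).
Proof.
elim: n => [//|[//|n] IH]; rewrite /bh !bhistS IH /= !nth_negp /negp /=.
by congr ((_, _) :: _); [case: (xi1 _ _)|case: (xi2 _ _)] => /=; case: (nth _ _ _) => [[] []].
Qed.

Let walk1_negp h : walk1 R (map negp h) = - walk1 R h.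
Proof.
rewrite /walk1 big_map -sumrN; apply: eq_bigr => p _.
by rewrite /negp /sgn /=; case: p.1; rewrite ?opprK.
Qed.

Let int_walk_step w k : `|int_walk (bh w k.+1) - int_walk (bh w k)| <= 1.
Proof.
have step p : `|int_step p| <= 1 by case: p.
case: k => [|k].
  by rewrite /int_walk /= big_cons !big_nil addr0 subr0.
by rewrite /bh bhistS /int_walk big_cons addrK.
Qed.

(* Negating the initial steps negates the walk, so that [walk1_lil_io] also bounds the
   walk from above infinitely often. *)
Lemma recurrence_ae : {ae P, forall w, forall (z : int) N, exists2 n, (N <= n)%N & S1 n w = z}.
Proof.
apply: filterS3 ew_S1_ae (walk1_lil_io model p1_itv b0)
  (walk1_lil_io model p1_itv (negp b0)) => w S1E up dn z N.
have [n0 Hn0] := lil_unbounded (4000 * `|z%:~R : R|).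
have [m mN Hm] := dn (maxn n0 N).
have [n nm Hn] := up (maxn n0 m).
rewrite bhist_negp walk1_negp in Hm.
have [_ lm] := Hn0 m (leq_trans (leq_maxl _ _) mN).
have [_ ln_] := Hn0 n (leq_trans (leq_maxl _ _) nm).
have sm : int_walk (bh w m) <= z.
  rewrite -(ler_int R) int_walkE; have := ler_norm (- (z%:~R : R)); rewrite normrN; lra.
have sn : z <= int_walk (bh w n).
  rewrite -(ler_int R) int_walkE; have := ler_norm (z%:~R : R); lra.
have [k mk kz] := @discrete_ivt (fun n => int_walk (bh w n)) z m n
  (leq_trans (leq_maxr _ _) nm) (int_walk_step w) sm sn.
exists k; last by rewrite S1E.
by apply: leq_trans mk; apply: leq_trans mN; rewrite leq_maxr.
Qed.

Lemma limsup_ae : {ae P, forall w,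
  (((4000^-1 : R)%:E <= limn_esup (fun n => ((S1 n w)%:~R / lil R n)%:E))%E /\
  (limn_esup (fun n => ((S1 n w)%:~R / lil R n)%:E)
     <= (1 + Num.sqrt 2 * `|alpha|)%:E)%E)}.
Proof.
pose B : R := 1 + Num.sqrt 2 * `|alpha|.
have sB : Num.sqrt (1 + 2 * alpha ^+ 2) <= B.
  have a0 : 0 <= `|alpha| by [].
  have r0 : 0 <= Num.sqrt 2 :> R by exact: sqrtr_ge0.
  have B0 : 0 <= B by rewrite /B addr_ge0// mulr_ge0.
  rewrite -[leRHS]ger0_norm// -sqrtr_sqr ler_sqrt ?sqr_ge0// (_ : B ^+ 2 =
    1 + 2 * (Num.sqrt 2 * `|alpha|) + Num.sqrt 2 ^+ 2 * `|alpha| ^+ 2); last by rewrite /B; ring.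
  rewrite sqr_sqrtr// real_normK ?num_real//.
  have : 0 <= Num.sqrt 2 * `|alpha| :> R by rewrite mulr_ge0.
  lra.
(* Countably many constants above [B] keep a single null set; large [k] then gives [B] itself. *)
have upper : {ae P, forall w k, exists n0, forall n, (n0 <= n)%N ->
    1 * walk1 R (bh w n) <= (B + k.+1%:R^-1) * lil R n}.
  apply/ae_foralln => k; apply: (walk1_lil model p1_itv); first by rewrite normr1.
  by apply: le_lt_trans sB _; rewrite ltrDl invr_gt0 ltr0n.
apply: filterS3 ew_S1_ae (walk1_lil_io model p1_itv b0) upper => w S1E low up; split.
  apply: limn_esup_ge => N.
  have [n0 Hn0] := lil_unbounded 0.
  have [n nN Hn] := low (maxn n0 N); exists n; first exact: leq_trans (leq_maxr _ _) nN.
  have [l0 _] := Hn0 n (leq_trans (leq_maxl _ _) nN).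
  by rewrite lee_fin S1E int_walkE (ler_pdivlMr _ _ l0); lra.
apply/lee_addgt0Pr => e e0.
pose k := Num.bound e^-1.
have ke : k.+1%:R^-1 <= e.
  rewrite -[leRHS]invrK lef_pV2 ?posrE ?invr_gt0 ?ltr0n//; apply: ltW.
  have e0' : 0 <= e^-1 by rewrite invr_ge0 ltW.
  by apply: lt_le_trans (archi_boundP e0') _; rewrite ler_nat.
have [n0 Hn0] := up k.
apply: (@limn_esup_le _ _ _ n0) => n nn; rewrite -EFinD lee_fin S1E int_walkE.
have := Hn0 n nn; rewrite mul1r => h.
have [l0|l0] := ltP 0 (lil R n).
  rewrite ler_pdivrMr//; apply: le_trans h _; rewrite ler_wpM2r ?lil_ge0//.
  by rewrite /B lerD2l.
(* Where [lil R n] vanishes the quotient is 0, by the convention [0^-1 = 0]. *)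
have -> : lil R n = 0 by apply/eqP; rewrite eq_le l0 lil_ge0.
by rewrite invr0 mulr0 !addr_ge0 ?mulr_ge0 ?sqrtr_ge0// ltW.
Qed.

Lemma cvg_standard_normal : cvg_in_distribution P
  (fun n w => (S1 n w)%:~R / Num.sqrt ((1 + 2 * alpha ^+ 2) * n%:R)) (normal_prob 0 1).
Proof.
move=> x _; rewrite -PhiE.
pose A n := [set w | (S1 n w)%:~R / Num.sqrt ((1 + 2 * alpha ^+ 2) * n%:R) <= x :> R].
pose p n : R := expect alpha n.-1 (fun h => (norming alpha n * walk1 R h <= x)%R%:R) [:: b0].
have alpha_le1 : `|alpha| <= 1.
  by case/andP: p1_itv => ? ?; rewrite ler_norml /alpha; lra.
have PA n : (0 < n)%N -> P (A n) = (p n)%:E.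
  move=> n0; pose B (h : hist) := (norming alpha n * walk1 R h <= x)%R.
  rewrite /p -(probability_bhist model p1_itv b0 n.-1 B) prednK// -/bh.
  have mA : measurable (A n).
    exact: (discretely_measurable_event (fun h : seq (int * int) =>
      (\sum_(q <- h) q.1)%:~R / Num.sqrt ((1 + 2 * alpha ^+ 2) * n%:R) <= x :> R)
      (measurable_ew_hist n)).
  have mB : measurable [set w | B (bh w n)].
    by rewrite -(prednK n0); exact: (measurable_bhist_event model b0 n.-1 B).
  have [Z [mZ PZ HZ]] := ew_S1_ae.
  have AB w : ~ Z w -> A n w <-> B (bh w n).
    move=> nZ; have E : S1 n w = int_walk (bh w n).
      by apply: contrapT => ne; apply: nZ; apply: HZ => /= /(_ n).
    by rewrite /A /B /= E int_walkE mulrC.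
  have PD C : measurable C -> P C = P (C `\` Z).
    move=> mC; transitivity (P (C `\` Z) + P (C `&` Z))%E; first exact: measureDI.
    rewrite (_ : P (C `&` Z) = 0%E) ?adde0//.
    apply: (@subset_measure0 _ _ _ P _ Z) => //; first exact: measurableI.
  rewrite PD// [RHS]PD//; congr (P _); apply/seteqP; split => w [Cw nZ]; split=> //.
    by apply/(AB w nZ).
  by apply/(AB w nZ).
have pc : p @ \oo --> Phi x.
  apply/cvgrPdist_le => e e0.
  have c0 : 0 < 6 + 4 * `|x| by rewrite ltr_pwDl// mulr_ge0.
  pose e' := Num.min 1 (e / (6 + 4 * `|x|)).
  have e'0 : 0 < e' <= 1 by rewrite lt_min ltr01 divr_gt0//= ge_min lexx.
  have [N0 HN] := clt_kernel alpha_le1 b0 x e'0.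
  exists N0 => // n /= /HN h; rewrite distrC; apply: le_trans h _.
  by rewrite mulrC -ler_pdivlMr// ge_min lexx orbT.
apply/fine_cvgP; split.
  by exists 1 => // n /= n1; rewrite -/(A n) PA.
apply: cvg_trans pc; apply: near_eq_cvg; exists 1 => // n /= n1.
by rewrite -/(A n) PA.
Qed.

End Assembly.


Theorem theorem1p1 (R : realType) (p1 : R) (hp1 : 0 <= p1 <= 1) :
  let alpha1 := 2 * p1 - 1 in
  exists C : R, 0 < C /\
  forall (d : measure_display) (T : measurableType d) (P : probability T R)
    (xi1 xi2 : nat -> T -> bool) (u1 u2 : nat -> T -> nat) (x1 x2 : int),
    (x1 = 1 \/ x1 = -1) -> (x2 = 1 \/ x2 = -1) ->
    two_elephant_model P p1 (2^-1) xi1 xi2 u1 u2 ->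
    let S1 := ew_S1 x1 x2 xi1 xi2 u1 u2 in
    [/\ (* (i) law of the iterated logarithm bounds *)
        {ae P, forall w, (C%:E <= limn_esup (fun n =>
              ((S1 n w)%:~R / Num.sqrt (2 * n%:R * ln (ln n%:R)))%:E))%E /\
           (limn_esup (fun n =>
              ((S1 n w)%:~R / Num.sqrt (2 * n%:R * ln (ln n%:R)))%:E)
              <= (1 + Num.sqrt 2 * `|alpha1|)%:E)%E},
        (* (i) recurrence *)
        {ae P, forall w, forall z : int, forall N : nat,
            exists2 n : nat, (N <= n)%N & S1 n w = z}
      & (* (ii) central limit theorem *)
        cvg_in_distribution P
          (fun n w => (S1 n w)%:~R / Num.sqrt ((1 + 2 * alpha1 ^+ 2) * n%:R))
          (normal_prob 0 1)].
Proof.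
move=> alpha1; exists 4000^-1; split; first by rewrite invr_gt0; lra.
move=> d T P xi1 xi2 u1 u2 x1 x2 x1_pm x2_pm model S1; split.
- exact: (limsup_ae model hp1 x1_pm x2_pm).
- exact: (recurrence_ae model hp1 x1_pm x2_pm).
- exact: (cvg_standard_normal model hp1 x1_pm x2_pm).
Qed.
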